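(* Let $\mathbb{L}>0$, $\sigma>0$, $x_0\in\mathbb{R}$, and let $V,p\colon\mathbb{R}\to\mathbb{R}$ satisfy: (i) $V,p\in C^2(\mathbb{R})$, $V(0)=0$, $p(0)=0$, and $p$ is $\mathbb{L}$-periodic; (ii) $V'$ is globally Lipschitz on $\mathbb{R}$ with Lipschitz constant $L_V>0$; (iii) there exist $\beta>0$ and $R\ge 1$ such that $-\operatorname{sign}(x)V'(x)\le -\beta|x|$ for all $|x|\ge R$. For $\varepsilon>0$ let $X^\varepsilon$ be the solution of $$\mathrm{d}X_t^\varepsilon=-V'(X_t^\varepsilon)\,\mathrm{d}t-\frac1\varepsilon p'\!\left(\frac{X_t^\varepsilon}{\varepsilon}\right)\mathrm{d}t+\sqrt{2\sigma^2}\,\mathrm{d}W_t,\qquad X_0^\varepsilon=x_0,$$ where $W$ is a standard one-dimensional Brownian motion. For $N\in\mathbb{N}$ and $T>0$ define the estimator $$\widehat\rho_N^{T,\varepsilon}(x)=\sum_{n=0}^{N-1}\widehat\alpha_n^{T,\varepsilon}\psi_n(x),\qquad \widehat\alpha_n^{T,\varepsilon}=\frac1T\int_0^T\psi_n(X_t^\varepsilon)\,\mathrm{d}t,$$ and let $\rho(x)=\frac1Z e^{-V(x)/\sigma^2}$ with $Z=\int_\mathbb{R}e^{-V(x)/\sigma^2}\,\mathrm{d}x$. Set $$c=\frac{\sigma^2+1}{\sigma^2},\qquad l=\frac{L_V+|V'(0)|}{\sigma^2},\qquad r=\frac{\beta}{\sigma^2}.$$ Let $\kappa>0$, and let $\gamma,\zeta$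 satisfy $$\gamma>\begin{cases}3+\log(8),&\text{if }\sigma=1,\\ c^2+\max\left\{16e^{3/2},\ \frac c4\left(\log\left|\frac2c-1\right|+2\log(4)\right)\right\},&\text{if }\sigma\neq1,\end{cases}\qquad \zeta>\begin{cases}5,&\text{if } r\ge l,\\ 5\frac lr,&\text{if } r<l.\end{cases}$$ Define $N(\varepsilon)=\left\lfloor\frac{\pi^2}{\gamma\mathbb{L}^2\varepsilon^2}\right\rfloor$ and $T(\varepsilon)=\kappa\varepsilon^{-\zeta}$. Then $$\lim_{\varepsilon\to0}\mathbb{E}\left[\left\|\widehat\rho_{N(\varepsilon)}^{T(\varepsilon),\varepsilon}-\rho\right\|_{L^2(\mathbb{R})}^2\right]=0.$$
   Context: $H_n$ denotes the $n$-th physicist's Hermite polynomial and $\psi_n(x)=\frac{1}{\sqrt{\sqrt\pi\,2^n n!}}e^{-x^2/2}H_n(x)$, $n\in\mathbb{N}\cup\{0\}$, are the Hermite functions, an orthonormal basis of $L^2(\mathbb{R})$. The density $\rho$ is the invariant density of the homogenized limit of the multiscale SDE. The expectation is with respect to the Brownian motion driving $X^\varepsilon$ (the initial condition $x_0$ is deterministic). *)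

(* Defs.v *)
From HB Require Import structures.
From mathcomp Require Import all_boot all_order all_algebra.
From mathcomp Require Import all_classical all_reals all_analysis.
Set Implicit Arguments. Unset Strict Implicit. Unset Printing Implicit Defensive.
Import Order.TTheory GRing.Theory Num.Theory.
Import numFieldNormedType.Exports.
Local Open Scope classical_set_scope.
Local Open Scope ring_scope.

Section Defs.
Context {R : realType}.

(* physicist's Hermite polynomials: H_0 = 1, H_1 = 2x,
   H_{n+1} = 2x H_n - 2n H_{n-1};  hermite_pair n x = (H_n x, H_{n+1} x) *)
Fixpoint hermite_pair (n : nat) (x : R) : R * R :=
  match n with
  | 0%N => (1, 2 * x)
  | n'.+1 => let (a, b) := hermite_pair n' x in (b, 2 * x * b - 2 * (n'.+1)%:R * a)
  end.

Definition hermite (n : nat) (x : R) : R := (hermite_pair n x).1.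

Definition hermite_fun (n : nat) (x : R) : R :=
  (Num.sqrt (Num.sqrt pi * 2 ^+ n * (n`!)%:R))^-1 * expR (- x ^+ 2 / 2) * hermite n x.

Definition C2 (f : R -> R) : Prop :=
  (forall x, derivable f x 1) /\ (forall x, derivable (derive1 f) x 1) /\
  continuous (derive1 (derive1 f)).

Definition is_brownian_motion {d : measure_display} {Omega : measurableType d}
    (P : probability Omega R) (W : Omega -> R -> R) : Prop :=
  (forall t, 0 <= t -> measurable_fun setT (fun w => W w t)) /\
  (forall w, W w 0 = 0) /\
  (forall w, {within `[0, +oo[, continuous (W w)}) /\
  (forall (n : nat) (t : nat -> R), t 0%N = 0 ->
     (forall i, (i < n)%N -> t i < t i.+1) ->
     forall A : nat -> set R, (forall i, measurable (A i)) ->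
     fine (P (\bigcap_(i in `I_n) [set w | A i (W w (t i.+1) - W w (t i))]))
     = \prod_(i < n) fine (normal_prob 0 (Num.sqrt (t i.+1 - t i)) (A i))).

Definition solves_sde {d : measure_display} {Omega : measurableType d}
    (V p : R -> R) (sigma eps x0 : R) (W : Omega -> R -> R)
    (X : Omega -> R -> R) : Prop :=
  forall w, {within `[0, +oo[, continuous (X w)} /\
    forall t, 0 <= t ->
      X w t = x0
        - Rintegral lebesgue_measure `[0, t]
            (fun s => derive1 V (X w s) + eps^-1 * derive1 p (X w s / eps))
        + Num.sqrt (2 * sigma ^+ 2) * W w t.

Definition alpha_hat (X : R -> R) (T : R) (n : nat) : R :=
  T^-1 * Rintegral lebesgue_measure `[0, T] (fun t => hermite_fun n (X t)).

Definition rho_hat (X : R -> R) (T : R) (N : nat) (x : R) : R :=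
  \sum_(n < N) alpha_hat X T n * hermite_fun n x.

Definition Zconst (V : R -> R) (sigma : R) : R :=
  Rintegral lebesgue_measure setT (fun x => expR (- V x / sigma ^+ 2)).

Definition rho (V : R -> R) (sigma : R) (x : R) : R :=
  expR (- V x / sigma ^+ 2) / Zconst V sigma.

End Defs.

(* Main.v *)
(** The law of large numbers and the homogenization error are both made
    quantitative in [eps].

    - Statistical error. Let [L] be the generator of [X^eps], let [f = psi_n],
      and let [alpha] be its mean under the invariant density, which is
      proportional to [w_eps = exp (- (V + p (./eps)) / sigma^2)]. The Poisson
      equation [L u = alpha - f] has an explicit solution in which
      [v = u'] is bounded uniformly in [n] and [eps], because
      [psi_n] has unit norm and [w_eps] has Gaussian tails. Ito's formula for [u]
      would turn [\int_0^T (alpha - f (X_t)) dt] into a boundary term minus a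
      martingale; here it is carried out on Euler schemes for a truncated drift,
      whose paths converge to [X^eps], and Fatou's lemma passes to the limit. This
      gives a mean square error [O (1 / (eps^2 T))] for each coefficient.
    - Homogenization error. [w_eps = rho q (./eps)] up to constants, with [q]
      periodic. For a zero mean periodic [q = Q''], integrating by parts twice
      and using [psi_n'' = (x^2 - (2 n + 1)) psi_n] trades [psi_n] against
      [rho q (./eps)] for [eps^2 (2 n + 1)] times [psi_n] against [rho Q (./eps)].
      Since [|Q| <= LL^2 |q| / 16] and [n < N(eps)], each step gains a factor
      at most 1/2 as soon as [gamma >= 4]; iterating makes the sum over [n] of the
      squared biases small.
    - Truncation error. If [f] is orthogonal to [psi_0, ..., psi_(N-1)], then
      [2 N |f|^2 <= |x f + f'|^2].

    With [N(eps) = O (eps^-2)] and [T(eps)] of order [eps^-zeta], [zeta >= 5], the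
    total risk vanishes. *)
Require Import Defs.
From HB Require Import structures.
From mathcomp Require Import all_boot all_order all_algebra.
From mathcomp Require Import all_classical all_reals all_analysis.
From mathcomp Require Import ring lra measurable_realfun.
Import Order.TTheory GRing.Theory Num.Theory.
Import numFieldNormedType.Exports.
Local Open Scope classical_set_scope.
Local Open Scope ring_scope.

Set Implicit Arguments. Unset Strict Implicit. Unset Printing Implicit Defensive.

(** * Derivatives on the whole line and Taylor estimates *)

Section Derivatives.
Context {R : realType}.
Implicit Types (f g df dg : R -> R).

(** Only the pathwise integral equation and the law of Brownian increments on finite grids are
    given, so every probabilistic estimate is a one-step Gaussian computation iterated by a discrete
    Gronwall bound. Two families of constants are kept apart. Those of the truncated problem (bounds
    on the clamped drift and on the derivatives of the cut-off test function) depend on the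
    truncation level; they occur only multiplied by the step size, which is chosen after them. Those
    that survive are the bound on [v], the noise strength and a dissipativity constant. The last one
    is the source of [eps^-2]: completing the square between the confinement [beta y^2] and the fast
    drift of size [1 / eps] costs [eps^-2]. It enters because only the derivative of [u] is bounded,
    so the boundary term is controlled by the second moment of the displacement. The exponent 5
    balances [N] coefficients, each with error [eps^-2 / T]: the total [eps^-4 * eps^5] tends to 0.
    All integrals over the line are taken in one class with Gaussian decay, where integrability and
    vanishing boundary terms are automatic. *)

Definition has_deriv f df := forall x : R, is_derive x (1 : R) f (df x).

Lemma has_deriv_eq f df dg : has_deriv f df -> (forall x, df x = dg x) ->
  has_deriv f dg.
Proof. by move=> h e x; rewrite -e; exact: h. Qed.

Lemma has_deriv_cst (c : R) : has_deriv (fun=> c) (fun=> 0).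
Proof. by move=> x; exact: is_derive_cst. Qed.

Lemma has_deriv_id : has_deriv (fun x => x) (fun=> 1).
Proof. by move=> x; exact: is_derive_id. Qed.

Lemma has_derivD f g df dg : has_deriv f df -> has_deriv g dg ->
  has_deriv (fun x => f x + g x) (fun x => df x + dg x).
Proof. by move=> hf hg x; exact: is_deriveD. Qed.

Lemma has_derivN f df : has_deriv f df ->
  has_deriv (fun x => - f x) (fun x => - df x).
Proof. by move=> hf x; exact: is_deriveN. Qed.

Lemma has_derivB f g df dg : has_deriv f df -> has_deriv g dg ->
  has_deriv (fun x => f x - g x) (fun x => df x - dg x).
Proof. by move=> hf hg x; exact: is_deriveB. Qed.

Lemma has_derivM f g df dg : has_deriv f df -> has_deriv g dg ->
  has_deriv (fun x => f x * g x) (fun x => df x * g x + f x * dg x).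
Proof.
move=> hf hg x; apply: (is_derive_eq (is_deriveM (hf x) (hg x))).
by rewrite /GRing.scale /=; ring.
Qed.

Lemma has_derivZ (c : R) f df : has_deriv f df ->
  has_deriv (fun x => c * f x) (fun x => c * df x).
Proof. by move=> hf x; exact: is_deriveZ. Qed.

Lemma has_deriv_comp f g df dg : has_deriv f df -> has_deriv g dg ->
  has_deriv (fun x => f (g x)) (fun x => df (g x) * dg x).
Proof. by move=> hf hg x; apply: is_derive1_comp. Qed.

Lemma has_deriv_exp f df : has_deriv f df ->
  has_deriv (fun x => expR (f x)) (fun x => df x * expR (f x)).
Proof.
move=> hf; apply: (@has_deriv_eq _ (fun x => expR (f x) * df x)).
  by apply: (@has_deriv_comp expR) => // x; exact: is_derive_expR.
by move=> x; rewrite mulrC.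
Qed.

Lemma has_deriv_cont {f df} : has_deriv f df -> continuous f.
Proof.
move=> hf x; apply: differentiable_continuous.
by apply/derivable1_diffP; case: (hf x).
Qed.

Lemma has_deriv_uniq {f df dg} : has_deriv f df -> has_deriv f dg ->
  forall x, df x = dg x.
Proof. by move=> h1 h2 x; case: (h1 x) => _ <-; case: (h2 x) => _ <-. Qed.

Lemma has_deriv_derive1 f : (forall x, derivable f x 1) -> has_deriv f (derive1 f).
Proof. by move=> h x; rewrite derive1E; apply: derivableP. Qed.

Lemma derive1_has_deriv f df : has_deriv f df -> (derive1 f) = df.
Proof. by move=> h; apply/funext => x; rewrite derive1E; case: (h x). Qed.

Lemma has_deriv_MVT f df a b : has_deriv f df -> a <= b ->
  exists2 c, a <= c <= b & f b - f a = df c * (b - a).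
Proof.
move=> h ab; have [|c] := MVT_segment ab (fun x _ => h x).
  by apply: continuous_subspaceT; exact: has_deriv_cont h.
by rewrite in_itv; exists c.
Qed.

Lemma has_deriv_lip f df (a b K : R) : has_deriv f df ->
  (forall x, `|x - a| <= `|b - a| -> `|df x| <= K) ->
  `|f b - f a| <= K * `|b - a|.
Proof.
move=> h hK; case: (leP a b) => ab.
  have [c /andP[ac cb] ->] := has_deriv_MVT h ab.
  rewrite normrM ler_wpM2r// hK//.
  by rewrite !ger0_norm ?subr_ge0// lerD2r.
have [c /andP[bc ca]] := has_deriv_MVT h (ltW ab).
rewrite distrC => ->; rewrite normrM (distrC b) ler_wpM2r// hK//.
by rewrite [leLHS]distrC [leRHS]distrC !ger0_norm ?subr_ge0// ?lerB// ltW.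
Qed.

Lemma has_deriv0_cst f : has_deriv f (fun=> 0) -> forall x y, f x = f y.
Proof. by move=> h x y; exact: is_derive_0_is_cst. Qed.

Lemma has_deriv_cst_diff {f g df} : has_deriv f df -> has_deriv g df ->
  forall x y, f x - f y = g x - g y.
Proof.
move=> hf hg x y.
have h : has_deriv (fun x => f x - g x) (fun=> 0).
  by apply: has_deriv_eq (has_derivB hf hg) _ => z; rewrite subrr.
have /= := has_deriv0_cst h x y; lra.
Qed.

(** The quadratic majorant plus or minus the remainder, [G s] with [s = 1] or [s = -1], has a
    derivative with the sign of [z - x]; so it is smallest at [x], where it vanishes. *)
Lemma taylor1_bound f df (K : R) (x y : R) : has_deriv f df ->
  (forall z, `|df z - df x| <= K * `|z - x|) ->
  `|f y - f x - df x * (y - x)| <= K / 2 * (y - x) ^+ 2.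
Proof.
move=> h hK.
pose G s := fun z => K / 2 * ((z - x) * (z - x)) + s * (f z - f x - df x * (z - x)).
have hG s : has_deriv (G s) (fun z => K * (z - x) + s * (df z - df x)).
  rewrite /G; have hx : has_deriv (fun z => z - x) (fun=> 1).
    by apply: has_deriv_eq (has_derivB has_deriv_id (has_deriv_cst x)) _ => z; lra.
  have hd := has_derivD (has_derivZ (K / 2) (has_derivM hx hx))
    (has_derivZ s (has_derivB (has_derivB h (has_deriv_cst (f x)))
       (has_derivZ (df x) hx))).
  by apply: has_deriv_eq hd _ => z; field.
have H s : `|s| = 1 -> 0 <= G s y.
  move=> s1; have Gx : G s x = 0 by rewrite /G; ring.
  case: (leP x y) => xy.
    have [c /andP[xc cy]] := has_deriv_MVT (hG s) xy.
    rewrite Gx subr0 => ->; apply: mulr_ge0; last by rewrite subr_ge0.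
    have := hK c; rewrite (ger0_norm (_ : 0 <= c - x)) ?subr_ge0// => k.
    have : `|s * (df c - df x)| <= K * (c - x) by rewrite normrM s1 mul1r.
    rewrite ler_norml; lra.
  have [c /andP[xc cy]] := has_deriv_MVT (hG s) (ltW xy).
  rewrite Gx sub0r => /(congr1 -%R); rewrite opprK => ->; rewrite -mulNr.
  apply: mulr_ge0; last by rewrite subr_ge0 ltW.
  have := hK c; rewrite (ler0_norm (_ : c - x <= 0)) ?subr_le0// => k.
  have : `|s * (df c - df x)| <= K * - (c - x) by rewrite normrM s1 mul1r.
  rewrite ler_norml; lra.
have := H 1 (normr1 R); have := H (-1) (normrN1 R).
rewrite /G expr2 ler_norml; lra.
Qed.

(** The remainder [G] has derivative [v t - v x - w x * (t - x)], which the first-order estimate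
    bounds by [K * (t - x) ^ 2]; the mean value inequality then adds one power. The sharp constant
    [K / 6] is not sought. *)
Lemma taylor2_bound u v w z (K : R) (x y : R) : has_deriv u v ->
  has_deriv v w -> has_deriv w z -> (forall t, `|z t| <= K) ->
  `|u y - u x - v x * (y - x) - w x / 2 * (y - x) ^+ 2| <= K * `|y - x| ^+ 3.
Proof.
move=> hu hv hw hK.
have K0 : 0 <= K by apply: le_trans (hK 0).
have hwx t : `|w t - w x| <= K * `|t - x| by apply: has_deriv_lip hw _ => *.
have hvx t : `|v t - v x - w x * (t - x)| <= K * `|t - x| ^+ 2.
  have -> : `|t - x| ^+ 2 = (t - x) ^+ 2 by rewrite real_normK// num_real.
  apply: le_trans (taylor1_bound t hv hwx) _.
  by rewrite ler_wpM2r ?sqr_ge0//; lra.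
have hxx : has_deriv (fun z => z - x) (fun=> 1).
  by apply: has_deriv_eq (has_derivB has_deriv_id (has_deriv_cst x)) _ => t; lra.
pose G := fun t => u t - v x * (t - x) - w x / 2 * ((t - x) * (t - x)).
have hG : has_deriv G (fun t => v t - v x - w x * (t - x)).
  rewrite /G.
  have hd := has_derivB (has_derivB hu (has_derivZ (v x) hxx))
    (has_derivZ (w x / 2) (has_derivM hxx hxx)).
  by apply: has_deriv_eq hd _ => t; field.
have -> : u y - u x - v x * (y - x) - w x / 2 * (y - x) ^+ 2 = G y - G x.
  by rewrite /G; ring.
have -> : K * `|y - x| ^+ 3 = (K * `|y - x| ^+ 2) * `|y - x| by ring.
apply: has_deriv_lip hG _ => t tx; apply: le_trans (hvx t) _.
by rewrite ler_wpM2l// lerXn2r ?nnegrE.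
Qed.

End Derivatives.

(** * Functions with Gaussian decay and with polynomial growth *)

Section GaussianDecay.
Context {R : realType}.
Implicit Types (f g k df dg F : R -> R).
Local Notation leb := (@lebesgue_measure R).

Lemma contD f g : continuous f -> continuous g -> continuous (fun x => f x + g x).
Proof. by move=> hf hg x; apply: cvgD; [exact: hf|exact: hg]. Qed.

Lemma contN f : continuous f -> continuous (fun x => - f x).
Proof. by move=> hf x; apply: cvgN; exact: hf. Qed.

Lemma contM f g : continuous f -> continuous g -> continuous (fun x => f x * g x).
Proof. by move=> hf hg x; apply: cvgM; [exact: hf|exact: hg]. Qed.

Lemma cont_cst (c : R) : continuous (fun _ : R => c).
Proof. by move=> x; exact: cvg_cst. Qed.

Lemma cont_id : continuous (fun x : R => x).
Proof. by move=> x; exact: cvg_id. Qed.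

Lemma cont_comp f g : continuous f -> continuous g -> continuous (fun x => f (g x)).
Proof. by move=> hf hg x; apply: continuous_comp; [exact: hg|exact: hf]. Qed.

Lemma cont_norm f : continuous f -> continuous (fun x => `|f x|).
Proof. by move=> hf x; apply: cvg_norm; exact: hf. Qed.

Lemma cont_integrable f a b : continuous f -> leb.-integrable `[a, b] (EFin \o f).
Proof.
move=> cf; apply: continuous_compact_integrable; first exact: segment_compact.
exact: continuous_subspaceT.
Qed.

(** An integral from a fixed limit only covers the points to its right, and [f] may fail to be
    integrable at [-oo]. The lower limit therefore follows [x]; subtracting the integral up to 0
    cancels the dependence on it. *)
Lemma has_antideriv f : continuous f -> exists F, has_deriv F f.
Proof.
move=> cf.
pose J a x := Rintegral leb `[a, x] f.
have HJ a b x : a <= b -> b <= x -> J a x - J a b = Rintegral leb `]b, x] f.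
  move=> ab bx; rewrite /J Rintegral_itvB//; first exact: cont_integrable.
pose F x := J (- (`|x| + 1)) x - J (- (`|x| + 1)) 0.
exists F => x; change (is_derive x 1 F (f x)).
(* A fixed limit lying below [- (|y| + 1)] for every [y] within distance 1 of [x], so that near [x]
   the function [F] is an integral from [a] up to a constant. *)
pose a := - (`|x| + 3).
have [dJ eJ] : derivable (J a) x 1 /\ derive1 (J a) x = f x.
  apply: (@continuous_FTC1 R f (BLeft a) x (x + 1)) => //.
  - by rewrite ltrDl.
  - exact: cont_integrable.
  - by rewrite lte_fin /a; have := ler_norm (- x); rewrite normrN; lra.
  - exact: cf.
apply: (@near_eq_is_derive _ _ _ (fun y => J a y - J a 0)); last first.
  have dJ' : is_derive x 1 (J a) (f x) by rewrite -eJ derive1E; exact: derivableP.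
  have := is_deriveB dJ' (is_derive_cst (J a 0) x (1 : R)).
  by rewrite subr0.
have near1 : \forall y \near x, `|x - y| < 1 by apply/nbhs_normP; exists 1 => //=.
near=> y.
have xy : `|x - y| < 1 by near: y.
have ya : `|y| <= `|x| + 1.
  by have := ler_normD (y - x) x; rewrite subrK distrC; lra.
have := HJ a (- (`|y| + 1)) y; have := HJ a (- (`|y| + 1)) 0.
have := ler_norm (- y); have := normr_ge0 y; rewrite normrN /a => y0 y1 h1 h2.
have := h1 ltac:(lra) ltac:(lra); have := h2 ltac:(lra) ltac:(lra).
have J0 z : Rintegral leb `]- (`|y| + 1), z] f = J (- (`|y| + 1)) z.
  rewrite Rintegral_itv_obnd_cbnd//.
  apply: (integrableS _ _ _ (cont_integrable (- (`|y| + 1)) z cf)) => // u /=.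
  by rewrite !in_itv/= => /andP[/ltW h3 h4]; rewrite h3 h4.
rewrite !J0.
rewrite /F; lra.
Unshelve. all: by end_near. Qed.

Lemma Rintegral_deriv F f a b : a <= b -> continuous f -> has_deriv F f ->
  Rintegral leb `[a, b] f = F b - F a.
Proof.
rewrite le_eqVlt => /predU1P[->|ab] cf hF.
  by rewrite set_itv1 Rintegral_set1 subrr.
rewrite /Rintegral (@continuous_FTC2 R f F a b) => //.
- exact: continuous_subspaceT.
- have cF := has_deriv_cont hF; split.
  + by move=> x _; case: (hF x).
  + by apply: cvg_at_right_filter; exact: cF.
  + by apply: cvg_at_left_filter; exact: cF.
- by move=> x _; rewrite (derive1_has_deriv hF).
Qed.

(** The rate is existential, so the class is stable under sums, products and polynomial factors; the
    sign of [C] is recovered by evaluating at 0. *)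
Definition gdecay f := continuous f /\
  exists C d, 0 < d /\ forall x, `|f x| <= C * expR (- (d * x ^+ 2)).

Lemma gdecayP f C d : continuous f -> 0 < d ->
  (forall x, `|f x| <= C * expR (- (d * x ^+ 2))) -> gdecay f.
Proof. by move=> cf d0 h; split => //; exists C, d. Qed.

Lemma gdecay_nonneg f : gdecay f -> exists C d,
  [/\ 0 <= C, 0 < d & forall x, `|f x| <= C * expR (- (d * x ^+ 2))].
Proof.
move=> [_ [C [d [d0 h]]]]; exists C, d; split => //.
by have := h 0; rewrite expr0n mulr0 oppr0 expR0 mulr1; exact: le_trans.
Qed.

Lemma eq_gdecay f g : gdecay f -> (forall x, f x = g x) -> gdecay g.
Proof. by move=> h fg; rewrite (_ : g = f)//; apply/funext => x. Qed.

Lemma gdecayZ (c : R) f : gdecay f -> gdecay (fun x => c * f x).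
Proof.
move=> h; have [C [d [C0 d0 hC]]] := gdecay_nonneg h.
apply: (@gdecayP _ (`|c| * C) d) => //.
  by apply: contM; [exact: cont_cst|case: h].
by move=> x; rewrite normrM -mulrA ler_wpM2l.
Qed.

Lemma gdecayN f : gdecay f -> gdecay (fun x => - f x).
Proof. by move=> h; apply: eq_gdecay (gdecayZ (-1) h) _ => x; rewrite mulN1r. Qed.

Lemma gdecayD f g : gdecay f -> gdecay g -> gdecay (fun x => f x + g x).
Proof.
move=> hf hg; have [C [d [C0 d0 hC]]] := gdecay_nonneg hf.
have [C' [d' [C0' d0' hC']]] := gdecay_nonneg hg.
apply: (@gdecayP _ (C + C') (Num.min d d')).
- by apply: contD; [case: hf|case: hg].
- by rewrite lt_min d0.
move=> x; apply: le_trans (ler_normD _ _) _; rewrite mulrDl lerD//.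
  apply: le_trans (hC x) _; rewrite ler_wpM2l// ler_expR lerN2.
  by rewrite ler_wpM2r ?sqr_ge0// ge_min lexx.
apply: le_trans (hC' x) _; rewrite ler_wpM2l// ler_expR lerN2.
by rewrite ler_wpM2r ?sqr_ge0// ge_min lexx orbT.
Qed.

Lemma gdecayB f g : gdecay f -> gdecay g -> gdecay (fun x => f x - g x).
Proof. by move=> hf hg; apply: gdecayD => //; exact: gdecayN. Qed.

Lemma gdecay_mul_bounded f g (K : R) : gdecay f -> continuous g ->
  (forall x, `|g x| <= K) -> gdecay (fun x => f x * g x).
Proof.
move=> hf cg hK; have [C [d [C0 d0 hC]]] := gdecay_nonneg hf.
apply: (@gdecayP _ (C * K) d) => //; first by apply: contM => //; case: hf.
by move=> x; rewrite normrM mulrAC ler_pM.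
Qed.

Lemma expRN_le1 (x : R) : 0 <= x -> expR (- x) <= 1.
Proof. by move=> x0; rewrite -[leRHS]expR0 ler_expR oppr_le0. Qed.

Lemma gdecay_bounded f : gdecay f -> exists K, forall x, `|f x| <= K.
Proof.
move=> hf; have [C [d [C0 d0 hC]]] := gdecay_nonneg hf; exists C => x.
apply: le_trans (hC x) _; rewrite -[leRHS]mulr1 ler_wpM2l// expRN_le1//.
by rewrite mulr_ge0 ?sqr_ge0// ltW.
Qed.

Lemma gdecayM f g : gdecay f -> gdecay g -> gdecay (fun x => f x * g x).
Proof.
move=> hf hg; have [K hK] := gdecay_bounded hg.
by apply: gdecay_mul_bounded hK => //; case: hg.
Qed.

(** Half of the Gaussian exponent pays for the factor, since
    [1 + x^2 <= (1 + 2 / d) exp (d x^2 / 2)]. *)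
Lemma gdecay_mul1sqr f : gdecay f -> gdecay (fun x => (1 + x ^+ 2) * f x).
Proof.
move=> hf; have [C [d [C0 d0 hC]]] := gdecay_nonneg hf.
apply: (@gdecayP _ ((1 + 2 / d) * C) (d / 2)).
- apply: contM; last by case: hf.
  apply: contD; [exact: cont_cst|exact: exprn_continuous].
- by rewrite divr_gt0.
move=> x; have x2 := sqr_ge0 x.
rewrite normrM ger0_norm; last lra.
have e1 := expR_ge1Dx (d / 2 * x ^+ 2).
have -> : (1 + 2 / d) * C * expR (- (d / 2 * x ^+ 2)) =
   ((1 + 2 / d) * expR (d / 2 * x ^+ 2)) * (C * expR (- (d * x ^+ 2))).
  have -> : - (d / 2 * x ^+ 2) = d / 2 * x ^+ 2 + - (d * x ^+ 2) by field.
  by rewrite expRD; ring.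
apply: ler_pM => //; first lra.
apply: (@le_trans _ _ ((1 + 2 / d) * (1 + d / 2 * x ^+ 2))).
  have -> : (1 + 2 / d) * (1 + d / 2 * x ^+ 2) = 1 + x ^+ 2 + (2 / d + d / 2 * x ^+ 2).
    by field; rewrite gt_eqF.
  have h1 : 0 <= 2 / d by rewrite divr_ge0// ltW.
  have h2 : 0 <= d / 2 * x ^+ 2 by apply: mulr_ge0 => //; lra.
  lra.
by rewrite ler_wpM2l// addr_ge0// divr_ge0// (ltW d0).
Qed.

(** Powers of [1 + x ^ 2] are at least 1, so exponents can be added or enlarged freely, and each
    power is absorbed by one use of [gdecay_mul1sqr]. *)
Definition pgrowth f := continuous f /\
  exists C n, forall x, `|f x| <= C * (1 + x ^+ 2) ^+ n.

Lemma gdecayMp f g : gdecay f -> pgrowth g -> gdecay (fun x => f x * g x).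
Proof.
move=> hf [cg [C [n hC]]].
have h : gdecay (fun x => (1 + x ^+ 2) ^+ n * f x).
  elim: n {hC} => [|n IH]; first by apply: eq_gdecay hf _ => x; rewrite expr0 mul1r.
  by apply: eq_gdecay (gdecay_mul1sqr IH) _ => x; rewrite (exprS _ n) mulrA.
have [K [d [K0 d0 hK]]] := gdecay_nonneg h.
apply: (@gdecayP _ (C * K) d) => //; first by apply: contM => //; case: hf.
move=> x; rewrite normrM.
have C0 : 0 <= C.
  by have := hC 0; rewrite expr0n addr0 expr1n mulr1; exact: le_trans.
apply: (@le_trans _ _ (`|f x| * (C * (1 + x ^+ 2) ^+ n))); first by rewrite ler_wpM2l.
have := hK x; rewrite normrM ger0_norm; last first.
  by apply: exprn_ge0; rewrite addr_ge0 ?sqr_ge0.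
move=> /(ler_wpM2l C0); rewrite mulrA; congr (_ <= _); ring.
Qed.

Lemma one_le_1sqr (x : R) n : 1 <= (1 + x ^+ 2) ^+ n.
Proof. by apply: exprn_ege1; rewrite lerDl sqr_ge0. Qed.

Lemma pgrowth_nonneg f : pgrowth f -> exists C n,
  0 <= C /\ forall x, `|f x| <= C * (1 + x ^+ 2) ^+ n.
Proof.
move=> [_ [C [n h]]]; exists C, n; split => //.
by have := h 0; rewrite expr0n addr0 expr1n mulr1; exact: le_trans.
Qed.

Lemma pgrowth_bounded f K : continuous f -> (forall x, `|f x| <= K) -> pgrowth f.
Proof. by move=> cf h; split => //; exists K, 0%N => x; rewrite expr0 mulr1. Qed.

Lemma pgrowth_lin f (a b : R) : continuous f -> 0 <= a -> 0 <= b ->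
  (forall x, `|f x| <= a + b * `|x|) -> pgrowth f.
Proof.
move=> cf a0 b0 h; split => //; exists (a + b), 1%N => x; rewrite expr1.
apply: le_trans (h x) _; have : `|x| <= 1 + x ^+ 2.
  by have := sqr_ge0 (`|x| - 1); rewrite sqrrB expr1n real_normK ?num_real//;
    have := sqr_ge0 x; lra.
have x2 := sqr_ge0 x => h1; rewrite mulrDl lerD//; last by rewrite ler_wpM2l.
by rewrite ler_peMr// lerDl.
Qed.

Lemma gdecay_pgrowth f : gdecay f -> pgrowth f.
Proof.
by move=> h; have [K hK] := gdecay_bounded h; apply: pgrowth_bounded hK; case: h.
Qed.

Lemma pgrowthM f g : pgrowth f -> pgrowth g -> pgrowth (fun x => f x * g x).
Proof.
move=> hf hg; have [C [n [C0 h]]] := pgrowth_nonneg hf.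
have [C' [n' [C0' h']]] := pgrowth_nonneg hg.
split; first by apply: contM; [case: hf|case: hg].
exists (C * C'), (n + n')%N => x; rewrite normrM exprD.
have := ler_pM (normr_ge0 _) (normr_ge0 _) (h x) (h' x).
by congr (_ <= _); ring.
Qed.

Lemma pgrowthZ (c : R) f : pgrowth f -> pgrowth (fun x => c * f x).
Proof.
move=> h; apply: pgrowthM => //; apply: (@pgrowth_bounded _ `|c|) => //.
exact: cont_cst.
Qed.

Lemma pgrowthD f g : pgrowth f -> pgrowth g -> pgrowth (fun x => f x + g x).
Proof.
move=> hf hg; have [C [n [C0 h]]] := pgrowth_nonneg hf.
have [C' [n' [C0' h']]] := pgrowth_nonneg hg.
split; first by apply: contD; [case: hf|case: hg].
exists (C + C'), (n + n')%N => x; apply: le_trans (ler_normD _ _) _.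
have e1 := one_le_1sqr x n; have e2 := one_le_1sqr x n'.
rewrite mulrDl exprD; apply: lerD.
  apply: le_trans (h x) _; rewrite ler_wpM2l// ler_peMr//; lra.
apply: le_trans (h' x) _; rewrite ler_wpM2l// ler_peMl//; lra.
Qed.

Lemma eq_pgrowth f g : pgrowth f -> (forall x, f x = g x) -> pgrowth g.
Proof. by move=> h fg; rewrite (_ : g = f)//; apply/funext => x. Qed.

Lemma pgrowth_cst (c : R) : pgrowth (fun=> c).
Proof. by apply: (@pgrowth_bounded _ `|c|) => //; exact: cont_cst. Qed.

Lemma pgrowth_id : pgrowth (fun x => x).
Proof.
by apply: (@pgrowth_lin _ 0 1) => // [|x]; [exact: cont_id|rewrite add0r mul1r].
Qed.

End GaussianDecay.

(** * Integrals over the line, primitives and integration by parts *)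

Section Integral.
Context {R : realType}.
Implicit Types (f g df dg F : R -> R).
Local Notation leb := (@lebesgue_measure R).

Definition integ f : R := Rintegral leb setT f.

Lemma normal_pdf_gauss (m d : R) : 0 < d -> exists2 c : R, 0 < c &
  forall x, normal_pdf m (Num.sqrt (2 * d)^-1) x = c * expR (- (d * (x - m) ^+ 2)).
Proof.
move=> d0; set s := Num.sqrt _.
have s2 : s ^+ 2 = (2 * d)^-1 by rewrite sqr_sqrtr// invr_ge0; lra.
have s0 : s != 0 by rewrite gt_eqF// sqrtr_gt0 invr_gt0; lra.
exists (normal_peak s); first exact: normal_peak_gt0.
move=> x; rewrite normal_pdfE// /normal_fun s2; congr (_ * expR _).
by field; rewrite gt_eqF.
Qed.

Lemma integrable_gauss (m d : R) : 0 < d ->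
  leb.-integrable setT (EFin \o (fun t => expR (- (d * (t - m) ^+ 2)))).
Proof.
move=> d0; have [c c0 h] := normal_pdf_gauss m d0.
have := integrableZl measurableT (c^-1) (integrable_normal_pdf m (Num.sqrt (2 * d)^-1)).
apply: eq_integrable => // t _.
by rewrite /= -EFinM h mulrA mulVf ?gt_eqF// mul1r.
Qed.

Lemma gdecay_integrable f : gdecay f -> leb.-integrable setT (EFin \o f).
Proof.
move=> [cf [C [d [d0 h]]]].
have hi := integrableZl measurableT C (integrable_gauss 0 d0).
apply: le_integrable hi => //.
  by apply/measurable_EFinP; exact: continuous_measurable_fun.
move=> x _; rewrite lee_fin subr0.
by apply: le_trans (h x) _; exact: ler_norm.
Qed.

Lemma integD f g : gdecay f -> gdecay g ->
  integ (fun x => f x + g x) = integ f + integ g.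
Proof. by move=> hf hg; rewrite /integ RintegralD//; exact: gdecay_integrable. Qed.

Lemma integB f g : gdecay f -> gdecay g ->
  integ (fun x => f x - g x) = integ f - integ g.
Proof. by move=> hf hg; rewrite /integ RintegralB//; exact: gdecay_integrable. Qed.

Lemma integZ c f : gdecay f -> integ (fun x => c * f x) = c * integ f.
Proof. by move=> hf; rewrite /integ RintegralZl//; exact: gdecay_integrable. Qed.

Lemma eq_integ f g : (forall x, f x = g x) -> integ f = integ g.
Proof. by move=> h; congr integ; apply/funext. Qed.

Lemma integ_ge0 f : (forall x, 0 <= f x) -> 0 <= integ f.
Proof. by move=> h; apply: Rintegral_ge0. Qed.

Lemma integ_le f g : gdecay f -> gdecay g -> (forall x, f x <= g x) ->
  integ f <= integ g.
Proof.
by move=> hf hg h; apply: le_Rintegral => //; exact: gdecay_integrable.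
Qed.

Lemma gdecay_norm f : gdecay f -> gdecay (fun x => `|f x|).
Proof.
move=> [cf [C [d [d0 h]]]]; apply: (@gdecayP _ _ C d) => //.
  exact: cont_norm.
by move=> x; rewrite normr_id.
Qed.

Lemma gdecay_sqr f : gdecay f -> gdecay (fun x => f x ^+ 2).
Proof. by move=> h; apply: eq_gdecay (gdecayM h h) _ => x; rewrite expr2. Qed.

Lemma gdecay_sum n (f : 'I_n -> R -> R) : (forall i, gdecay (f i)) ->
  gdecay (fun x => \sum_(i < n) f i x).
Proof.
elim: n f => [|n IH] f h.
  apply: (@gdecayP _ _ 0 1) => // [|x]; last by rewrite big_ord0 normr0 mul0r.
  by under eq_fun do rewrite big_ord0; exact: cont_cst.
apply: eq_gdecay (gdecayD (IH (fun i => f (widen_ord (leqnSn n) i)) _) (h ord_max)) _.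
  by move=> i; exact: h.
by move=> x; rewrite big_ord_recr.
Qed.

Lemma integ_sum n (f : 'I_n -> R -> R) : (forall i, gdecay (f i)) ->
  integ (fun x => \sum_(i < n) f i x) = \sum_(i < n) integ (f i).
Proof.
elim: n f => [|n IH] f h.
  rewrite big_ord0 /integ; under eq_Rintegral do rewrite big_ord0.
  by rewrite /Rintegral integral0.
rewrite big_ord_recr /= -IH//.
rewrite -integD//; last by apply: gdecay_sum.
by apply: eq_integ => x; rewrite big_ord_recr.
Qed.

Lemma sqr_le_of_quadratic (a b c : R) : 0 <= a -> 0 <= c ->
  (forall t, 0 <= a - 2 * t * b + t ^+ 2 * c) -> b ^+ 2 <= a * c.
Proof.
move=> a0 c0 h; have [c00|cn0] := eqVneq c 0.
  have [-> |b0] := eqVneq b 0; first by rewrite expr0n mulr_ge0.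
  (* For [c = 0] the form is affine in [t], and this [t] gives it the value -1. *)
  have := h ((a + 1) / (2 * b)).
  have -> : 2 * ((a + 1) / (2 * b)) * b = a + 1 by field.
  by rewrite c00 mulr0 addr0; lra.
have cp : 0 < c by rewrite lt_neqAle eq_sym cn0.
have := h (b / c).
have -> : a - 2 * (b / c) * b + (b / c) ^+ 2 * c = (a * c - b ^+ 2) / c by field.
by rewrite pmulr_lge0 ?invr_gt0// subr_ge0.
Qed.

Lemma cauchy_schwarz f g : gdecay f -> gdecay g ->
  (integ (fun x => f x * g x)) ^+ 2 <=
  integ (fun x => f x ^+ 2) * integ (fun x => g x ^+ 2).
Proof.
move=> hf hg; apply: sqr_le_of_quadratic.
- by apply: integ_ge0 => x; exact: sqr_ge0.
- by apply: integ_ge0 => x; exact: sqr_ge0.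
move=> t; have := gdecayM hf hg => hfg.
have f2 := gdecay_sqr hf; have g2 := gdecay_sqr hg.
rewrite -!integZ// -integB//; last exact: gdecayZ.
rewrite -integD; [|by apply: gdecayB => //; exact: gdecayZ|exact: gdecayZ].
apply: integ_ge0 => x.
have -> : f x ^+ 2 - 2 * t * (f x * g x) + t ^+ 2 * g x ^+ 2 = (f x - t * g x) ^+ 2.
  by ring.
exact: sqr_ge0.
Qed.

Definition gauss (d m : R) : R -> R := fun t => expR (- (d * (t - m) ^+ 2)).

Lemma gdecay_gauss d m : 0 < d -> gdecay (gauss d m).
Proof.
move=> d0; apply: (@gdecayP _ _ (expR (d * m ^+ 2)) (d / 2)).
- have hx : has_deriv (fun t : R => t - m) (fun=> 1).
    by apply: has_deriv_eq (has_derivB has_deriv_id (has_deriv_cst m)) _ => t; lra.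
  rewrite /gauss; under eq_fun do rewrite expr2.
  exact: (has_deriv_cont (has_deriv_exp (has_derivN (has_derivZ d (has_derivM hx hx))))).
- by rewrite divr_gt0.
move=> x; rewrite ger0_norm ?expR_ge0// -expRD ler_expR.
have := mulr_ge0 (ltW d0) (sqr_ge0 (x - 2 * m)).
rewrite -[_ <= _ + _]subr_ge0.
have -> : d * m ^+ 2 - d / 2 * x ^+ 2 - - (d * (x - m) ^+ 2) =
    d * (x - 2 * m) ^+ 2 / 2 by field.
by move=> ?; rewrite divr_ge0.
Qed.

Lemma gauss_ge0 d m t : 0 <= gauss d m t. Proof. exact: expR_ge0. Qed.

(** Both integrals are the inverse of the peak of a normal density, which depends on the standard
    deviation but not on the mean. *)
Lemma integ_gauss_shift d m : 0 < d -> integ (gauss d m) = integ (gauss d 0).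
Proof.
move=> d0.
have H k : exists2 c, 0 < c & 1 = c * integ (gauss d k) /\
    c = normal_peak (Num.sqrt (2 * d)^-1).
  set s := Num.sqrt (2 * d)^-1.
  have s2 : s ^+ 2 = (2 * d)^-1 by rewrite sqr_sqrtr// invr_ge0; lra.
  have s0 : s != 0 by rewrite gt_eqF// sqrtr_gt0 invr_gt0; lra.
  exists (normal_peak s); first exact: normal_peak_gt0.
  split => //; have := integral_normal_pdf k s => /(congr1 fine) /= <-.
  rewrite -integZ; last exact: gdecay_gauss.
  rewrite /integ /Rintegral; congr fine; apply: eq_integral => x _.
  rewrite normal_pdfE// /normal_fun s2 /gauss; congr (_ * expR _)%:E.
  by field; rewrite gt_eqF.
have [c c0 [h1 h2]] := H m; have [c' c0' [h3 h4]] := H 0.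
by apply: (mulfI (lt0r_neq0 c0)); rewrite -h1 h3 h2 h4.
Qed.

Lemma gdecay_le_integ (D : set (measurableTypeR R)) f k K : measurable D -> gdecay f ->
  gdecay k -> (forall x, 0 <= k x) ->
  (forall t, D t -> `|f t| <= K * k t) -> 0 <= K ->
  `|Rintegral leb D f| <= K * integ k.
Proof.
move=> mD hf hk k0 h K0.
have if' := integrableS measurableT mD (subsetT D) (gdecay_integrable hf).
have hKk := gdecayZ K hk.
have iK := integrableS measurableT mD (subsetT D) (gdecay_integrable hKk).
apply: le_trans (le_normr_Rintegral mD if') _.
apply: (@le_trans _ _ (Rintegral leb D (fun x => K * k x))).
  by apply: le_Rintegral => //; apply: integrable_norm.
rewrite -integZ// /integ /Rintegral fine_le//.
- exact: integrable_fin_num.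
- by apply: integrable_fin_num => //; exact: gdecay_integrable.
apply: ge0_subset_integral => //.
- by apply/measurable_EFinP; apply: continuous_measurable_fun; case: hKk.
- by move=> x _; rewrite lee_fin mulr_ge0.
Qed.

Definition primitive f (x : R) : R := Rintegral leb `]-oo, x] f.

Lemma primitive_deriv f : gdecay f -> has_deriv (primitive f) f.
Proof.
move=> hf x.
have [dJ eJ] : derivable (primitive f) x 1 /\ derive1 (primitive f) x = f x.
  apply: (@continuous_FTC1 R f (BInfty _ true) x (x + 1)) => //.
  - by rewrite ltrDl.
  - exact: (integrableS measurableT _ _ (gdecay_integrable hf)).
  - exact: ltNyr.
  - by case: hf => cf _; exact: cf.
by rewrite -eJ derive1E; exact: derivableP.
Qed.

Lemma primitive_compl f x : gdecay f ->
  integ f - primitive f x = Rintegral leb `]x, +oo[ f.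
Proof.
move=> hf; rewrite /primitive /integ -set_itvNyy Rintegral_itvB//.
by rewrite set_itvNyy; exact: gdecay_integrable.
Qed.

Lemma primitive_left f k K x : gdecay f -> gdecay k -> (forall x, 0 <= k x) ->
  0 <= K -> (forall t, t <= x -> `|f t| <= K * k t) ->
  `|primitive f x| <= K * integ k.
Proof.
move=> hf hk k0 K0 h; apply: gdecay_le_integ => // t /=.
Qed.

Lemma primitive_right f k K x : gdecay f -> gdecay k -> (forall x, 0 <= k x) ->
  0 <= K -> (forall t, x <= t -> `|f t| <= K * k t) ->
  `|integ f - primitive f x| <= K * integ k.
Proof.
move=> hf hk k0 K0 h; rewrite primitive_compl//; apply: gdecay_le_integ => // t /=.
by rewrite in_itv/= andbT => /ltW; exact: h.
Qed.

(* For [t] beyond [x] on the same side of the origin,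
   [t ^ 2 >= x ^ 2 + (t - x) ^ 2]. *)
Lemma gauss_split d x t : 0 <= d -> (t <= x <= 0) || (0 <= x <= t) ->
  expR (- (d * t ^+ 2)) <= expR (- (d * x ^+ 2)) * gauss d x t.
Proof.
move=> d0 h; rewrite -expRD ler_expR -opprD lerN2 -mulrDr ler_wpM2l//.
have : 0 <= x * (t - x).
  case/orP: h => /andP[h1 h2]; last by rewrite mulr_ge0// subr_ge0.
  by rewrite mulr_le0// subr_le0.
rewrite !expr2; nra.
Qed.

(** On the side away from the origin, [gauss_split] factors [exp (- d x^2)] out of the tail and
    leaves a Gaussian centred at [x], whose integral does not depend on [x]. The rate [d] is kept
    exactly: [raise_inverse] multiplies by [exp (x^2 / 2)] and needs the rest of the exponent. *)
Lemma primitive_decay f C d : gdecay f -> 0 <= C -> 0 < d ->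
  (forall x, `|f x| <= C * expR (- (d * x ^+ 2))) ->
  let C' := C * integ (gauss d 0) in
  [/\ 0 <= C',
  (forall x, x <= 0 -> `|primitive f x| <= C' * expR (- (d * x ^+ 2))) &
  (forall x, 0 <= x -> `|integ f - primitive f x| <= C' * expR (- (d * x ^+ 2)))].
Proof.
move=> hf C0 d0 hC C'.
have g0 : 0 <= integ (gauss d 0) by apply: integ_ge0 => x; exact: expR_ge0.
split; first exact: mulr_ge0.
- move=> x x0; rewrite /C' mulrAC -(integ_gauss_shift x)//.
  apply: primitive_left => //.
  + exact: gdecay_gauss.
  + exact: gauss_ge0.
  + by rewrite mulr_ge0 ?expR_ge0.
  move=> t tx; apply: le_trans (hC t) _; rewrite -mulrA ler_wpM2l//.
  by apply: gauss_split; rewrite ?(ltW d0)// tx x0.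
- move=> x x0; rewrite /C' mulrAC -(integ_gauss_shift x)//.
  apply: primitive_right => //.
  + exact: gdecay_gauss.
  + exact: gauss_ge0.
  + by rewrite mulr_ge0 ?expR_ge0.
  move=> t tx; apply: le_trans (hC t) _; rewrite -mulrA ler_wpM2l//.
  by apply: gauss_split; rewrite ?(ltW d0)// tx x0 orbT.
Qed.

Lemma gdecay_primitive f : gdecay f -> integ f = 0 -> gdecay (primitive f).
Proof.
move=> hf f0; have [C [d [C0 d0 hC]]] := gdecay_nonneg hf.
have [C0' h1 h2] := primitive_decay hf C0 d0 hC.
apply: gdecayP d0 _ => //.
  exact: has_deriv_cont (primitive_deriv hf).
move=> x; case: (leP x 0) => [|/ltW] x0; first exact: h1.
by have := h2 x x0; rewrite f0 sub0r normrN.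
Qed.

Lemma le_gauss_eq0 (c K d : R) : 0 < d ->
  (forall x, 0 <= x -> `|c| <= K * expR (- (d * x ^+ 2))) -> c = 0.
Proof.
move=> d0 h; apply/eqP; rewrite -normr_eq0 eq_le normr_ge0 andbT leNgt.
apply/negP => c0.
have K0 : 0 < K.
  by have := h 0 (lexx _); rewrite expr0n mulr0 oppr0 expR0 mulr1; exact: lt_le_trans.
(* At the abscissa [sqrt y] the exponent is [K / |c|]; then [exp t >= 1 + t] turns the hypothesis
   into [|c| + K <= K]. *)
pose y := K / `|c| / d; have y0 : 0 < y by rewrite !divr_gt0.
have dy : d * Num.sqrt y ^+ 2 = K / `|c|.
  by rewrite sqr_sqrtr ?(ltW y0)// /y; field; rewrite !gt_eqF.
have := h (Num.sqrt y) (sqrtr_ge0 _); rewrite dy.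
rewrite expRN ler_pdivlMr ?expR_gt0// => h1.
have := ler_wpM2l (normr_ge0 c) (expR_ge1Dx (K / `|c|)).
rewrite mulrDr mulr1 [_ * (K / _)]mulrC mulfVK ?gt_eqF//; lra.
Qed.

(** The two primitives differ by a constant, which is 0 because both decay at [-oo]. The integral is
    the right tail of [f] plus [F x], and both of these decay at [+oo]. *)
Lemma primitiveE F f : gdecay F -> gdecay f -> has_deriv F f ->
  integ f = 0 /\ forall x, primitive f x = F x.
Proof.
move=> hF hf dF; have [C0 [d [C00 d0 hC]]] := gdecay_nonneg hf.
have := primitive_decay hf C00 d0 hC; set C := C0 * _ => -[C0'' h1 h2].
have [C' [d' [C0' d0' h']]] := gdecay_nonneg hF.
pose m := Num.min d d'; have m0 : 0 < m by rewrite lt_min d0.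
have e1 x : expR (- (d * x ^+ 2)) <= expR (- (m * x ^+ 2)).
  by rewrite ler_expR lerN2 ler_wpM2r ?sqr_ge0// ge_min lexx.
have e2 x : expR (- (d' * x ^+ 2)) <= expR (- (m * x ^+ 2)).
  by rewrite ler_expR lerN2 ler_wpM2r ?sqr_ge0// ge_min lexx orbT.
have dd := has_deriv_cst_diff (primitive_deriv hf) dF.
have c0 : primitive f 0 - F 0 = 0.
  apply: (@le_gauss_eq0 _ (C + C') m) => // x x0.
  have -> : primitive f 0 - F 0 = primitive f (- x) - F (- x).
    by have := dd 0 (- x); lra.
  apply: le_trans (ler_normB _ _) _; rewrite mulrDl.
  have := h1 (- x); have := h' (- x); rewrite sqrrN oppr_le0 => k1 /(_ x0) k2.
  by apply: lerD; [apply: le_trans k2 _|apply: le_trans k1 _]; rewrite ler_wpM2l.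
have pF x : primitive f x = F x by have := dd x 0; lra.
split => //; apply: (@le_gauss_eq0 _ (C + C') m) => // x x0.
have -> : integ f = (integ f - primitive f x) + F x by rewrite pF; ring.
apply: le_trans (ler_normD _ _) _; rewrite mulrDl.
by apply: lerD; [apply: le_trans (h2 x x0) _|apply: le_trans (h' x) _]; rewrite ler_wpM2l.
Qed.

Lemma integ_deriv F f : gdecay F -> gdecay f -> has_deriv F f -> integ f = 0.
Proof. by move=> hF hf dF; case: (primitiveE hF hf dF). Qed.

Lemma integ_by_parts f g df dg : has_deriv f df -> has_deriv g dg ->
  gdecay (fun x => f x * g x) -> gdecay (fun x => df x * g x) ->
  gdecay (fun x => f x * dg x) ->
  integ (fun x => df x * g x) = - integ (fun x => f x * dg x).
Proof.
move=> hf hg h1 h2 h3; apply/eqP; rewrite -subr_eq0 opprK -integD//; apply/eqP.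
by apply: integ_deriv h1 _ (has_derivM hf hg); exact: gdecayD.
Qed.

Lemma integ_sqr_le f (K : R) g : gdecay f -> gdecay g -> 0 <= K ->
  (forall x, `|f x| <= K * `|g x|) ->
  integ (fun x => f x ^+ 2) <= K ^+ 2 * integ (fun x => g x ^+ 2).
Proof.
move=> hf hg K0 h; rewrite -integZ; last exact: gdecay_sqr.
apply: integ_le; [exact: gdecay_sqr|apply: gdecayZ; exact: gdecay_sqr|] => x.
rewrite -exprMn -[leLHS]real_normK ?num_real// -[leRHS]real_normK ?num_real//.
by rewrite lerXn2r ?nnegrE// normrM (ger0_norm K0).
Qed.

End Integral.

(** * Hermite functions, ladder operators and the truncation error *)

Section Hermite.
Context {R : realType}.
Implicit Types (f g df dg F h dh : R -> R) (n m N : nat).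

Lemma hermite_pairE n (x : R) : hermite_pair n x = (hermite n x, hermite n.+1 x).
Proof. by rewrite /hermite /=; case: (hermite_pair n x). Qed.

Lemma hermite0 (x : R) : hermite 0 x = 1. Proof. by []. Qed.

Lemma hermite1 (x : R) : hermite 1 x = 2 * x. Proof. by []. Qed.

Lemma hermiteSS n (x : R) :
  hermite n.+2 x = 2 * x * hermite n.+1 x - 2 * n.+1%:R * hermite n x.
Proof. by rewrite {1}/hermite /= hermite_pairE. Qed.

(** The recurrence has order two, so two consecutive indices are carried; differentiating it in [hS]
    reproduces the recurrence one index lower. *)
Lemma hermite_deriv n : has_deriv (@hermite R n.+1) (fun x => 2 * n.+1%:R * hermite n x).
Proof.
suff [] : has_deriv (@hermite R n.+1) (fun x => 2 * n.+1%:R * hermite n x) /\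
    has_deriv (@hermite R n.+2) (fun x => 2 * n.+2%:R * hermite n.+1 x) by [].
have h1 : has_deriv (@hermite R 1) (fun x => 2 * 1%:R * hermite 0 x).
  apply: has_deriv_eq (has_derivZ 2 has_deriv_id) _ => x.
  by rewrite hermite0; ring.
have hS k d0 : has_deriv (@hermite R k.+1) (fun x => 2 * k.+1%:R * hermite k x) ->
    has_deriv (@hermite R k) d0 ->
    (forall x, 2 * x * (2 * k.+1%:R * hermite k x) - 2 * k.+1%:R * d0 x =
       2 * k.+1%:R * hermite k.+1 x) ->
    has_deriv (@hermite R k.+2) (fun x => 2 * k.+2%:R * hermite k.+1 x).
  move=> i1 i0 e.
  have := has_derivB (has_derivM (has_derivZ 2 has_deriv_id) i1)
    (has_derivZ (2 * k.+1%:R) i0).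
  rewrite (_ : (fun x => _ - _) = @hermite R k.+2); last first.
    by apply/funext => x; rewrite hermiteSS.
  move=> h; apply: has_deriv_eq h _ => x.
  by rewrite -addrA e -!natr1; ring.
elim: n => [|n [IH1 IH2]].
  split => //; apply: hS h1 (has_deriv_cst 1) _ => x; rewrite hermite0 hermite1; ring.
split => //; apply: hS IH2 IH1 _ => x.
by rewrite [hermite n.+2 x]hermiteSS; ring.
Qed.

Lemma hermite_pgrowth n : pgrowth (@hermite R n).
Proof.
suff [] : pgrowth (@hermite R n) /\ pgrowth (@hermite R n.+1) by [].
elim: n => [|n [IH1 IH2]].
  by split; [exact: (pgrowth_cst 1)|exact: pgrowthZ pgrowth_id].
split => //.
have := pgrowthD (pgrowthM (pgrowthZ 2 pgrowth_id) IH2) (pgrowthZ (- (2 * n.+1%:R)) IH1).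
by move=> h; apply: eq_pgrowth h _ => x; rewrite hermiteSS mulNr.
Qed.

(** Unnormalised Hermite functions, on which the ladder operators act with integer coefficients. *)
Definition phi n (x : R) := expR (- (1 / 2 * x ^+ 2)) * hermite n x.

Lemma gauss_half_deriv :
  has_deriv (fun x : R => expR (- (1 / 2 * x ^+ 2)))
    (fun x => - x * expR (- (1 / 2 * x ^+ 2))).
Proof.
under [X in has_deriv X _]eq_fun do rewrite expr2.
apply: has_deriv_eq (has_deriv_exp (has_derivN (has_derivZ (1/2)
  (has_derivM has_deriv_id has_deriv_id)))) _ => x.
by rewrite expr2; congr (_ * _); field.
Qed.

(** Read as the action of the creation operator: [x - d/dx] sends [phi n] to [phi n.+1]. Together
    with [phi_lower], the annihilation operator [x + d/dx] sends [phi n.+1] to [2 (n + 1) phi n]. *)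
Lemma phi_deriv n : has_deriv (phi n) (fun x => x * phi n x - phi n.+1 x).
Proof.
case: n => [|n].
  apply: has_deriv_eq (has_derivM gauss_half_deriv (has_deriv_cst 1)) _ => x.
  by rewrite /phi hermite0 hermite1; ring.
apply: has_deriv_eq (has_derivM gauss_half_deriv (hermite_deriv n)) _ => x.
by rewrite /phi hermiteSS; ring.
Qed.

Lemma phi_lower n x : phi n.+2 x = 2 * x * phi n.+1 x - 2 * n.+1%:R * phi n x.
Proof. by rewrite /phi hermiteSS; ring. Qed.

Lemma phi1 x : phi 1 x = 2 * x * phi 0 x.
Proof. by rewrite /phi hermite1 hermite0; ring. Qed.

Lemma gdecay_phi n : gdecay (phi n).
Proof.
apply: gdecayMp (hermite_pgrowth n).
apply: eq_gdecay (@gdecay_gauss R (1/2) 0 _) _; first by rewrite divr_gt0.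
by move=> x; rewrite /gauss subr0.
Qed.

Lemma gdecay_mulx f : gdecay f -> gdecay (fun x => x * f x).
Proof. by move=> h; apply: eq_gdecay (gdecayMp h pgrowth_id) _ => x; rewrite mulrC. Qed.

(** Creation and annihilation are adjoint: the derivative changes sign under integration by parts
    while multiplication by [x] is symmetric. Orthogonality and the spectral gap both rest on
    this. *)
Lemma adjoint f df g dg : has_deriv f df -> has_deriv g dg ->
  gdecay f -> gdecay df -> gdecay g -> gdecay dg ->
  integ (fun x => (x * f x - df x) * g x) = integ (fun x => f x * (x * g x + dg x)).
Proof.
move=> hf hg gf gdf gg gdg.
have ip := integ_by_parts hf hg (gdecayM gf gg) (gdecayM gdf gg) (gdecayM gf gdg).
have e1 : integ (fun x => (x * f x - df x) * g x) =
    integ (fun x => x * f x * g x) - integ (fun x => df x * g x).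
  rewrite -integB; [|exact: gdecayM (gdecay_mulx gf) gg|exact: gdecayM].
  by apply: eq_integ => x; ring.
have e2 : integ (fun x => f x * (x * g x + dg x)) =
    integ (fun x => x * f x * g x) + integ (fun x => f x * dg x).
  rewrite -integD; [|exact: gdecayM (gdecay_mulx gf) gg|exact: gdecayM].
  by apply: eq_integ => x; ring.
by rewrite e1 e2 ip opprK.
Qed.

Lemma gdecay_phi_deriv n : gdecay (fun x => x * phi n x - phi n.+1 x).
Proof. by apply: gdecayB (gdecay_phi _); exact: gdecay_mulx (gdecay_phi _). Qed.

Lemma phi_raise n g dg : has_deriv g dg -> gdecay g -> gdecay dg ->
  integ (fun x => phi n.+1 x * g x) = integ (fun x => phi n x * (x * g x + dg x)).
Proof.
move=> hg gg gdg.
rewrite -(adjoint (phi_deriv n) hg (gdecay_phi n) (gdecay_phi_deriv n) gg gdg).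
by apply: eq_integ => x; ring.
Qed.

Lemma phi_raise_phi n m :
  integ (fun x => phi n.+1 x * phi m.+1 x) =
  2 * m.+1%:R * integ (fun x => phi n x * phi m x).
Proof.
rewrite (phi_raise n (phi_deriv _) (gdecay_phi _) (gdecay_phi_deriv _)).
rewrite -integZ; last exact: gdecayM (gdecay_phi _) (gdecay_phi _).
by apply: eq_integ => x; rewrite phi_lower; ring.
Qed.

(** Moving one creation operator across lowers both indices together. When the second index reaches
    0 first, [phi 0] is annihilated; when both do, a Gaussian integral remains. *)
Lemma phi_orth n m : integ (fun x => phi n x * phi m x) =
  if n == m then Num.sqrt pi * 2 ^+ n * n`!%:R else 0.
Proof.
have z0 k : integ (fun x => phi k.+1 x * phi 0 x) = 0.
  rewrite (phi_raise k (phi_deriv _) (gdecay_phi _) (gdecay_phi_deriv _)).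
  transitivity (integ (fun _ : R => 0 * gauss 1 0 0)).
    by apply: eq_integ => x; rewrite phi1; ring.
  rewrite /integ; under eq_Rintegral do rewrite mul0r.
  by rewrite /Rintegral integral0.
elim: n m => [|n IH] [|m].
- rewrite eqxx expr0 fact0 !mulr1 /integ /Rintegral.
  rewrite -[RHS]/(fine (Num.sqrt pi)%:E) -integralT_gauss; congr fine.
  apply: eq_integral => x _; congr (_%:E); rewrite /phi hermite0 !mulr1 -expRD /gauss_fun.
  by congr expR; field.
- by rewrite /= -(z0 m); apply: eq_integ => x; rewrite mulrC.
- exact: z0.
- rewrite phi_raise_phi IH eqSS; case: eqP => [<-|_]; last by rewrite mulr0.
  by rewrite factS natrM exprS; ring.
Qed.

Definition hermite_norm n : R := (Num.sqrt (Num.sqrt pi * 2 ^+ n * (n`!)%:R))^-1.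

Lemma hermite_norm_gt0 n : 0 < hermite_norm n.
Proof.
rewrite invr_gt0 sqrtr_gt0 !mulr_gt0 ?exprn_gt0 ?sqrtr_gt0 ?pi_gt0//.
Qed.

Lemma hermite_norm_sqr n :
  hermite_norm n ^+ 2 * (Num.sqrt pi * 2 ^+ n * (n`!)%:R) = 1.
Proof.
rewrite /hermite_norm; set A := Num.sqrt pi * 2 ^+ n * (n`!)%:R : R.
have A0 : 0 < A.
  by rewrite /A !mulr_gt0 ?exprn_gt0 ?sqrtr_gt0 ?pi_gt0// ?ltr0n ?fact_gt0.
by rewrite exprVn sqr_sqrtr ?ltW// mulVf// gt_eqF.
Qed.

Lemma hermite_norm_S n : hermite_norm n = Num.sqrt (2 * n.+1%:R) * hermite_norm n.+1.
Proof.
rewrite /hermite_norm factS natrM exprS.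
have -> : Num.sqrt pi * (2 * 2 ^+ n) * (n.+1%:R * (n`!)%:R) =
   2 * n.+1%:R * (Num.sqrt pi * 2 ^+ n * (n`!)%:R) :> R by ring.
rewrite [X in _ = _ * X^-1](@sqrtrM _ (2 * n.+1%:R)) ?mulr_ge0// invfM mulrA.
rewrite divff ?mul1r//.
Qed.

Lemma hermite_funE n x : hermite_fun n x = hermite_norm n * phi n x.
Proof.
rewrite /hermite_fun /phi /hermite_norm mulrA; congr (_ * expR _ * _).
by field.
Qed.

Lemma gdecay_hermite_fun n : gdecay (@hermite_fun R n).
Proof.
by apply: eq_gdecay (gdecayZ (hermite_norm n) (gdecay_phi n)) _ => x; rewrite hermite_funE.
Qed.

Lemma hermite_fun_orth n m :
  integ (fun x => hermite_fun n x * hermite_fun m x) = (n == m)%:R :> R.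
Proof.
transitivity (hermite_norm n * hermite_norm m * integ (fun x => phi n x * phi m x)).
  rewrite -integZ; last exact: gdecayM (gdecay_phi _) (gdecay_phi _).
  by apply: eq_integ => x; rewrite !hermite_funE; ring.
rewrite phi_orth; case: eqP => [->|_]; last by rewrite mulr0.
by rewrite -expr2 hermite_norm_sqr.
Qed.

Lemma hermite_fun_deriv n : exists2 df : R -> R, gdecay df & has_deriv (hermite_fun n) df.
Proof.
exists (fun x => hermite_norm n * (x * phi n x - phi n.+1 x)).
  exact: gdecayZ (gdecay_phi_deriv n).
rewrite (_ : hermite_fun n = fun x => hermite_norm n * phi n x).
  exact: has_derivZ (phi_deriv n).
by apply/funext => x; rewrite hermite_funE.
Qed.

(* [(psi_n)'' = (x ^ 2 - (2 n + 1)) psi_n], tested against [g]. *)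
Lemma hermite_fun_eigen n g dg ddg : has_deriv g dg -> has_deriv dg ddg ->
  gdecay g -> gdecay dg -> gdecay ddg ->
  integ (fun x => hermite_fun n x * ddg x) =
  integ (fun x => hermite_fun n x * (x ^+ 2 * g x)) -
  (2 * n%:R + 1) * integ (fun x => hermite_fun n x * g x).
Proof.
move=> hg hdg gg gdg gddg.
have gp := gdecay_phi n; have gdp := gdecay_phi_deriv n.
have d2 : has_deriv (fun x => x * phi n x - phi n.+1 x)
    (fun x => (x ^+ 2 - (2 * n%:R + 1)) * phi n x).
  apply: has_deriv_eq (has_derivB (has_derivM has_deriv_id (phi_deriv n)) (phi_deriv n.+1)) _ => x.
  by rewrite phi_lower -natr1; ring.
have gx2 h : gdecay h -> gdecay (fun x => x ^+ 2 * h x).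
  by move=> gh; apply: eq_gdecay (gdecay_mulx (gdecay_mulx gh)) _ => x; rewrite expr2 mulrA.
have gd2 : gdecay (fun x => (x ^+ 2 - (2 * n%:R + 1)) * phi n x).
  apply: eq_gdecay (gdecayB (gx2 _ gp) (gdecayZ (2 * n%:R + 1) gp)) _ => x; ring.
have i1 := integ_by_parts (phi_deriv n) hdg (gdecayM gp gdg) (gdecayM gdp gdg) (gdecayM gp gddg).
have i2 := integ_by_parts d2 hg (gdecayM gdp gg) (gdecayM gd2 gg) (gdecayM gdp gdg).
have E (h : R -> R) : gdecay h -> integ (fun x => hermite_fun n x * h x) =
    hermite_norm n * integ (fun x => phi n x * h x).
  move=> gh; rewrite -integZ; last exact: gdecayM.
  by apply: eq_integ => x; rewrite hermite_funE mulrA.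
rewrite !E//; last exact: gx2.
rewrite mulrCA -mulrBr; congr (_ * _).
rewrite -[LHS]opprK -i1 -[LHS]opprK opprK -i2.
rewrite -integZ; last exact: gdecayM.
rewrite -integB; [|exact: gdecayM gp (gx2 _ gg)|exact: gdecayZ (gdecayM gp gg)].
by apply: eq_integ => x; ring.
Qed.

Definition hcoef f n : R := integ (fun x => hermite_fun n x * f x).

Lemma gdecay_hcomb N (a : nat -> R) :
  gdecay (fun x : R => \sum_(n < N) a n * hermite_fun n x).
Proof. by apply: gdecay_sum => i; apply: gdecayZ; exact: gdecay_hermite_fun. Qed.

Lemma integ_hcomb N (a : nat -> R) g : gdecay g ->
  integ (fun x => g x * \sum_(n < N) a n * hermite_fun n x) = \sum_(n < N) a n * hcoef g n.
Proof.
move=> gg; transitivity (integ (fun x => \sum_(n < N) a n * (hermite_fun n x * g x))).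
  by apply: eq_integ => x; rewrite mulr_sumr; apply: eq_bigr => i _; ring.
rewrite integ_sum; last first.
  by move=> i; apply: gdecayZ; exact: gdecayM (gdecay_hermite_fun _) gg.
by apply: eq_bigr => i _; rewrite integZ//; exact: gdecayM (gdecay_hermite_fun _) gg.
Qed.

Lemma hcoef_hcomb N (a : nat -> R) k : (k < N)%N ->
  hcoef (fun x => \sum_(n < N) a n * hermite_fun n x) k = a k.
Proof.
move=> kN; rewrite /hcoef integ_hcomb; last exact: gdecay_hermite_fun.
rewrite (bigD1 (Ordinal kN))//= /hcoef hermite_fun_orth eqxx mulr1 big1 ?addr0// => i ik.
rewrite hermite_fun_orth (_ : _ == _ = false) ?mulr0//.
by apply/eqP => ki; move/eqP: ik; apply; apply/val_inj.
Qed.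

Lemma hcoefB f g n : gdecay f -> gdecay g ->
  hcoef (fun x => f x - g x) n = hcoef f n - hcoef g n.
Proof.
move=> gf gg; have hn := gdecay_hermite_fun n.
rewrite /hcoef -integB; [|exact: gdecayM|exact: gdecayM].
by apply: eq_integ => x; ring.
Qed.

Lemma hcoefD f g n : gdecay f -> gdecay g ->
  hcoef (fun x => f x + g x) n = hcoef f n + hcoef g n.
Proof.
move=> gf gg; have hn := gdecay_hermite_fun n.
rewrite /hcoef -integD; [|exact: gdecayM|exact: gdecayM].
by apply: eq_integ => x; ring.
Qed.

Lemma hcoefZ c f n : gdecay f -> hcoef (fun x => c * f x) n = c * hcoef f n.
Proof.
move=> gf; have hn := gdecay_hermite_fun n.
rewrite /hcoef -integZ; last exact: gdecayM.
by apply: eq_integ => x; ring.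
Qed.

(** Pythagoras: the coefficient error and the truncation error add without a cross term, for
    arbitrary coefficients [a]. [bessel] is the case where [a] is [hcoef f]. *)
Lemma integ_sqr_hcomb f N (a : nat -> R) : gdecay f ->
  integ (fun x => (\sum_(n < N) a n * hermite_fun n x - f x) ^+ 2) =
  \sum_(n < N) (a n - hcoef f n) ^+ 2 +
  (integ (fun x => f x ^+ 2) - \sum_(n < N) hcoef f n ^+ 2).
Proof.
move=> gf; have gS := gdecay_hcomb N a; set S := fun x => \sum_(n < N) _ in gS *.
have -> : integ (fun x => (S x - f x) ^+ 2) =
   integ (fun x => S x * S x) - 2 * integ (fun x => f x * S x) + integ (fun x => f x ^+ 2).
  rewrite -integZ; last exact: gdecayM.
  rewrite -integB; [|exact: gdecayM|by apply: gdecayZ; exact: gdecayM].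
  rewrite -integD; [|by apply: gdecayB; [exact: gdecayM|apply: gdecayZ; exact: gdecayM]|exact: gdecay_sqr].
  by apply: eq_integ => x; ring.
rewrite {2}/S !integ_hcomb//.
have -> : \sum_(n < N) a n * hcoef S n = \sum_(n < N) a n ^+ 2.
  by apply: eq_bigr => i _; rewrite hcoef_hcomb// expr2.
have -> : \sum_(n < N) (a n - hcoef f n) ^+ 2 =
   \sum_(n < N) a n ^+ 2 - 2 * (\sum_(n < N) a n * hcoef f n) + \sum_(n < N) hcoef f n ^+ 2.
  rewrite mulr_sumr -sumrB -big_split; apply: eq_bigr => i _ /=; ring.
ring.
Qed.

Lemma bessel f N : gdecay f -> \sum_(n < N) hcoef f n ^+ 2 <= integ (fun x => f x ^+ 2).
Proof.
move=> gf; have := integ_sqr_hcomb N (hcoef f) gf.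
rewrite big1 ?add0r => [h|i _]; last by rewrite subrr expr0n.
rewrite -subr_ge0 -h; apply: integ_ge0 => x; exact: sqr_ge0.
Qed.

(* [f = x h - h'] is solved by [h = - e^(x^2/2) \int_(-oo)^x f e^(-t^2/2) dt];
   orthogonality to [phi 0] is what makes [h] decay at [+oo]. *)
Lemma raise_inverse f : gdecay f -> integ (fun x => phi 0 x * f x) = 0 ->
  exists h, [/\ gdecay h, gdecay (fun x => x * h x - f x) &
    has_deriv h (fun x => x * h x - f x)].
Proof.
move=> gf f0; pose g x := phi 0 x * f x.
have gg : gdecay g := gdecayM (gdecay_phi 0) gf.
have [C [d [C0 d0 hC]]] := gdecay_nonneg gf.
have d1 : 0 < 1 / 2 + d by rewrite addr_gt0// divr_gt0.
have hg x : `|g x| <= C * expR (- ((1 / 2 + d) * x ^+ 2)).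
  rewrite /g /phi hermite0 mulr1 normrM ger0_norm ?expR_ge0// mulrDl opprD expRD.
  by rewrite [leRHS]mulrCA ler_wpM2l ?expR_ge0.
have [C0' h1 h2] := primitive_decay gg C0 d1 hg.
set C' := C * _ in C0' h1 h2.
pose E x : R := expR (1 / 2 * x ^+ 2).
have dE : has_deriv E (fun x => x * E x).
  rewrite /E; under [X in has_deriv X _]eq_fun do rewrite expr2.
  apply: has_deriv_eq (has_deriv_exp (has_derivZ (1/2)
    (has_derivM has_deriv_id has_deriv_id))) _ => x.
  by rewrite expr2; congr (_ * _); field.
pose h x := - (E x * primitive g x).
have dh : has_deriv h (fun x => x * h x - f x).
  apply: has_deriv_eq (has_derivN (has_derivM dE (primitive_deriv gg))) _ => x.
  rewrite /h /g /phi hermite0 mulr1 /E.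
  have e1 : expR (1 / 2 * x ^+ 2) * expR (- (1 / 2 * x ^+ 2)) = 1 :> R.
    by rewrite -expRD subrr expR0.
  rewrite [in X in - (_ + X)]mulrA e1; ring.
have gh : gdecay h.
  apply: (@gdecayP _ _ C' d) => //; first exact: has_deriv_cont dh.
  move=> x; rewrite normrN normrM ger0_norm ?expR_ge0//.
  have -> : - (d * x ^+ 2) = 1 / 2 * x ^+ 2 + - ((1 / 2 + d) * x ^+ 2) :> R by ring.
  rewrite expRD [leRHS]mulrCA ler_wpM2l ?expR_ge0//.
  case: (leP x 0) => [|/ltW] x0; first exact: h1.
  by have := h2 x x0; rewrite f0 sub0r normrN.
exists h; split => //; apply: gdecayB => //; exact: gdecay_mulx.
Qed.

(** The commutator of the ladder operators is 2: the two squares differ by [- 4 x h h'], whose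
    integral is that of [2 h^2]. *)
Lemma raise_lower_norm h dh : has_deriv h dh -> gdecay h -> gdecay dh ->
  integ (fun x => (x * h x - dh x) ^+ 2) =
  integ (fun x => (x * h x + dh x) ^+ 2) + 2 * integ (fun x => h x ^+ 2).
Proof.
move=> hd gh gdh; have gxh := gdecay_mulx gh.
have e : integ (fun x => h x ^+ 2 + 2 * (x * h x * dh x)) = 0.
  apply: (@integ_deriv R (fun x => x * (h x * h x))).
  - by apply: gdecay_mulx; exact: gdecayM.
  - by apply: gdecayD (gdecay_sqr gh) _; apply: gdecayZ; exact: gdecayM.
  - apply: has_deriv_eq (has_derivM has_deriv_id (has_derivM hd hd)) _ => x; ring.
have gp := gdecay_sqr (gdecayD gxh gdh).
rewrite -[LHS]addr0 -(mulr0 2) -e.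
have ge : gdecay (fun x => h x ^+ 2 + 2 * (x * h x * dh x)).
  by apply: gdecayD (gdecay_sqr gh) _; apply: gdecayZ; exact: gdecayM.
rewrite -integZ// -integD; [|exact: gdecay_sqr (gdecayB gxh gdh)|exact: gdecayZ].
rewrite -integZ; last exact: gdecay_sqr.
rewrite -integD; [|by []|by apply: gdecayZ; exact: gdecay_sqr].
by apply: eq_integ => x; ring.
Qed.

(** Write [a] for [x + d/dx] and [h] as the creation operator applied to [k]; then [k] is orthogonal
    to one function fewer. The induction hypothesis and [raise_lower_norm] give [|h|^2 = |a k|^2 + 2
    |k|^2 >= 2 (N + 1) |k|^2]. Since [|h|^2] is also the product of [k] with [a h], Cauchy-Schwarz
    transfers the gap from [k] to [h]. *)
Lemma spectral_gap N h dh : has_deriv h dh -> gdecay h -> gdecay dh ->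
  (forall n, (n < N)%N -> integ (fun x => phi n x * h x) = 0) ->
  2 * N%:R * integ (fun x => h x ^+ 2) <= integ (fun x => (x * h x + dh x) ^+ 2).
Proof.
elim: N h dh => [|N IH] h dh hd gh gdh orth.
  by rewrite mulr0 mul0r; apply: integ_ge0 => x; exact: sqr_ge0.
have [k [gk gdk dk]] := raise_inverse gh (orth 0%N isT).
have orthk n : (n < N)%N -> integ (fun x => phi n x * k x) = 0.
  move=> nN; have := adjoint dk (phi_deriv n.+1) gk gdk (gdecay_phi _) (gdecay_phi_deriv _).
  have -> : integ (fun x => (x * k x - (x * k x - h x)) * phi n.+1 x) = 0.
    by rewrite -(orth n.+1 nN); apply: eq_integ => x; ring.
  have -> : integ (fun x => k x * (x * phi n.+1 x + (x * phi n.+1 x - phi n.+2 x))) =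
     2 * n.+1%:R * integ (fun x => phi n x * k x).
    rewrite -integZ; last exact: gdecayM (gdecay_phi _) gk.
    by apply: eq_integ => x; rewrite phi_lower; ring.
  by move/esym/eqP; rewrite mulf_eq0 mulf_eq0 !pnatr_eq0 /= => /eqP.
have nk := raise_lower_norm dk gk gdk.
have IHk := IH k _ dk gk gdk orthk.
have e1 : integ (fun x => (x * k x - (x * k x - h x)) ^+ 2) = integ (fun x => h x ^+ 2).
  by apply: eq_integ => x; ring.
have := adjoint dk hd gk gdk gh gdh.
have -> : integ (fun x => (x * k x - (x * k x - h x)) * h x) = integ (fun x => h x ^+ 2).
  by apply: eq_integ => x; ring.
move=> e2; have ga := gdecayD (gdecay_mulx gh) gdh.
have := cauchy_schwarz gk ga; rewrite -e2.
rewrite e1 in nk; set A := integ (fun x => (x * h x + dh x) ^+ 2).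
set H := integ (fun x => h x ^+ 2) in nk *; set K := integ (fun x => k x ^+ 2) in nk IHk *.
move=> cs; have hK : 2 * N.+1%:R * K <= H by rewrite -natr1; lra.
have H0 : 0 <= H by apply: integ_ge0 => x; exact: sqr_ge0.
have A0 : 0 <= A by apply: integ_ge0 => x; exact: sqr_ge0.
have N0 : 0 < 2 * N.+1%:R :> R by rewrite mulr_gt0.
have [->|Hn0] := eqVneq H 0; first by rewrite mulr0.
have Hp : 0 < H by rewrite lt_neqAle eq_sym Hn0.
rewrite -(ler_pM2r Hp).
have := ler_wpM2l (ltW N0) cs; have := ler_wpM2r A0 hK.
have -> : 2 * N.+1%:R * H ^+ 2 = 2 * N.+1%:R * H * H by ring.
have -> : 2 * N.+1%:R * (K * A) = 2 * N.+1%:R * K * A by ring.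
rewrite (mulrC A H); lra.
Qed.

(** The gap is applied to [g], the projection of [f] minus [f]. Lowering [g] gives the same kind of
    error for [af], with one index fewer, and by Pythagoras its norm is at most that of [af]. *)
Lemma hermite_tail f df N : has_deriv f df -> gdecay f -> gdecay df ->
  2 * N%:R * (integ (fun x => f x ^+ 2) - \sum_(n < N) hcoef f n ^+ 2) <=
  integ (fun x => (x * f x + df x) ^+ 2).
Proof.
move=> hd gf gdf.
case: N => [|N]; first by rewrite mulr0 mul0r; apply: integ_ge0 => x; exact: sqr_ge0.
pose af x := x * f x + df x.
have gaf : gdecay af by apply: gdecayD => //; exact: gdecay_mulx.
pose g x := \sum_(n < N.+1) hcoef f n * hermite_fun n x - f x.
have gS := gdecay_hcomb N.+1 (hcoef f).
have gg : gdecay g by exact: gdecayB.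
pose dS M (x : R) := \sum_(n < M) hcoef f n * (hermite_norm n * (x * phi n x - phi n.+1 x)).
have dSd M : has_deriv (fun x => \sum_(n < M) hcoef f n * hermite_fun n x) (dS M).
  rewrite /dS; elim: M => [|M IH].
    under [X in has_deriv X _]eq_fun do rewrite big_ord0.
    by apply: has_deriv_eq (has_deriv_cst 0) _ => x; rewrite big_ord0.
  under [X in has_deriv X _]eq_fun do rewrite big_ord_recr/= hermite_funE.
  apply: has_deriv_eq (has_derivD IH (has_derivZ _ (has_derivZ _ (phi_deriv M)))) _ => x.
  by rewrite big_ord_recr.
have gdS : gdecay (dS N.+1).
  by apply: gdecay_sum => i; apply: gdecayZ; apply: gdecayZ; exact: gdecay_phi_deriv.
have dg := has_derivB (dSd N.+1) hd; have gdg := gdecayB gdS gdf.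
have orth n : (n < N.+1)%N -> integ (fun x => phi n x * g x) = 0.
  move=> nN; have : hcoef g n = 0 by rewrite hcoefB// hcoef_hcomb// subrr.
  rewrite /hcoef; have -> : integ (fun x => hermite_fun n x * g x) =
     hermite_norm n * integ (fun x => phi n x * g x).
    rewrite -integZ; last exact: gdecayM (gdecay_phi _) gg.
    by apply: eq_integ => x; rewrite hermite_funE mulrA.
  by move/eqP; rewrite mulf_eq0 gt_eqF ?hermite_norm_gt0//= => /eqP.
have := spectral_gap dg gg gdg orth.
have -> : integ (fun x => g x ^+ 2) =
    integ (fun x => f x ^+ 2) - \sum_(n < N.+1) hcoef f n ^+ 2.
  rewrite /g integ_sqr_hcomb// big1 ?add0r// => i _; by rewrite subrr expr0n.
move=> /le_trans; apply.
(* Lowering kills index 0 and shifts the others, so the [N.+1] coefficients of [f] become the first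
   [N] coefficients of [af]; the square roots of [hermite_norm_S] combine into the integer
   factor. *)
have lower x : x * g x + (dS N.+1 x - df x) =
    \sum_(n < N) hcoef af n * hermite_fun n x - af x.
  transitivity (\sum_(n < N.+1) hcoef f n *
     (hermite_norm n * (2 * x * phi n x - phi n.+1 x)) - af x).
    rewrite /af /g mulrBr; apply/eqP; rewrite -subr_eq0; apply/eqP.
    rewrite mulr_sumr /dS opprB.
    set a := \sum_(n < N.+1) _; set b := \sum_(n < N.+1) _; set c := \sum_(n < N.+1) _.
    have -> : c = a + b.
      by rewrite /a /b /c -big_split; apply: eq_bigr => i _ /=; rewrite hermite_funE; ring.
    ring.
  congr (_ - _); rewrite big_ord_recl /= phi1 subrr !mulr0 add0r.
  apply: eq_bigr => i _; rewrite  /bump leq0n add1n phi_lower.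
  have -> : hcoef af i = Num.sqrt (2 * i.+1%:R) * hcoef f i.+1.
    rewrite /hcoef; transitivity (hermite_norm i * integ (fun x => phi i x * af x)).
      rewrite -integZ; last exact: gdecayM (gdecay_phi _) gaf.
      by apply: eq_integ => t; rewrite hermite_funE mulrA.
    rewrite -(phi_raise i hd gf gdf) hermite_norm_S -mulrA; congr (_ * _).
    rewrite -integZ; last exact: gdecayM (gdecay_phi _) gf.
    by apply: eq_integ => t; rewrite hermite_funE mulrA.
  rewrite hermite_funE (hermite_norm_S i).
  set s := Num.sqrt _; have s2 : s * s = 2 * i.+1%:R by rewrite -expr2 sqr_sqrtr.
  transitivity (hcoef f i.+1 * (hermite_norm i.+1 * ((2 * i.+1%:R) * phi i x))); first ring.
  by rewrite -s2; ring.
have -> : integ (fun x => (x * g x + (dS N.+1 x - df x)) ^+ 2) =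
    integ (fun x => (\sum_(n < N) hcoef af n * hermite_fun n x - af x) ^+ 2).
  by apply: eq_integ => x; rewrite lower.
rewrite integ_sqr_hcomb// big1 ?add0r => [|i _]; last by rewrite subrr expr0n.
by rewrite lerBlDr lerDl sumr_ge0// => i _; exact: sqr_ge0.
Qed.

End Hermite.

(** * Fast periodic factors tested against Hermite functions *)

Section PeriodicOscillation.
Context {R : realType}.
Implicit Types (f g q G Q : R -> R) (L M : R).

Definition periodic L g := forall x, g (x + L) = g x.

(** Zero mean over a period, encoded as the existence of a periodic primitive, which is the form
    that integration by parts consumes. *)
Definition zero_mean L g := exists2 G, has_deriv G g & periodic L G.

Lemma periodic_nat L g (n : nat) x : periodic L g -> g (x + n%:R * L) = g x.
Proof.
move=> h; elim: n => [|n IH]; first by rewrite mul0r addr0.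
by rewrite -natr1 mulrDl mul1r addrA h IH.
Qed.

Lemma periodic_bounded L g : 0 < L -> continuous g -> periodic L g ->
  exists M, forall x, `|g x| <= M.
Proof.
move=> L0 cg pg.
have [c _ hc] := @EVT_max R (fun x => `|g x|) 0 L (ltW L0)
  (continuous_subspaceT (cont_norm cg)).
exists `|g c| => x; case: (leP 0 x) => x0.
  have xL : 0 <= x / L by rewrite divr_ge0// ltW.
  have /andP[h1 h2] := truncn_itv xL; set n := Num.truncn _ in h1 h2.
  have -> : x = (x - n%:R * L) + n%:R * L by rewrite subrK.
  rewrite periodic_nat//; apply: hc; rewrite in_itv/=.
  by move: h1 h2; rewrite ler_pdivlMr// ltr_pdivrMr// -natr1 mulrDl mul1r; lra.
have xL : 0 <= - x / L by rewrite divr_ge0 ?(ltW L0)// oppr_ge0 ltW.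
have /andP[h1 h2] := truncn_itv xL; set n := Num.truncn _ in h1 h2.
rewrite -(periodic_nat n.+1 x pg); apply: hc; rewrite in_itv/=.
by move: h1 h2; rewrite ler_pdivlMr// ltr_pdivrMr// -natr1 mulrDl mul1r; lra.
Qed.

Lemma has_deriv_shift f df (c : R) : has_deriv f df ->
  has_deriv (fun x => f (x + c)) (fun x => df (x + c)).
Proof.
move=> h; have hx : has_deriv (fun x : R => x + c) (fun=> 1).
  by apply: has_deriv_eq (has_derivD has_deriv_id (has_deriv_cst c)) _ => x; lra.
by apply: has_deriv_eq (has_deriv_comp h hx) _ => x; rewrite mulr1.
Qed.

(** A primitive of [g] and its shift by [L] have the same derivative, so the primitive gains the
    same amount over every period; removing that slope makes it periodic. *)
Lemma zero_mean_decomp L g : 0 < L -> continuous g -> periodic L g ->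
  exists c, zero_mean L (fun x => g x - c).
Proof.
move=> L0 cg pg; have [F dF] := has_antideriv cg.
pose c := (F L - F 0) / L; exists c.
pose G x := F x - c * x.
have dG : has_deriv G (fun x => g x - c).
  apply: has_deriv_eq (has_derivB dF (has_derivZ c has_deriv_id)) _ => x.
  by rewrite mulr1.
exists G => // x.
have dS := has_deriv_shift L dF.
have dS' : has_deriv (fun x => F (x + L)) g by apply: has_deriv_eq dS _ => y; exact: pg.
have := has_deriv_cst_diff dS' dF x 0; rewrite add0r => h.
have cL : c * L = F L - F 0 by rewrite /c mulfVK// gt_eqF.
by rewrite /G mulrDr cL; lra.
Qed.

(* Integrating over the window of length [L] centred at [x]: the primitive
   returns to its value, while its first order part is [L * G x]. *)
Lemma zero_mean_primitive_bound L M g G : 0 < L -> has_deriv G g -> zero_mean L G ->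
  (forall x, `|g x| <= M) -> forall x, `|G x| <= L * M / 4.
Proof.
move=> L0 dG [P dP pP] gM x.
have lip z : `|G z - G x| <= M * `|z - x| by apply: has_deriv_lip dG _ => *.
have h1 := taylor1_bound (x + L / 2) dP lip.
have h2 := taylor1_bound (x - L / 2) dP lip.
have e : P (x + L / 2) = P (x - L / 2).
  by rewrite -(pP (x - L / 2)); congr P; field.
have e1 : x + L / 2 - x = L / 2 by ring.
have e2 : x - L / 2 - x = - (L / 2) by ring.
rewrite e e1 in h1; rewrite e2 in h2.
have h : `|G x * L| <= M / 2 * (L / 2) ^+ 2 + M / 2 * (- (L / 2)) ^+ 2.
  have -> : G x * L = (P (x - L / 2) - P x - G x * - (L / 2)) -
     (P (x - L / 2) - P x - G x * (L / 2)) by field.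
  by apply: le_trans (ler_normB _ _) _; lra.
rewrite normrM (gtr0_norm L0) in h.
rewrite -(ler_pM2r L0); apply: le_trans h _.
by rewrite le_eqVlt; apply/orP; left; apply/eqP; rewrite sqrrN; field.
Qed.

(** The primitive is recentred at each of the two integrations, so each of them gains a factor
    [L / 4]; this is the origin of 16. *)
Lemma zero_mean_second L M g : 0 < L -> continuous g -> zero_mean L g ->
  (forall x, `|g x| <= M) -> exists Q G,
  [/\ has_deriv Q G, has_deriv G g, periodic L Q, zero_mean L Q &
   forall x, `|G x| <= L * M / 4 /\ `|Q x| <= L ^+ 2 * M / 16].
Proof.
move=> L0 cg [G1 dG1 pG1] gM.
have [c [P dP pP]] := zero_mean_decomp L0 (has_deriv_cont dG1) pG1.
have dG : has_deriv (fun x => G1 x - c) g.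
  by apply: has_deriv_eq (has_derivB dG1 (has_deriv_cst c)) _ => x; rewrite subr0.
have [c' zP] := zero_mean_decomp L0 (has_deriv_cont dP) pP.
have dQ : has_deriv (fun x => P x - c') (fun x => G1 x - c).
  by apply: has_deriv_eq (has_derivB dP (has_deriv_cst c')) _ => x; rewrite subr0.
have bG := zero_mean_primitive_bound L0 dG (ex_intro2 _ _ P dP pP) gM.
have bQ := zero_mean_primitive_bound L0 dQ zP bG.
exists (fun x => P x - c'), (fun x => G1 x - c); split => //.
  by move=> x; rewrite pP.
move=> x; split; first exact: bG.
by apply: le_trans (bQ x) _; rewrite le_eqVlt; apply/orP; left; apply/eqP; field.
Qed.

Lemma has_deriv_scale f df (e : R) : has_deriv f df ->
  has_deriv (fun x => f (x / e)) (fun x => e^-1 * df (x / e)).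
Proof.
move=> h; have hx : has_deriv (fun x : R => x / e) (fun=> e^-1).
  have := has_derivZ e^-1 has_deriv_id.
  rewrite (_ : (fun x => _ * x) = fun x => x / e); last first.
    by apply/funext => x; rewrite mulrC.
  by move=> h'; apply: has_deriv_eq h' _ => x; rewrite mulr1.
by apply: has_deriv_eq (has_deriv_comp h hx) _ => x; rewrite mulrC.
Qed.

Lemma cont_scale f (e : R) : continuous f -> continuous (fun x : R => f (x / e)).
Proof.
by move=> cf; apply: (cont_comp cf); apply: contM; [exact: cont_id|exact: cont_cst].
Qed.

Variables (f df ddf : R -> R).
Hypotheses (hf : has_deriv f df) (hdf : has_deriv df ddf).
Hypotheses (gf : gdecay f) (gdf : gdecay df) (gddf : gdecay ddf).

Local Notation osc q e := (fun x => f x * q (x / e)).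

Lemma gdecay_osc q M e : continuous q -> (forall x, `|q x| <= M) -> gdecay (osc q e).
Proof.
move=> cq qM; apply: (@gdecay_mul_bounded _ _ _ M) => //; exact: cont_scale.
Qed.

(* One step: with [q = Q''], the eigenvalue relation trades [f q(x/e)] for
   [e^2 (2 n + 1) f Q(x/e)] up to O(e), and [|Q| <= L^2 M / 16]. *)
Lemma osc_hcoef_iter L (B : R) (k : nat) : 0 < L -> 0 <= B -> B * L ^+ 2 / 16 <= 1 / 2 ->
  forall q M, continuous q -> periodic L q -> zero_mean L q ->
  (forall x, `|q x| <= M) ->
  exists2 C, 0 <= C & forall (e : R) (N : nat), 0 < e -> e <= 1 -> 2 * N%:R * e ^+ 2 <= B ->
   \sum_(n < N) hcoef (osc q e) n ^+ 2 <=
   2^-1 ^+ k * M ^+ 2 * integ (fun x => f x ^+ 2) + C * e ^+ 2.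
Proof.
move=> L0 B0 BL; elim: k => [|k IH] q M cq pq zq qM.
  exists 0 => // e N e0 e1 NB; rewrite expr0 mul1r mul0r addr0.
  have M0 : 0 <= M by apply: le_trans (qM 0).
  apply: le_trans (bessel N (gdecay_osc e cq qM)) _.
  apply: integ_sqr_le => //; first exact: gdecay_osc qM.
  by move=> x; rewrite normrM mulrC ler_wpM2r.
have M0 : 0 <= M by apply: le_trans (qM 0).
have [Q [G [dQ dG pQ zQ bd]]] := zero_mean_second L0 cq zq qM.
have cQ := has_deriv_cont dQ; have cG := has_deriv_cont dG.
have bG x : `|G x| <= L * M / 4 by case: (bd x).
have bQ x : `|Q x| <= L ^+ 2 * M / 16 by case: (bd x).
have [C C0 hC] := IH Q _ cQ pQ zQ bQ.
have gx2 : gdecay (fun x => x ^+ 2 * f x).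
  by apply: eq_gdecay (gdecay_mulx (gdecay_mulx gf)) _ => x; rewrite expr2 mulrA.
have LM0 : 0 <= L * M / 4 by rewrite divr_ge0// mulr_ge0// ltW.
have L2M0 : 0 <= L ^+ 2 * M / 16 by rewrite divr_ge0// mulr_ge0// sqr_ge0.
(* Majorant of the error term [Er] divided by [e], valid for all [e <= 1]; it makes [C'] independent
   of [e] and [N]. *)
pose K x := L ^+ 2 * M / 16 * (`|x ^+ 2 * f x| + `|ddf x|) + 2 * (L * M / 4) * `|df x|.
have gK : gdecay K.
  apply: gdecayD; apply: gdecayZ; last exact: gdecay_norm.
  by apply: gdecayD; exact: gdecay_norm.
have K0 x : 0 <= K x.
  by rewrite addr_ge0// mulr_ge0// ?addr_ge0// mulr_ge0.
pose C' := 2 * B ^+ 2 * C + 2 * integ (fun x => K x ^+ 2).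
exists C'.
  rewrite addr_ge0// mulr_ge0// ?mulr_ge0 ?sqr_ge0//.
  by apply: integ_ge0 => x; exact: sqr_ge0.
move=> e N e0 e1 NB.
have en0 : e != 0 by rewrite gt_eqF.
have gQ : gdecay (osc Q e) by exact: gdecay_osc bQ.
have gdQ : gdecay (fun x => df x * Q (x / e)).
  by apply: (@gdecay_mul_bounded _ _ _ (L ^+ 2 * M / 16)) => //; exact: cont_scale.
have gddQ : gdecay (fun x => ddf x * Q (x / e)).
  by apply: (@gdecay_mul_bounded _ _ _ (L ^+ 2 * M / 16)) => //; exact: cont_scale.
have gG : gdecay (osc G e) by exact: gdecay_osc bG.
have gdG : gdecay (fun x => df x * G (x / e)).
  by apply: (@gdecay_mul_bounded _ _ _ (L * M / 4)) => //; exact: cont_scale.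
have gq : gdecay (osc q e) by exact: gdecay_osc qM.
have d1 : has_deriv (osc Q e) (fun x => df x * Q (x / e) + e^-1 * (f x * G (x / e))).
  apply: has_deriv_eq (has_derivM hf (has_deriv_scale e dQ)) _ => x; ring.
have g1 : gdecay (fun x => df x * Q (x / e) + e^-1 * (f x * G (x / e))).
  by apply: gdecayD => //; exact: gdecayZ.
pose D2 x := ddf x * Q (x / e) + 2 * e^-1 * (df x * G (x / e)) + e^-1 ^+ 2 * (f x * q (x / e)).
have d2 : has_deriv (fun x => df x * Q (x / e) + e^-1 * (f x * G (x / e))) D2.
  apply: has_deriv_eq (has_derivD (has_derivM hdf (has_deriv_scale e dQ))
    (has_derivZ e^-1 (has_derivM hf (has_deriv_scale e dG)))) _ => x.
  by rewrite /D2; ring.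
have g2 : gdecay D2 by apply: gdecayD; [apply: gdecayD|]; rewrite //; exact: gdecayZ.
(* What remains, of size O(e), when [e ^ 2] times [D2] is solved for [f q (./e)] and the term with
   [2 n + 1] is set apart. *)
pose Er x := e ^+ 2 * (x ^+ 2 * (f x * Q (x / e)) - ddf x * Q (x / e)) - 2 * e * (df x * G (x / e)).
have gx2Q : gdecay (fun x => x ^+ 2 * (f x * Q (x / e))).
  apply: eq_gdecay (gdecay_mulx (gdecay_mulx gQ)) _ => x; by rewrite expr2 mulrA.
have gEr : gdecay Er.
  by apply: gdecayB; apply: gdecayZ => //; exact: gdecayB.
have id n : hcoef (osc q e) n = hcoef Er n - e ^+ 2 * (2 * n%:R + 1) * hcoef (osc Q e) n.
  have eg := hermite_fun_eigen n d1 d2 gQ g1 g2.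
  have -> : hcoef Er n = e ^+ 2 * (hcoef (fun x => x ^+ 2 * (f x * Q (x / e))) n -
      hcoef D2 n) + hcoef (osc q e) n.
    rewrite -hcoefB// -hcoefZ; last exact: gdecayB.
    rewrite -hcoefD//; last by apply: gdecayZ; exact: gdecayB.
    congr hcoef; apply/funext => x; rewrite /Er /D2; field.
    by rewrite en0.
  rewrite -/(hcoef D2 n) -/(hcoef _ n) -/(hcoef _ n) in eg.
  by rewrite /hcoef in eg *; rewrite eg; ring.
have sE : \sum_(n < N) hcoef Er n ^+ 2 <= e ^+ 2 * integ (fun x => K x ^+ 2).
  apply: le_trans (bessel N gEr) _; apply: integ_sqr_le => //; first exact: ltW.
  move=> x; rewrite (ger0_norm (K0 x)) /Er.
  have e2e : e ^+ 2 <= e by rewrite expr2 -[leRHS]mul1r ler_wpM2r// ltW.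
  apply: le_trans (ler_normB _ _) _; rewrite /K [leRHS]mulrDr; apply: lerD.
    rewrite normrM (ger0_norm (sqr_ge0 e)).
    apply: ler_pM; [exact: sqr_ge0|exact: normr_ge0|exact: e2e|].
    apply: le_trans (ler_normB _ _) _; rewrite mulrDr !normrM; apply: lerD.
      by rewrite mulrA mulrC ler_wpM2r// mulr_ge0.
    by rewrite mulrC ler_wpM2r.
  rewrite !normrM (ger0_norm (ltW e0)) ger0_norm//.
  have -> : e * (2 * (L * M / 4) * `|df x|) = 2 * e * (`|df x| * (L * M / 4)) by ring.
  by rewrite ler_wpM2l ?ler_wpM2l// mulr_ge0// ltW.
have sQ : \sum_(n < N) (e ^+ 2 * (2 * n%:R + 1) * hcoef (osc Q e) n) ^+ 2 <=
    B ^+ 2 * \sum_(n < N) hcoef (osc Q e) n ^+ 2.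
  rewrite mulr_sumr; apply: ler_sum => i _.
  rewrite exprMn ler_wpM2r ?sqr_ge0// lerXn2r ?nnegrE//.
    by rewrite mulr_ge0 ?sqr_ge0// addr_ge0// mulr_ge0.
  apply: le_trans NB; rewrite mulrC ler_wpM2r ?sqr_ge0//.
  have : i.+1%:R <= N%:R :> R by rewrite ler_nat.
  rewrite -natr1; lra.
(* The factor 2 comes from [(a - b)^2 <= 2 a^2 + 2 b^2], and [B] bounds [e^2 (2 n + 1)] for [n < N].
   With [B L^2 / 16 <= 1 / 2] one step then contributes [2 * (1 / 2)^2 = 1 / 2]. *)
have B2 : 2 * B ^+ 2 * (L ^+ 2 * M / 16) ^+ 2 <= 2^-1 * M ^+ 2.
  have -> : 2 * B ^+ 2 * (L ^+ 2 * M / 16) ^+ 2 = 2 * (B * L ^+ 2 / 16) ^+ 2 * M ^+ 2 by field.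
  rewrite ler_wpM2r ?sqr_ge0//.
  have b0 : 0 <= B * L ^+ 2 / 16 by rewrite divr_ge0// mulr_ge0// sqr_ge0.
  have : (B * L ^+ 2 / 16) ^+ 2 <= (1 / 2) ^+ 2 by rewrite lerXn2r ?nnegrE//; lra.
  by rewrite -[(1 / 2) ^+ 2]/(1 / 2 * (1 / 2)); lra.
have S0 : 0 <= integ (fun x => f x ^+ 2) by apply: integ_ge0 => x; exact: sqr_ge0.
have := hC e N e0 e1 NB => hQ.
apply: (@le_trans _ _ (2 * \sum_(n < N) hcoef Er n ^+ 2 +
    2 * \sum_(n < N) (e ^+ 2 * (2 * n%:R + 1) * hcoef (osc Q e) n) ^+ 2)).
  rewrite !mulr_sumr -big_split; apply: ler_sum => i _ /=; rewrite id.
  rewrite -subr_ge0; set a := hcoef Er i; set b := _ * hcoef _ i.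
  have -> : 2 * a ^+ 2 + 2 * b ^+ 2 - (a - b) ^+ 2 = (a + b) ^+ 2 by ring.
  exact: sqr_ge0.
apply: (@le_trans _ _ (2 * (e ^+ 2 * integ (fun x => K x ^+ 2)) + 2 * (B ^+ 2 *
   (2^-1 ^+ k * (L ^+ 2 * M / 16) ^+ 2 * integ (fun x => f x ^+ 2) + C * e ^+ 2)))).
  apply: lerD; rewrite ler_wpM2l//; apply: le_trans sQ _.
  by rewrite ler_wpM2l// sqr_ge0.
have : 2^-1 ^+ k * integ (fun x => f x ^+ 2) * (2 * B ^+ 2 * (L ^+ 2 * M / 16) ^+ 2) <=
    2^-1 ^+ k * integ (fun x => f x ^+ 2) * (2^-1 * M ^+ 2).
  by rewrite ler_wpM2l// mulr_ge0// exprn_ge0.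
rewrite /C' (exprS _ k).
set I2 := integ (fun x => f x ^+ 2); set K2 := integ _.
move: (L ^+ 2 * M / 16) (2^-1 ^+ k) I2 K2 => q' a I2 K2 h.
by rewrite -subr_ge0; move: h; rewrite -subr_ge0 => h; apply: le_trans h _;
  rewrite le_eqVlt; apply/orP; left; apply/eqP; field.
Qed.

(** The number [k] of steps is fixed before [e]: it makes the geometric part at most [eta / 2]
    (through [k <= 2 ^ k]), and only then does a small [e] absorb [C e^2], whose constant depends on
    [k]. *)
Lemma osc_hcoef_small L (B : R) q : 0 < L -> 0 <= B -> B * L ^+ 2 / 16 <= 1 / 2 ->
  continuous q -> periodic L q -> zero_mean L q ->
  forall eta : R, 0 < eta -> exists2 e0 : R, 0 < e0 &
  forall (e : R) (N : nat), 0 < e -> e <= e0 -> 2 * N%:R * e ^+ 2 <= B ->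
  \sum_(n < N) hcoef (osc q e) n ^+ 2 <= eta.
Proof.
move=> L0 B0 BL cq pq zq eta eta0; have [M qM] := periodic_bounded L0 cq pq.
pose A := M ^+ 2 * integ (fun x => f x ^+ 2).
have A0 : 0 <= A.
  by rewrite mulr_ge0 ?sqr_ge0//; apply: integ_ge0 => x; exact: sqr_ge0.
have [k hk] : exists k : nat, 2^-1 ^+ k * A <= eta / 2.
  pose k := (Num.truncn (2 * A / eta)).+1; exists k.
  have a0 : 0 <= 2 * A / eta by rewrite divr_ge0 ?(ltW eta0)// mulr_ge0.
  have /andP[_ h] := truncn_itv a0; rewrite -/k in h; clearbody k.
  have k2 : k%:R <= 2 ^+ k :> R by rewrite -natrX ler_nat ltnW// ltn_expl.
  rewrite exprVn mulrC ler_pdivrMr ?exprn_gt0//.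
  have h3 : eta / 2 * k%:R <= eta / 2 * 2 ^+ k by rewrite ler_wpM2l// divr_ge0// ltW.
  apply: le_trans h3; move: h; rewrite ltr_pdivrMr// => h; lra.
have [C C0 hC] := osc_hcoef_iter k L0 B0 BL cq pq zq qM.
pose e0 := Num.min 1 (eta / (2 * (C + 1))).
have C1 : 0 < C + 1 by lra.
exists e0; first by rewrite lt_min ltr01 divr_gt0// mulr_gt0.
move=> e N ep; rewrite le_min => /andP[e1 e2] NB.
apply: le_trans (hC e N ep e1 NB) _.
have -> : eta = eta / 2 + eta / 2 by field.
apply: lerD; first by rewrite -mulrA.
have h1 : C * e ^+ 2 <= (C + 1) * e.
  apply: ler_pM => //; [exact: sqr_ge0|lra|].
  by rewrite expr2 -[leRHS]mul1r ler_wpM2r// ltW.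
apply: le_trans h1 _; move: e2; rewrite ler_pdivlMr ?mulr_gt0//; lra.
Qed.

(** One integration by parts: [q (x / e)] is the derivative of [e G (x / e)] with [G] bounded. This
    controls the normalising constant of the oscillating density. *)
Lemma osc_integ_small L q : 0 < L -> continuous q -> periodic L q -> zero_mean L q ->
  exists2 C, 0 <= C & forall e : R, 0 < e -> `|integ (osc q e)| <= C * e.
Proof.
move=> L0 cq pq [G dG pG]; have [M qM] := periodic_bounded L0 cq pq.
have cG := has_deriv_cont dG; have [M' GM] := periodic_bounded L0 cG pG.
have M0 : 0 <= M' by apply: le_trans (GM 0).
exists (M' * integ (fun x => `|df x|)).
  by rewrite mulr_ge0//; exact: integ_ge0.
move=> e e0; have en0 : e != 0 by rewrite gt_eqF.
have gG : gdecay (osc G e) by exact: gdecay_osc GM.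
have gdG : gdecay (fun x => df x * G (x / e)).
  by apply: (@gdecay_mul_bounded _ _ _ M') => //; exact: cont_scale.
have gq : gdecay (osc q e) by exact: gdecay_osc qM.
have gq' : gdecay (fun x => f x * (e^-1 * q (x / e))).
  by apply: eq_gdecay (gdecayZ e^-1 gq) _ => x; ring.
have ip := integ_by_parts hf (has_deriv_scale e dG) gG gdG gq'.
have -> : integ (osc q e) = - e * integ (fun x => df x * G (x / e)).
  rewrite ip mulrNN -integZ//; apply: eq_integ => x; field; exact: en0.
rewrite normrM normrN (gtr0_norm e0) mulrC ler_wpM2r ?(ltW e0)//.
apply: gdecay_le_integ => //; first exact: gdecay_norm.
by move=> x _; rewrite normrM mulrC ler_wpM2r.
Qed.

End PeriodicOscillation.

(** * Recursions driven by independent inputs *)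

Section RandomRecursion.
Context {R : realType} {d : measure_display} {Omega : measurableType d}
  (P : probability Omega R).
Context {d' : measure_display} {T : measurableType d'}.
Local Open Scope ereal_scope.

Fixpoint chain (F : T * measurableTypeR R -> T) (xi : nat -> Omega -> R) (s0 : T) (k : nat)
    (w : Omega) : T :=
  if k is k'.+1 then F (chain F xi s0 k' w, xi k' w) else s0.

Variables (nu : probability (measurableTypeR R) R).
Variables (xi : nat -> Omega -> R).
Hypothesis mxi : forall i, measurable_fun setT (xi i : Omega -> measurableTypeR R).
Hypothesis indep : forall n (A : nat -> set (measurableTypeR R)),
  (forall i, measurable (A i)) ->
  fine (P (\bigcap_(i in `I_n) [set w | A i (xi i w)])) =
  (\prod_(i < n) fine (nu (A i)))%R.

Variables (F : T * measurableTypeR R -> T) (s0 : T).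
Hypothesis mF : measurable_fun setT F.

Local Notation S := (chain F xi s0).

Lemma measurable_chain k : measurable_fun setT (S k).
Proof.
elim: k => [|k IH]; first exact: measurable_cst.
exact: (measurableT_comp mF (measurable_fun_pair IH (mxi k))).
Qed.

Let Sk k : {RV P >-> T} :=
  HB.pack (S k) (isMeasurableFun.Build _ _ _ _ _ (measurable_chain k)).

Let future k m (A : nat -> set (measurableTypeR R)) :=
  \bigcap_(i in `I_m) [set w | A i (xi (k + i)%N w)].

Let measurable_future k m A : (forall i, measurable (A i)) -> measurable (future k m A).
Proof.
move=> mA; apply: bigcap_measurableType => i _.
by rewrite -[X in measurable X]setTI; exact: mxi.
Qed.

(* The state at time [k] is independent of the present and future inputs; the
   induction has to carry all future inputs along. *)
Let future_indep k := forall m (A : nat -> set (measurableTypeR R)) (C : set T),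
  (forall i, measurable (A i)) -> measurable C ->
  P (S k @^-1` C `&` future k m A) =
  P (S k @^-1` C) * (\prod_(i < m) fine (nu (A i)))%:E.

(** As functions of [X] both sides are measures, and on rectangles they agree by the independence
    statement at [m.+1], with [B] put in front of the sequence [A]. Uniqueness of the product
    measure is applied after division by [c], whence the separate case [c = 0]. *)
Let joint_law k : future_indep k ->
  forall m (A : nat -> set (measurableTypeR R)) (X : set (T * measurableTypeR R)),
  (forall i, measurable (A i)) -> measurable X ->
  P ((fun w => (S k w, xi k w)) @^-1` X `&` future k.+1 m A) =
  (distribution P (Sk k) \x nu) X * (\prod_(i < m) fine (nu (A i)))%:E.
Proof.
move=> IH m A X mA mX; have mrest := measurable_future k.+1 m mA.
pose J w := (S k w, xi k w : measurableTypeR R).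
have mJ : measurable_fun setT J := measurable_fun_pair (measurable_chain k) (mxi k).
pose m' : {measure set (T * measurableTypeR R) -> \bar R} :=
  measure_function_pushforward__canonical__measure_function_Measure (mrestr P mrest) mJ.
set c := (\prod_(i < m) fine (nu (A i)))%R.
have c0 : (0 <= c)%R by apply: prodr_ge0 => i _; exact: fine_ge0.
have m'E D B : measurable D -> measurable B ->
    m' (D `*` B) = distribution P (Sk k) D * nu B * c%:E.
  move=> mD mB; pose A' i := if i is i'.+1 then A i' else B.
  have mA' i : measurable (A' i) by case: i => [|i] /=; [exact: mB|exact: mA].
  have := IH m.+1 A' D mA' mD; rewrite big_ord_recl /= EFinM fineK ?fin_num_measure// muleA => <-.
  congr (P _); apply/seteqP; split => w /=.
    move=> [[h1 h2] h3]; split => // -[|i] /= im; first by rewrite addn0.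
    by rewrite addnS -addSn; exact: h3.
  move=> [h1 h2]; split; first by split => //; have := h2 0%N isT; rewrite addn0.
  by move=> i im; have := h2 i.+1 im; rewrite /= addnS -addSn.
change (m' X = (distribution P (Sk k) \x nu) X * c%:E).
have [cE|cn0] := eqVneq c 0%R.
  rewrite cE mule0; apply/eqP; rewrite -measure_le0.
  have <- : m' (setT `*` setT) = 0 by rewrite m'E// cE mule0.
  by apply: le_measure; rewrite ?inE ?setXTT//; exact: subsetT.
have ci0 : (0 <= c^-1)%R by rewrite invr_ge0.
rewrite (@product_measure_unique _ _ _ _ _ _ _ (mscale (NngNum ci0) m'))//.
  by rewrite /mscale/= muleAC -EFinM mulVf// mul1e.
move=> D B mD mB; change ((c^-1)%:E * m' (D `*` B) = distribution P (Sk k) D * nu B).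
by rewrite m'E// muleCA -EFinM mulVf// mule1.
Qed.

Let chain_future_indep k : future_indep k.
Proof.
elim: k => [|k IH] m A C mA mC.
  have [Cs|nCs] := pselect (C s0).
    have -> : S 0 @^-1` C = setT by apply/seteqP; split.
    rewrite setTI probability_setT mul1e -indep// fineK// fin_num_measure//.
    exact: (@measurable_future 0 m A mA).
  have -> : S 0 @^-1` C = set0 by apply/seteqP; split.
  by rewrite set0I measure0 mul0e.
have mFC : measurable (F @^-1` C) by rewrite -[X in measurable X]setTI; exact: mF.
rewrite (joint_law IH m mA mFC); congr (_ * _).
have := joint_law IH 0 mA mFC; rewrite big_ord0 mule1 => <-.
by congr (P _); apply/seteqP; split => w //= [].
Qed.

(** One-step Markov property: the state and the next input have the product law, so Tonelli
    integrates the input first. *)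
Lemma chain_integral k (phi : T -> \bar R) : measurable_fun setT phi ->
  (forall s, 0 <= phi s) ->
  \int[P]_w phi (S k.+1 w) = \int[P]_w \int[nu]_z phi (F (S k w, z)).
Proof.
move=> mphi phi0.
pose J w := (S k w, xi k w : measurableTypeR R).
have mJ : measurable_fun setT J := measurable_fun_pair (measurable_chain k) (mxi k).
have mpF : measurable_fun setT (phi \o F) := measurableT_comp mphi mF.
transitivity (\int[distribution P (Sk k) \x nu]_x (phi \o F) x).
  transitivity (\int[pushforward P J]_x (phi \o F) x).
    by rewrite ge0_integral_pushforward// => x _; exact: phi0.
  apply: eq_measure_integral => X mX _.
  have := joint_law (@chain_future_indep k) 0 (fun=> measurableT) mX.
  rewrite big_ord0 mule1 => H; apply: etrans H; congr (P _).
  by apply/seteqP; split => w //= [].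
rewrite fubini_tonelli1//; last by move=> x; exact: phi0.
rewrite ge0_integral_distribution//.
- by apply: measurable_fun_fubini_tonelli_F => // x; exact: phi0.
- by move=> x; apply: integral_ge0 => z _; exact: phi0.
Qed.

(** Discrete Gronwall in mean for a Lyapunov function vanishing at the start. The geometric sum is
    bounded by [n] times its largest factor, so that [a = 0] is included; the later uses are [a = 0]
    and [a = 1 / n]. *)
Lemma chain_drift (V : T -> R) (a b : R) (n : nat) : (0 <= a)%R -> (0 <= b)%R ->
  measurable_fun setT V -> (forall s, (0 <= V s)%R) -> V s0 = 0%R ->
  (forall s, \int[nu]_z (V (F (s, z)))%:E <= ((1 + a) * V s + b)%:E) ->
  \int[P]_w (V (S n w))%:E <= ((1 + a) ^+ n * (n%:R * b))%:E.
Proof.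
move=> a0 b0 mV V0 Vs h; elim: n => [|n IH].
  rewrite mul0r mulr0; under eq_integral do rewrite /= Vs.
  by rewrite integral0.
have mVE : measurable_fun setT (EFin \o V) by exact/measurable_EFinP.
rewrite (@chain_integral n (EFin \o V))//.
have mVS : measurable_fun setT (fun w => (V (S n w))%:E).
  exact: (measurableT_comp mVE (measurable_chain n)).
apply: (@le_trans _ _ (\int[P]_w ((1 + a)%:E * (V (S n w))%:E + b%:E))).
  apply: ge0_le_integral => //.
  - by move=> w _; apply: integral_ge0 => z _; rewrite lee_fin.
  - have mpF : measurable_fun setT ((EFin \o V) \o F) := measurableT_comp mVE mF.
    have := @measurable_fun_fubini_tonelli_F _ _ _ _ _ nu _ mpF (fun x => V0 (F x)).
    by move=> hm; exact: (measurableT_comp hm (measurable_chain n)).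
  - by apply: emeasurable_funD => //; exact: measurable_funeM.
  - by move=> w _; exact: h.
rewrite ge0_integralD//; last first.
- exact: measurable_funeM.
- by move=> w _; rewrite -EFinM lee_fin mulr_ge0// addr_ge0.
rewrite ge0_integralZl//; last 2 first.
- by move=> w _; rewrite lee_fin.
- by rewrite lee_fin addr_ge0.
have -> : \int[P]__ b%:E = b%:E by rewrite integral_cst//= (@probability_setT _ _ _ P) mule1.
apply: (@le_trans _ _ ((1 + a)%:E * ((1 + a) ^+ n * (n%:R * b))%:E + b%:E)).
  by apply: leeD => //; apply: lee_wpmul2l => //; rewrite lee_fin addr_ge0.
rewrite -EFinM -EFinD lee_fin.
rewrite (_ : (1 + a) * _ = (1 + a) ^+ n.+1 * (n%:R * b))%R; last by rewrite (exprS _ n) !mulrA.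
have e1 : (1 <= (1 + a) ^+ n.+1)%R by apply: exprn_ege1; rewrite lerDl.
rewrite -natr1 mulrDl mul1r mulrDr lerD2l ler_peMl//.
Qed.

End RandomRecursion.

(** * Gaussian moments and the one-step Ito expansion *)

Section GaussianMoments.
Context {R : realType}.
Implicit Types (f g : R -> R).
Variable tau : R.
Hypothesis tau0 : 0 < tau.
Local Notation leb := (@lebesgue_measure R).
Local Notation pdf := (@normal_pdf R 0 tau).

(** The mean under the centred normal law, as a Lebesgue integral, to which the calculus of [gdecay]
    applies. *)
Definition gmean f : R := integ (fun z => f z * pdf z).

(** The Radon-Nikodym derivative of the normal law agrees almost everywhere with its density, since
    both have the same integrals over measurable sets. *)
Lemma normal_prob_integral f : continuous f -> (forall z, 0 <= f z) ->
  (\int[normal_prob 0 tau]_z (f z)%:E = \int[leb]_z (f z * pdf z)%:E)%E.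
Proof.
move=> cf f0; have dom := @normal_prob_dominates R 0 tau.
have mf : measurable_fun setT (EFin \o f : measurableTypeR R -> \bar R).
  by apply/measurable_EFinP; exact: continuous_measurable_fun.
rewrite -(Radon_Nikodym_SigmaFinite.change_of_variables dom _ measurableT mf); last first.
  by move=> x; rewrite lee_fin.
apply: ae_eq_integral => //.
- apply: emeasurable_funM => //.
  exact: measurable_int (Radon_Nikodym_SigmaFinite.f_integrable dom).
- apply/measurable_EFinP; apply: measurable_funM.
    exact: continuous_measurable_fun.
  exact: measurable_normal_pdf.
under [X in ae_eq _ _ _ X]eq_fun do rewrite EFinM.
apply: ae_eqe_mul2l; apply: integral_ae_eq => //.
- exact: Radon_Nikodym_SigmaFinite.f_integrable.
- by apply/measurable_EFinP; exact: measurable_normal_pdf.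
by move=> A _ mA; rewrite -Radon_Nikodym_SigmaFinite.f_integral.
Qed.

Lemma pdf_gauss : exists2 c : R, 0 < c & forall z, pdf z = c * gauss (2 * tau ^+ 2)^-1 0 z.
Proof.
have t20 : 0 < (2 * tau ^+ 2)^-1 by rewrite invr_gt0 mulr_gt0// exprn_gt0.
have [c c0 h] := @normal_pdf_gauss R 0 _ t20; exists c => // z; rewrite -h; congr normal_pdf.
have -> : (2 * (2 * tau ^+ 2)^-1)^-1 = tau ^+ 2 by field; rewrite gt_eqF.
by rewrite sqrtr_sqr gtr0_norm.
Qed.

Lemma gdecay_pdf : gdecay pdf.
Proof.
have [c c0 h] := pdf_gauss.
have t20 : 0 < (2 * tau ^+ 2)^-1 by rewrite invr_gt0 mulr_gt0// exprn_gt0.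
by apply: eq_gdecay (gdecayZ c (@gdecay_gauss R _ 0 t20)) _ => z; rewrite h.
Qed.

Lemma pdf_deriv : has_deriv pdf (fun z => - (z / tau ^+ 2) * pdf z).
Proof.
have [c c0 h] := pdf_gauss.
rewrite (_ : pdf = fun z => c * gauss (2 * tau ^+ 2)^-1 0 z); last by apply/funext.
rewrite /gauss; under [X in has_deriv X _]eq_fun do rewrite subr0 expr2.
apply: has_deriv_eq (has_derivZ c (has_deriv_exp (has_derivN (has_derivZ _
  (has_derivM has_deriv_id has_deriv_id))))) _ => x.
rewrite /= subr0 expr2 [RHS]mulrCA; congr (_ * (_ * _)).
by field; rewrite gt_eqF.
Qed.

Lemma gmeanD f g : pgrowth f -> pgrowth g ->
  gmean (fun z => f z + g z) = gmean f + gmean g.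
Proof.
move=> hf hg; have gp := gdecay_pdf.
have h1 : gdecay (fun z => f z * pdf z).
  by apply: eq_gdecay (gdecayMp gp hf) _ => z; rewrite mulrC.
have h2 : gdecay (fun z => g z * pdf z).
  by apply: eq_gdecay (gdecayMp gp hg) _ => z; rewrite mulrC.
by rewrite /gmean -integD//; apply: eq_integ => z; rewrite mulrDl.
Qed.

Lemma gdecay_pgrowth_pdf f : pgrowth f -> gdecay (fun z => f z * pdf z).
Proof.
by move=> hf; apply: eq_gdecay (gdecayMp gdecay_pdf hf) _ => z; rewrite mulrC.
Qed.

Lemma gmeanZ c f : pgrowth f -> gmean (fun z => c * f z) = c * gmean f.
Proof.
move=> hf; rewrite /gmean -integZ; last exact: gdecay_pgrowth_pdf.
by apply: eq_integ => z; rewrite mulrA.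
Qed.

Lemma gmean_le f g : pgrowth f -> pgrowth g -> (forall z, f z <= g z) -> gmean f <= gmean g.
Proof.
move=> hf hg h; apply: integ_le; [exact: gdecay_pgrowth_pdf|exact: gdecay_pgrowth_pdf|].
by move=> z; rewrite ler_wpM2r// normal_pdf_ge0.
Qed.

Lemma eq_gmean f g : (forall z, f z = g z) -> gmean f = gmean g.
Proof. by move=> h; apply: eq_integ => z; rewrite h. Qed.

Lemma gmean_abs f g : pgrowth f -> pgrowth g -> (forall z, `|f z| <= g z) ->
  `|gmean f| <= gmean g.
Proof.
move=> hf hg h; have hNg : pgrowth (fun z => -1 * g z) by exact: pgrowthZ.
have := gmean_le hf hg (fun z => le_trans (ler_norm _) (h z)).
have : gmean (fun z => -1 * g z) <= gmean f.
  by apply: gmean_le => // z; have := h z; rewrite ler_norml => /andP[]; lra.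
by rewrite gmeanZ// ler_norml; lra.
Qed.

Lemma gmean_cst c : gmean (fun=> c) = c.
Proof.
transitivity (gmean (fun z => c * 1)); first by apply: eq_gmean => z; rewrite mulr1.
rewrite gmeanZ; last exact: pgrowth_cst.
suff -> : gmean (fun=> 1) = 1 by rewrite mulr1.
rewrite /gmean /integ /Rintegral.
under eq_integral do rewrite mul1r.
by rewrite integral_normal_pdf.
Qed.

Lemma pgrowthX n : pgrowth (fun z : R => z ^+ n).
Proof.
elim: n => [|n IH]; first exact: (pgrowth_cst 1).
by apply: eq_pgrowth (pgrowthM pgrowth_id IH) _ => z; rewrite exprS.
Qed.

(** Stein's identity, the source of all the moments below: the density has logarithmic derivative
    [- z / tau^2]. *)
Lemma gmean_deriv f df : has_deriv f df -> pgrowth f -> pgrowth df ->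
  gmean (fun z => z * f z) = tau ^+ 2 * gmean df.
Proof.
move=> hf gf gdf; have gxf := pgrowthM pgrowth_id gf.
have tn0 : tau != 0 by rewrite gt_eqF.
have tn : tau ^+ 2 != 0 by rewrite expf_neq0.
have d1 : gdecay (fun z => f z * (- (z / tau ^+ 2) * pdf z)).
  apply: eq_gdecay (gdecayZ (- (tau ^+ 2)^-1) (gdecay_pgrowth_pdf gxf)) _ => z.
  by field.
have := integ_by_parts hf pdf_deriv (gdecay_pgrowth_pdf gf) (gdecay_pgrowth_pdf gdf) d1.
rewrite -/(gmean df) => ->.
have -> : integ (fun z => f z * (- (z / tau ^+ 2) * pdf z)) =
    - (tau ^+ 2)^-1 * gmean (fun z => z * f z).
  rewrite /gmean -integZ; last exact: gdecay_pgrowth_pdf.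
  by apply: eq_integ => z; field.
by rewrite mulNr opprK mulVKf.
Qed.

Lemma gmean1 : gmean (fun z => z) = 0.
Proof.
transitivity (gmean (fun z => z * 1)); first by apply: eq_gmean => z; rewrite mulr1.
rewrite (gmean_deriv (has_deriv_cst 1) (pgrowth_cst _) (pgrowth_cst _)).
by rewrite gmean_cst mulr0.
Qed.

Lemma gmean2 : gmean (fun z => z ^+ 2) = tau ^+ 2.
Proof.
rewrite (gmean_deriv has_deriv_id pgrowth_id (pgrowth_cst 1)).
by rewrite gmean_cst mulr1.
Qed.

Lemma gmean4 : gmean (fun z => z ^+ 4) = 3 * tau ^+ 4.
Proof.
transitivity (gmean (fun z => z * z ^+ 3)); first by apply: eq_gmean => z; rewrite -exprS.
have d3 : has_deriv (fun z : R => z ^+ 3) (fun z => 3 * z ^+ 2).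
  have h := has_derivM has_deriv_id (has_derivM has_deriv_id (@has_deriv_id R)).
  rewrite (_ : (fun z => z ^+ 3) = fun z : R => z * (z * z)); last by apply/funext => z; ring.
  by apply: has_deriv_eq h _ => z; ring.
rewrite (gmean_deriv d3 (pgrowthX 3) (pgrowthZ 3 (pgrowthX 2))).
by rewrite gmeanZ ?gmean2; [ring|exact: pgrowthX].
Qed.

Lemma normal_prob_gmean f : pgrowth f -> (forall z, 0 <= f z) ->
  (\int[normal_prob 0 tau]_z (f z)%:E = (gmean f)%:E)%E.
Proof.
move=> hf f0; rewrite normal_prob_integral//; last by case: hf.
rewrite /gmean /integ /Rintegral fineK//.
by apply: integrable_fin_num => //; apply: gdecay_integrable; exact: gdecay_pgrowth_pdf.
Qed.

Lemma gmean_sqr_affine (a s : R) : gmean (fun z => (a + s * z) ^+ 2) = a ^+ 2 + s ^+ 2 * tau ^+ 2.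
Proof.
transitivity (gmean (fun z => a ^+ 2 + (2 * a * s * z + s ^+ 2 * z ^+ 2))).
  by apply: eq_gmean => z; ring.
have p1 := pgrowthZ (2 * a * s) (@pgrowth_id R); have p2 := pgrowthZ (s ^+ 2) (pgrowthX 2).
rewrite gmeanD; [|exact: pgrowth_cst|exact: pgrowthD].
rewrite gmeanD// gmean_cst !gmeanZ ?gmean1 ?gmean2; [ring|exact: pgrowthX|exact: pgrowth_id].
Qed.

Variables (u v w z : R -> R) (Cv Kw Kz B s : R).
Hypotheses (du : has_deriv u v) (dv : has_deriv v w) (dw : has_deriv w z).
Hypotheses (bv : forall x, `|v x| <= Cv) (bw : forall x, `|w x| <= Kw)
  (bz : forall x, `|z x| <= Kz).
Hypotheses (s0 : 0 <= s) (B0 : 0 <= B) (tau1 : tau <= 1).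

Let h := tau ^+ 2.
(** The change of [u] over one Euler step from [y], with drift value [b], noise [x] and step
    [h = tau ^ 2], minus [h] times the generator: a martingale increment up to a small bias. *)
Definition ito_incr (b y x : R) : R :=
  u (y - b * h + s * x) - u y - h * (s ^+ 2 / 2 * w y - b * v y).

Let Cv0 : 0 <= Cv. Proof. exact: le_trans (bv 0). Qed.
Let Kw0 : 0 <= Kw. Proof. exact: le_trans (bw 0). Qed.
Let Kz0 : 0 <= Kz. Proof. exact: le_trans (bz 0). Qed.
Let h0 : 0 <= h. Proof. exact: sqr_ge0. Qed.

Lemma ito_incr_bound b y x : `|b| <= B ->
  `|ito_incr b y x| <= Cv * s * `|x| + h * (2 * Cv * B + s ^+ 2 / 2 * Kw).
Proof.
move=> bB; rewrite /ito_incr; apply: le_trans (ler_normB _ _) _.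
have h1 : `|u (y - b * h + s * x) - u y| <= Cv * `|y - b * h + s * x - y|.
  by apply: has_deriv_lip du _ => *.
have h2 : `|y - b * h + s * x - y| <= B * h + s * `|x|.
  have -> : y - b * h + s * x - y = s * x - b * h by ring.
  apply: le_trans (ler_normB _ _) _; rewrite (normrM s) (normrM b) (ger0_norm s0) (ger0_norm h0) addrC.
  by rewrite lerD2r ler_wpM2r.
have h3 : `|h * (s ^+ 2 / 2 * w y - b * v y)| <= h * (s ^+ 2 / 2 * Kw + B * Cv).
  rewrite normrM (ger0_norm h0) ler_wpM2l//; apply: le_trans (ler_normB _ _) _.
  apply: lerD; rewrite normrM; last by apply: ler_pM.
  by rewrite ger0_norm ?divr_ge0 ?sqr_ge0// ler_wpM2l// divr_ge0// sqr_ge0.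
have := ler_wpM2l Cv0 h2; lra.
Qed.

Lemma ito_incr_cont b y : continuous (ito_incr b y).
Proof.
apply: contD; last by apply: contN; exact: cont_cst.
apply: contD; last by apply: contN; exact: cont_cst.
apply: cont_comp; first exact: has_deriv_cont du.
apply: contD; first exact: cont_cst.
by apply: contM; [exact: cont_cst|exact: cont_id].
Qed.

Let Kg := 2 * Cv * B + s ^+ 2 / 2 * Kw.
Let Kg0 : 0 <= Kg.
Proof. by rewrite addr_ge0// !mulr_ge0// sqr_ge0. Qed.

Lemma ito_incr_pgrowth b y : `|b| <= B -> pgrowth (ito_incr b y).
Proof.
move=> bB; apply: (@pgrowth_lin _ _ (h * Kg) (Cv * s)).
- exact: ito_incr_cont.
- by rewrite mulr_ge0.
- by rewrite mulr_ge0.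
by move=> x; rewrite addrC; exact: ito_incr_bound.
Qed.

Let tau_le (n m : nat) : (n <= m)%N -> tau ^+ m <= tau ^+ n.
Proof. by move=> nm; rewrite ler_wiXn2l// ltW. Qed.

Definition ito_bias : R := Kw * B ^+ 2 + 4 * Kz * (B ^+ 3 + 2 * s ^+ 3).

(** About [1 / h] steps are added up, so the mean must be of smaller order than [h = tau ^ 2]. The
    generator cancels the terms of order [h]; the squared drift leaves [h ^ 2] and the third-order
    remainder [tau ^ 3]. *)
Lemma ito_incr_mean b y : `|b| <= B -> `|gmean (ito_incr b y)| <= ito_bias * tau ^+ 3.
Proof.
move=> bB.
(* The second-order Taylor polynomial in the displacement [s x - b h], minus [h] times the
   generator, sorted by powers of [x]. *)
pose lin x := w y / 2 * b ^+ 2 * h ^+ 2 - s ^+ 2 / 2 * w y * h +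
  ((s * v y - w y * b * h * s) * x + s ^+ 2 / 2 * w y * x ^+ 2).
pose rem x := ito_incr b y x + -1 * lin x.
have plin2 : pgrowth (fun x => (s * v y - w y * b * h * s) * x + s ^+ 2 / 2 * w y * x ^+ 2).
  by apply: pgrowthD; apply: pgrowthZ; [exact: pgrowth_id|exact: pgrowthX].
have plin : pgrowth lin by apply: pgrowthD plin2; exact: pgrowth_cst.
have glin : gmean lin = w y / 2 * b ^+ 2 * h ^+ 2.
  rewrite /lin gmeanD//; last exact: pgrowth_cst.
  rewrite gmean_cst gmeanD; [|apply: pgrowthZ; exact: pgrowth_id|apply: pgrowthZ; exact: pgrowthX].
  rewrite !gmeanZ ?gmean1 ?gmean2; [|exact: pgrowthX|exact: pgrowth_id].
  by rewrite -/h; ring.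
have pi := ito_incr_pgrowth y bB.
have prem : pgrowth rem by apply: pgrowthD => //; exact: pgrowthZ.
have grem : gmean rem = gmean (ito_incr b y) - gmean lin.
  by rewrite /rem gmeanD ?gmeanZ//; [ring|exact: pgrowthZ].
(* Polynomial majorant of the remainder: [|x|^3] is split by the arithmetic-geometric inequality
   with weight [tau], which makes both means of order [tau ^ 3]. One factor 4 is that of
   [(a + c)^3 <= 4 (a^3 + c^3)]. *)
pose r x := 4 * Kz * (B ^+ 3 * h ^+ 3) +
  4 * Kz * s ^+ 3 * (tau / 2 * x ^+ 2 + tau^-1 / 2 * x ^+ 4).
have pr2 : pgrowth (fun x => tau / 2 * x ^+ 2 + tau^-1 / 2 * x ^+ 4).
  by apply: pgrowthD; apply: pgrowthZ; exact: pgrowthX.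
have pr : pgrowth r by apply: pgrowthD; [exact: pgrowth_cst|exact: pgrowthZ].
have gr : gmean r = 4 * Kz * (B ^+ 3 * h ^+ 3) + 4 * Kz * s ^+ 3 * (2 * tau ^+ 3).
  rewrite /r gmeanD; [|exact: pgrowth_cst|exact: pgrowthZ].
  rewrite gmean_cst gmeanZ// gmeanD; [|apply: pgrowthZ; exact: pgrowthX|apply: pgrowthZ; exact: pgrowthX].
  rewrite !gmeanZ ?gmean2 ?gmean4; [|exact: pgrowthX|exact: pgrowthX].
  congr (_ + _ * _); field; by rewrite gt_eqF.
have remr x : `|rem x| <= r x.
  have := taylor2_bound y (y - b * h + s * x) du dv dw bz.
  set D := y - b * h + s * x - y; have De : D = s * x - b * h by rewrite /D; ring.
  have -> : u (y - b * h + s * x) - u y - v y * D - w y / 2 * D ^+ 2 = rem x.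
    by rewrite /rem /lin /ito_incr De; field.
  move=> /le_trans; apply; rewrite /r -mulrA -[4 * Kz * s ^+ 3 * _]mulrA -mulrA.
  rewrite [in leRHS](mulrCA 4) [X in _ <= _ + X](mulrCA 4) -mulrDr ler_wpM2l// -mulrDr.
  have t3 : `|x| ^+ 3 <= tau / 2 * x ^+ 2 + tau^-1 / 2 * x ^+ 4.
    have -> : x ^+ 2 = `|x| ^+ 2 by rewrite real_normK// num_real.
    have -> : x ^+ 4 = `|x| ^+ 4.
      by rewrite -[4%N]/(2 * 2)%N !exprM real_normK// num_real.
    rewrite -subr_ge0; have -> : tau / 2 * `|x| ^+ 2 + tau^-1 / 2 * `|x| ^+ 4 - `|x| ^+ 3 =
        `|x| ^+ 2 * (`|x| - tau) ^+ 2 / (2 * tau) by field; rewrite gt_eqF.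
    apply: divr_ge0; last by apply: mulr_ge0 => //; exact: ltW.
    by apply: mulr_ge0; exact: sqr_ge0.
  have DB : `|D| <= B * h + s * `|x|.
    rewrite De; apply: le_trans (ler_normB _ _) _.
    by rewrite (normrM s) (normrM b) (ger0_norm s0) (ger0_norm h0) addrC lerD2r ler_wpM2r.
  apply: (@le_trans _ _ ((B * h + s * `|x|) ^+ 3)); first by rewrite lerXn2r// nnegrE// addr_ge0// mulr_ge0.
  have cub (a c : R) : 0 <= a -> 0 <= c -> (a + c) ^+ 3 <= 4 * (a ^+ 3 + c ^+ 3).
    move=> a0 c0; rewrite -subr_ge0.
    have -> : 4 * (a ^+ 3 + c ^+ 3) - (a + c) ^+ 3 = 3 * (a + c) * (a - c) ^+ 2 by ring.
    apply: mulr_ge0; last exact: sqr_ge0.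
    by apply: mulr_ge0 => //; exact: addr_ge0.
  apply: le_trans (cub _ _ (mulr_ge0 B0 h0) (mulr_ge0 s0 (normr_ge0 x))) _.
  by rewrite ler_wpM2l// (exprMn _ B) (exprMn _ s) lerD2l ler_wpM2l// exprn_ge0.
have := gmean_abs prem pr remr; rewrite grem gr glin => H.
have -> : gmean (ito_incr b y) = (gmean (ito_incr b y) - w y / 2 * b ^+ 2 * h ^+ 2) +
   w y / 2 * b ^+ 2 * h ^+ 2 by ring.
apply: le_trans (ler_normD _ _) _; apply: le_trans (lerD H (lexx _)) _.
have e1 : `|w y / 2 * b ^+ 2 * h ^+ 2| <= Kw * B ^+ 2 * tau ^+ 3.
  have b2 : b ^+ 2 <= B ^+ 2.
    by rewrite -(real_normK (num_real b)) lerXn2r// nnegrE.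
  have h2 : h ^+ 2 <= tau ^+ 3 by rewrite /h -exprM; exact: tau_le.
  have bh : b ^+ 2 * h ^+ 2 <= B ^+ 2 * tau ^+ 3.
    by apply: ler_pM => //; exact: sqr_ge0.
  have bh0 : 0 <= b ^+ 2 * h ^+ 2 by apply: mulr_ge0; exact: sqr_ge0.
  have -> : w y / 2 * b ^+ 2 * h ^+ 2 = w y * (b ^+ 2 * h ^+ 2 / 2) by ring.
  rewrite normrM (@ger0_norm _ (_ / 2)) ?divr_ge0// -mulrA.
  by apply: ler_pM; rewrite ?divr_ge0//; lra.
have e2 : h ^+ 3 <= tau ^+ 3 by rewrite /h -exprM; exact: tau_le.
have := ler_wpM2l (mulr_ge0 (ltac:(lra) : 0 <= 4 :> R) (mulr_ge0 Kz0 (exprn_ge0 3 B0))) e2.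
rewrite /ito_bias; lra.
Qed.

End GaussianMoments.

(** * Second moments along the Euler scheme *)

Section EulerScheme.
Context {R : realType} {d : measure_display} {Omega : measurableType d}
  (P : probability Omega R).
Local Notation rT := (measurableTypeR R).

Variables (tau s x0 : R) (b u v w z : R -> R) (Cv Kw Kz B C1 : R).
Hypotheses (tau0 : 0 < tau) (tau1 : tau <= 1) (s0 : 0 <= s) (B0 : 0 <= B).
Hypotheses (cb : continuous b) (bB : forall x, `|b x| <= B).
Hypotheses (du : has_deriv u v) (dv : has_deriv v w) (dw : has_deriv w z).
Hypotheses (bv : forall x, `|v x| <= Cv) (bw : forall x, `|w x| <= Kw)
  (bz : forall x, `|z x| <= Kz).
Variable xi : nat -> Omega -> R.
Hypothesis mxi : forall i, measurable_fun setT (xi i : Omega -> rT).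
Hypothesis indep : forall n (A : nat -> set rT), (forall i, measurable (A i)) ->
  fine (P (\bigcap_(i in `I_n) [set t | A i (xi i t)])) =
  \prod_(i < n) fine (normal_prob 0 tau (A i)).

Local Notation h := (tau ^+ 2).

Fixpoint euler (om : Omega) (k : nat) : R :=
  if k is k'.+1 then euler om k' - b (euler om k') * h + s * xi k' om else x0.

(** The generator of [dY = - b dt + s dW] applied to [u], where [v = u'] and [w = u'']. *)
Definition gen (y : R) : R := s ^+ 2 / 2 * w y - b y * v y.

Definition euler_mart (om : Omega) (n : nat) : R :=
  \sum_(k < n) ito_incr tau u v w s (b (euler om k)) (euler om k) (xi k om).

Lemma euler_martE om n :
  h * \sum_(k < n) gen (euler om k) = u (euler om n) - u x0 - euler_mart om n.
Proof.
rewrite /euler_mart; elim: n => [|n IH]; first by rewrite !big_ord0 mulr0 subr0 subrr.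
by rewrite !big_ord_recr /= mulrDr IH /ito_incr /gen; ring.
Qed.

(* The martingale part is adjoined to the state, so that both second moments
   come from one-step bounds. *)
Definition euler_step (q : (rT * rT) * rT) : rT * rT :=
  (q.1.1 - b q.1.1 * h + s * q.2,
   q.1.2 + ito_incr tau u v w s (b q.1.1) q.1.1 q.2).

Let mcont f : continuous f -> measurable_fun setT (f : rT -> rT).
Proof. exact: continuous_measurable_fun. Qed.

Lemma measurable_euler_step : measurable_fun setT euler_step.
Proof.
pose y (q : (rT * rT) * rT) : rT := q.1.1.
have my : measurable_fun setT y.
  exact: (measurableT_comp (@measurable_fst _ _ rT rT) (@measurable_fst _ _ (rT * rT)%type rT)).
have mm : measurable_fun setT (fun q : (rT * rT) * rT => q.1.2 : rT).
  exact: (measurableT_comp (@measurable_snd _ _ rT rT) (@measurable_fst _ _ (rT * rT)%type rT)).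
have mx : measurable_fun setT (fun q : (rT * rT) * rT => q.2 : rT) := @measurable_snd _ _ (rT * rT)%type rT.
have mc f : continuous f -> measurable_fun setT (fun q => f (y q) : rT).
  by move=> cf; exact: (measurableT_comp (mcont cf) my).
have my1 : measurable_fun setT (fun q : (rT * rT) * rT => y q - b (y q) * h + s * q.2 : rT).
  apply: measurable_funD; last by apply: measurable_funM.
  by apply: measurable_funB => //; apply: measurable_funM => //; exact: mc.
apply: measurable_fun_pair => //.
apply: measurable_funD => //; apply: measurable_funB.
  apply: measurable_funB; last exact: mc (has_deriv_cont du).
  exact: (measurableT_comp (mcont (has_deriv_cont du)) my1).
apply: measurable_funM => //; apply: measurable_funB.
  by apply: measurable_funM => //; exact: mc (has_deriv_cont dw).
by apply: measurable_funM; apply: mc => //; exact: (has_deriv_cont dv).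
Qed.

Let S := chain euler_step xi (x0 : rT, 0 : rT).

Lemma euler_chain om n : S n om = (euler om n, euler_mart om n).
Proof.
rewrite /euler_mart; elim: n => [|n IH]; first by rewrite big_ord0.
have -> : S n.+1 om = euler_step (S n om, xi n om) by [].
by rewrite IH /euler_step /= big_ord_recr.
Qed.

Lemma measurable_euler n : measurable_fun setT (fun om => euler om n).
Proof.
have := measurableT_comp (@measurable_fst _ _ rT rT)
  (measurable_chain mxi (x0 : rT, 0 : rT) measurable_euler_step n).
by apply: eq_measurable_fun => om _ /=; have := euler_chain om n; rewrite /S => ->.
Qed.

Lemma measurable_euler_mart n : measurable_fun setT (fun om => euler_mart om n).
Proof.
have := measurableT_comp (@measurable_snd _ _ rT rT)
  (measurable_chain mxi (x0 : rT, 0 : rT) measurable_euler_step n).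
by apply: eq_measurable_fun => om _ /=; have := euler_chain om n; rewrite /S => ->.
Qed.

(** The noise is centred and adds [s^2 h], so the hypothesis is exactly a one-step drift bound with
    [a = 0]; the growth is linear in the elapsed time. *)
Lemma euler_second_moment n :
  (forall y, (y - x0 - b y * h) ^+ 2 + s ^+ 2 * h <= (y - x0) ^+ 2 + h * C1) -> 0 <= C1 ->
  (\int[P]_om ((euler om n - x0) ^+ 2)%:E <= (n%:R * h * C1)%:E)%E.
Proof.
move=> diss C10.
pose V (q : rT * rT) : R := (q.1 - x0) ^+ 2.
have mV : measurable_fun setT V.
  by apply: measurable_funX; apply: measurable_funB => //; exact: measurable_fst.
have := @chain_drift R _ _ P _ _ (normal_prob 0 tau) xi mxi indep euler_step (x0 : rT, 0 : rT)
   measurable_euler_step V 0 (h * C1) n.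
rewrite addr0 expr1n mul1r mulrA => H.
rewrite (eq_integral (fun om => (V (S n om))%:E)); last first.
  by move=> om _; rewrite euler_chain.
apply: H => //; first exact: mulr_ge0 (sqr_ge0 _) C10.
- by move=> q; exact: sqr_ge0.
- by rewrite /V /= subrr expr0n.
move=> [y m]; rewrite /V /= mul1r.
have -> : (\int[normal_prob 0 tau]_t ((y - b y * h + s * t - x0) ^+ 2)%:E =
    (gmean tau (fun t => ((y - x0 - b y * h) + s * t) ^+ 2))%:E)%E.
  rewrite -normal_prob_gmean//.
  - by apply: eq_integral => t _; congr (_ ^+ 2)%:E; ring.
  - have p := pgrowthD (pgrowth_cst (y - x0 - b y * h)) (pgrowthZ s (@pgrowth_id R)).
    by apply: eq_pgrowth (pgrowthM p p) _ => t; rewrite expr2.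
  - by move=> t; exact: sqr_ge0.
by rewrite gmean_sqr_affine// lee_fin.
Qed.

Let Kg := 2 * Cv * B + s ^+ 2 / 2 * Kw.
Let bias := ito_bias Kw Kz B s.

(** The increments are only nearly centred. The cross term [2 m E eta] is split with weight [n]: the
    part [m^2 / n] is the growth rate [a = 1 / n], which costs [(1 + 1 / n)^n <= e], and the part
    [n (bias tau^3)^2 = h^2 bias^2 T] is of second order in [h]. *)
Lemma euler_mart_second_moment n : (0 < n)%N -> forall T, T = n%:R * h ->
  (\int[P]_om ((euler_mart om n) ^+ 2)%:E <=
   (expR 1 * T * (2 * Cv ^+ 2 * s ^+ 2 + h * (bias ^+ 2 * T + 2 * Kg ^+ 2)))%:E)%E.
Proof.
move=> n0 T TE.
have h0 : 0 < h by rewrite exprn_gt0.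
have T0 : 0 < T by rewrite TE mulr_gt0// ltr0n.
have Cv0 : 0 <= Cv := le_trans (normr_ge0 _) (bv 0).
pose V (q : rT * rT) : R := q.2 ^+ 2.
have mV : measurable_fun setT V by apply: measurable_funX; exact: measurable_snd.
pose K := h * (2 * Cv ^+ 2 * s ^+ 2 + h * (bias ^+ 2 * T + 2 * Kg ^+ 2)).
have K0 : 0 <= K.
  apply: mulr_ge0; first exact: ltW.
  apply: addr_ge0; first by rewrite -mulrA mulr_ge0// mulr_ge0// sqr_ge0.
  apply: mulr_ge0; first exact: ltW.
  by apply: addr_ge0; apply: mulr_ge0 => //; try exact: sqr_ge0; exact: ltW.
have := @chain_drift R _ _ P _ _ (normal_prob 0 tau) xi mxi indep euler_step (x0 : rT, 0 : rT)
   measurable_euler_step V (n%:R^-1) K n.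
move=> H; rewrite (eq_integral (fun om => (V (S n om))%:E)); last first.
  by move=> om _; rewrite euler_chain.
have n0' : (n%:R : R) != 0 by rewrite pnatr_eq0 -lt0n.
apply: le_trans (H _ _ _ _ _ _) _ => //.
- by move=> q; exact: sqr_ge0.
- by rewrite /V /= expr0n.
- move=> [y m]; rewrite /V /=; set eta := ito_incr _ _ _ _ _ _ _.
  have peta : pgrowth eta := ito_incr_pgrowth tau du bv bw s0 B0 y (bB y).
  have peta2 : pgrowth (fun t => eta t ^+ 2).
    by apply: eq_pgrowth (pgrowthM peta peta) _ => t; rewrite expr2.
  rewrite normal_prob_gmean//; last by move=> t; exact: sqr_ge0.
    have -> : gmean tau (fun t => (m + eta t) ^+ 2) =
        m ^+ 2 + (2 * m * gmean tau eta + gmean tau (fun t => eta t ^+ 2)).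
      have p1 := pgrowthZ (2 * m) peta.
      rewrite -gmeanZ// -gmeanD// -(gmean_cst tau0 (m ^+ 2)) -gmeanD//.
      - by apply: eq_gmean => t; ring.
      - exact: pgrowth_cst.
      - exact: pgrowthD.
    have e1 : gmean tau (fun t => eta t ^+ 2) <= 2 * Cv ^+ 2 * s ^+ 2 * h + 2 * h ^+ 2 * Kg ^+ 2.
      pose g t := 2 * h ^+ 2 * Kg ^+ 2 + 2 * Cv ^+ 2 * s ^+ 2 * t ^+ 2.
      have pg2 : pgrowth (fun t : R => 2 * Cv ^+ 2 * s ^+ 2 * t ^+ 2).
        by apply: pgrowthZ; exact: pgrowthX.
      have pg : pgrowth g by apply: pgrowthD => //; exact: pgrowth_cst.
      apply: le_trans (gmean_le tau0 peta2 pg _) _.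
        move=> t; have := ito_incr_bound tau du bv bw s0 y t (bB y).
        rewrite -/eta -/Kg => hb; rewrite -(real_normK (num_real (eta t))).
        apply: (@le_trans _ _ ((Cv * s * `|t| + h * Kg) ^+ 2)).
          by rewrite lerXn2r// nnegrE// (le_trans _ hb).
        rewrite /g -(real_normK (num_real t)) -subr_ge0.
        set t' := `|t|.
        have -> : 2 * h ^+ 2 * Kg ^+ 2 + 2 * Cv ^+ 2 * s ^+ 2 * t' ^+ 2 -
          (Cv * s * t' + h * Kg) ^+ 2 = (Cv * s * t' - h * Kg) ^+ 2 by ring.
        exact: sqr_ge0.
      rewrite /g (gmeanD tau0 (pgrowth_cst _) pg2) (gmean_cst tau0).
      rewrite (gmeanZ tau0 _ (pgrowthX 2)) (gmean2 tau0) addrC.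
      by rewrite lexx.
    have e2 : `|gmean tau eta| <= bias * tau ^+ 3.
      exact: (ito_incr_mean tau0 du dv dw bv bw bz s0 B0 tau1 y (bB y)).
    rewrite lee_fin.
    have -> : (1 + n%:R^-1) * m ^+ 2 + K = m ^+ 2 + (n%:R^-1 * m ^+ 2 + K) by ring.
    rewrite lerD2l.
    have e3 : 2 * m * gmean tau eta <= n%:R^-1 * m ^+ 2 + n%:R * (bias * tau ^+ 3) ^+ 2.
      have q2 : gmean tau eta ^+ 2 <= (bias * tau ^+ 3) ^+ 2.
        rewrite -(real_normK (num_real (gmean tau eta))) lerXn2r// nnegrE//.
        exact: le_trans e2.
      have nn : 0 < n%:R :> R by rewrite ltr0n.
      apply: (@le_trans _ _ (n%:R^-1 * m ^+ 2 + n%:R * gmean tau eta ^+ 2)).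
        rewrite -subr_ge0; set g := gmean tau eta.
        have -> : n%:R^-1 * m ^+ 2 + n%:R * g ^+ 2 - 2 * m * g = n%:R^-1 * (m - n%:R * g) ^+ 2.
          by field.
        by apply: mulr_ge0; [rewrite invr_ge0 ltW|exact: sqr_ge0].
      by rewrite lerD2l ler_wpM2l// ltW.
    have e4 : n%:R * (bias * tau ^+ 3) ^+ 2 = h * (h * (bias ^+ 2 * T)).
      by rewrite TE; ring.
    rewrite /K e4 in e3 *; lra.
  apply: eq_pgrowth (pgrowthM (pgrowthD (pgrowth_cst m) peta) (pgrowthD (pgrowth_cst m) peta)) _.
  by move=> t; rewrite expr2.
rewrite lee_fin; have -> : n%:R * K = T * (2 * Cv ^+ 2 * s ^+ 2 + h * (bias ^+ 2 * T + 2 * Kg ^+ 2)).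
  by rewrite /K TE; ring.
rewrite -[leRHS]mulrA; apply: ler_wpM2r.
  have -> : T * (2 * Cv ^+ 2 * s ^+ 2 + h * (bias ^+ 2 * T + 2 * Kg ^+ 2)) = n%:R * K.
    by rewrite /K TE; ring.
  exact: mulr_ge0.
have -> : expR 1 = expR (n%:R^-1) ^+ n :> R.
  by rewrite -expRM_natl mulfV.
by rewrite lerXn2r ?nnegrE ?expR_ge0 ?addr_ge0// ?invr_ge0// expR_ge1Dx.
Qed.

(** By telescoping, the Riemann sum of the generator is a boundary term minus the martingale. The
    boundary term is at most [Cv] times the displacement, so its square has mean O(T), like that of
    the martingale. *)
Lemma euler_ergodic n : (0 < n)%N ->
  (forall y, (y - x0 - b y * h) ^+ 2 + s ^+ 2 * h <= (y - x0) ^+ 2 + h * C1) -> 0 <= C1 ->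
  forall T, T = n%:R * h ->
  (\int[P]_om ((h * \sum_(k < n) gen (euler om k)) ^+ 2)%:E <=
   (2 * (expR 1 * T * (2 * Cv ^+ 2 * s ^+ 2 + h * (bias ^+ 2 * T + 2 * Kg ^+ 2))) +
    2 * Cv ^+ 2 * (T * C1))%:E)%E.
Proof.
move=> n0 diss C10 T TE.
have mY := measurable_euler n; have mM := measurable_euler_mart n.
have mY2 : measurable_fun setT (fun om => ((euler om n - x0) ^+ 2)%:E).
  by apply/measurable_EFinP; apply: measurable_funX; exact: measurable_funB.
have mM2 : measurable_fun setT (fun om => ((euler_mart om n) ^+ 2)%:E).
  by apply/measurable_EFinP; exact: measurable_funX.
have Cv2 : 0 <= 2 * Cv ^+ 2 by apply: mulr_ge0 => //; exact: sqr_ge0.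
apply: (@le_trans _ _ (\int[P]_om (2%:E * ((euler_mart om n) ^+ 2)%:E +
    (2 * Cv ^+ 2)%:E * ((euler om n - x0) ^+ 2)%:E))%E).
  apply: ge0_le_integral => //.
  - by move=> om _; rewrite lee_fin sqr_ge0.
  - under eq_fun do rewrite euler_martE.
    apply/measurable_EFinP; apply: measurable_funX; apply: measurable_funB => //.
    apply: measurable_funB => //.
    exact: (measurableT_comp (mcont (has_deriv_cont du)) mY).
  - by apply: emeasurable_funD; exact: measurable_funeM.
  - move=> om _; rewrite -!EFinM -EFinD lee_fin euler_martE.
    have lip : `|u (euler om n) - u x0| <= Cv * `|euler om n - x0|.
      by apply: has_deriv_lip du _ => *.
    have l2 : (u (euler om n) - u x0) ^+ 2 <= Cv ^+ 2 * (euler om n - x0) ^+ 2.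
      rewrite -exprMn -[leLHS](real_normK (num_real _)) -[leRHS](real_normK (num_real _)).
      rewrite lerXn2r ?nnegrE// normrM (@ger0_norm _ Cv)//.
      exact: le_trans (bv 0).
    set U := u _ - _ in l2 *; set M := euler_mart _ _.
    apply: (@le_trans _ _ (2 * M ^+ 2 + 2 * U ^+ 2)).
      rewrite -subr_ge0; have -> : 2 * M ^+ 2 + 2 * U ^+ 2 - (U - M) ^+ 2 = (U + M) ^+ 2 by ring.
      exact: sqr_ge0.
    by rewrite lerD2l -mulrA ler_wpM2l.
rewrite ge0_integralD//; last 4 first.
- by move=> om _; rewrite -EFinM lee_fin mulr_ge0// sqr_ge0.
- exact: measurable_funeM.
- by move=> om _; rewrite -EFinM lee_fin; apply: mulr_ge0 => //; exact: sqr_ge0.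
- exact: measurable_funeM.
rewrite !ge0_integralZl// ?lee_fin//; last 2 first.
- by move=> om _; rewrite lee_fin sqr_ge0.
- by move=> om _; rewrite lee_fin sqr_ge0.
have m2 := euler_mart_second_moment n0 TE.
have y2 := euler_second_moment n diss C10; rewrite -TE in y2.
have k2 : (0 <= 2%:E :> \bar R)%E by rewrite lee_fin.
have kC : (0 <= (2 * Cv ^+ 2)%:E)%E by rewrite lee_fin.
by have := leeD (lee_wpmul2l k2 m2) (lee_wpmul2l kC y2); rewrite -!EFinM -EFinD.
Qed.

End EulerScheme.

(** * Pathwise convergence of the Euler scheme *)

Section PathwiseEuler.
Context {R : realType}.
Implicit Types (f g b x W : R -> R).

Lemma cont_eps f t (e : R) : {for t, continuous f} -> 0 < e ->
  exists2 dl : R, 0 < dl & forall y, `|y - t| < dl -> `|f y - f t| < e.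
Proof.
move=> /cvgrPdist_lt cf e0; have /nbhs_normP[dl /= d0 h] := cf e e0.
exists dl => // y yt; have := h y; rewrite /= distrC => /(_ yt); by rewrite distrC.
Qed.

Lemma eps_cont f t : (forall e : R, 0 < e ->
  exists2 dl : R, 0 < dl & forall y, `|y - t| < dl -> `|f y - f t| < e) ->
  {for t, continuous f}.
Proof.
move=> h; apply/cvgrPdist_lt => e e0; have [dl d0 hd] := h e e0.
by apply/nbhs_normP; exists dl => //= y yt; rewrite distrC; apply: hd; rewrite distrC.
Qed.

(** Freezing a path at its initial value for negative times makes it continuous on the whole line,
    so that it has an antiderivative in the sense of [has_deriv]. *)
Lemma cont_extend f : {within `[0, +oo[, continuous f} ->
  continuous (fun t : R => f (Num.max t 0)).
Proof.
move=> /continuous_within_itvcyP[c1 c2] t; apply: eps_cont => e e0.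
case: (ltP 0 t) => t0.
  have ct : {for t, continuous f} by apply: c1; rewrite in_itv/= t0.
  have [dl d0 h] := cont_eps ct e0.
  exists (Num.min dl t); first by rewrite lt_min d0.
  move=> y; rewrite lt_min => /andP[y1 y2].
  have yp : 0 < y by move: y2; rewrite ltr_norml => /andP[]; lra.
  by rewrite !(max_idPl _) ?(ltW t0) ?(ltW yp)//; exact: h.
move: c2 => /cvgrPdist_lt /(_ e e0); rewrite near_withinE => /nbhs_normP[dl /= d0 h].
exists dl => // y yt.
case: (ltP 0 y) => y0; last by rewrite subrr normr0.
rewrite distrC; apply: h => //=; rewrite sub0r normrN gtr0_norm//.
by move: yt; rewrite ltr_norml => /andP[]; lra.
Qed.

Lemma unif_cont_segment f (a c e : R) : continuous f -> 0 < e ->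
  exists2 dl : R, 0 < dl & forall s t, a <= s <= c -> a <= t <= c ->
    `|s - t| <= dl -> `|f s - f t| <= e.
Proof.
move=> cf e0.
have /compact_near_coveringP nc := @segment_compact R a c.
have := nc R (0^'+) (fun dl y => forall z, `|z - y| <= dl -> `|f z - f y| <= e) _.
have P0 y : (y \in `[a, c]) -> \forall y' \near y & dl \near 0^'+,
    forall z, `|z - y'| <= dl -> `|f z - f y'| <= e.
  move=> _; have e2 : 0 < e / 2 by rewrite divr_gt0.
  have [d0 d00 h] := cont_eps (cf y) e2.
  exists ([set y' | `|y' - y| < d0 / 2], [set dl | dl < d0 / 2]).
    split => /=.
      apply/nbhs_normP; exists (d0 / 2); first by rewrite /= divr_gt0.
      by move=> y' /=; rewrite distrC.
    by apply: nbhs_right_lt; rewrite divr_gt0.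
  move=> [y' dl] /= [h1 h2] z hz.
  have k1 : `|f y' - f y| < e / 2 by apply: h; lra.
  have k2 : `|f z - f y| < e / 2.
    apply: h; have -> : z - y = (z - y') + (y' - y) by ring.
    by apply: le_lt_trans (ler_normD _ _) _; lra.
  have -> : f z - f y' = (f z - f y) - (f y' - f y) by ring.
  by apply: le_trans (ler_normB _ _) _; lra.
move=> /(_ _ P0); rewrite near_withinE => /nbhs_normP[dl /= d0 h].
have h' := h (dl / 2).
exists (dl / 2); first by rewrite divr_gt0.
move=> s t _ tac st; apply: h' => //=; last by rewrite divr_gt0.
by rewrite sub0r normrN gtr0_norm ?divr_gt0//; lra.
Qed.

(* One Euler step from the mean value theorem for the drift integral; the
   errors accumulate geometrically (discrete Gronwall). *)
Lemma euler_error x W Bf b (bm : R -> R) (Y : nat -> R) (x0 s K om h : R) (n : nat) :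
  0 <= K -> 0 < h ->
  has_deriv Bf (fun t => b (x t)) ->
  (forall t, 0 <= t -> x t = x0 - (Bf t - Bf 0) + s * W t) -> W 0 = 0 ->
  Y 0%N = x0 ->
  (forall k, Y k.+1 = Y k - bm (Y k) * h + s * (W (k.+1%:R * h) - W (k%:R * h))) ->
  (forall y y', `|bm y - bm y'| <= K * `|y - y'|) ->
  (forall t, 0 <= t -> t <= n%:R * h -> bm (x t) = b (x t)) ->
  (forall t t', 0 <= t -> t <= n%:R * h -> 0 <= t' -> t' <= n%:R * h ->
     `|t - t'| <= h -> `|x t - x t'| <= om) ->
  forall k, (k <= n)%N -> `|x (k%:R * h) - Y k| <= om * ((1 + K * h) ^+ k - 1).
Proof.
move=> K0 h0 dB xE W0 Y0 YS bmL bmE hom; elim => [|k IH] kn.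
  rewrite mul0r xE// W0 Y0 expr0 !subrr mulr0 subr0 mulr0 addr0 subrr.
  by rewrite normr0.
have {}IH := IH (ltnW kn).
have t0 : 0 <= k%:R * h by rewrite mulr_ge0// ltW.
have t1 : k.+1%:R * h = k%:R * h + h by rewrite -natr1; ring.
have tn : k.+1%:R * h <= n%:R * h by rewrite ler_pM2r// ler_nat.
have [|c /andP[c1 c2] cE] := has_deriv_MVT dB (_ : k%:R * h <= k.+1%:R * h).
  by rewrite t1 lerDl ltW.
have c0 : 0 <= c by apply: le_trans c1.
have cn : c <= n%:R * h by apply: le_trans tn.
have tkn : k%:R * h <= n%:R * h by apply: le_trans tn; rewrite t1 lerDl ltW.
have e1 : x (k.+1%:R * h) - Y k.+1 = (x (k%:R * h) - Y k) - h * (bm (x c) - bm (Y k)).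
  have t10 : 0 <= k.+1%:R * h by rewrite t1 addr_ge0// ltW.
  rewrite YS (bmE c c0 cn) (xE _ t0) (xE _ t10).
  have hh : k.+1%:R * h - k%:R * h = h by rewrite t1; ring.
  rewrite hh in cE.
  have -> : Bf (k.+1%:R * h) = Bf (k%:R * h) + b (x c) * h by lra.
  by ring.
have ck : `|x c - x (k%:R * h)| <= om.
  by apply: hom => //; rewrite ger0_norm ?subr_ge0//; move: c2; rewrite t1; lra.
have xc : `|x c - Y k| <= om + `|x (k%:R * h) - Y k|.
  have -> : x c - Y k = (x c - x (k%:R * h)) + (x (k%:R * h) - Y k) by ring.
  by apply: le_trans (ler_normD _ _) _; rewrite lerD2r.
rewrite e1; apply: le_trans (ler_normB _ _) _.
rewrite normrM (gtr0_norm h0).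
set E := `|x (k%:R * h) - Y k| in IH xc *.
have Kh : 0 <= K * h by rewrite mulr_ge0// ltW.
apply: (@le_trans _ _ (E + h * (K * (om + E)))).
  rewrite lerD2l; apply: ler_wpM2l; first exact: ltW.
  by apply: le_trans (bmL _ _) _; rewrite ler_wpM2l.
have -> : E + h * (K * (om + E)) = (1 + K * h) * E + K * h * om by ring.
have IH' := ler_wpM2l (_ : 0 <= 1 + K * h) IH.
apply: le_trans (lerD (IH' _) (lexx _)) _; first by rewrite addr_ge0.
by rewrite le_eqVlt; apply/orP; left; apply/eqP; rewrite exprS; ring.
Qed.

(** On [[0, T]] the path stays in some [[-A, A]], so for [m >= A] it also solves the equation with
    the truncated drift [bm m]. The scheme then stays within distance 1 of it, in a window where
    [gm m] is uniformly close to [g]. The Lipschitz constant [K] is common to all [m], which keeps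
    the Gronwall factor fixed. *)
Lemma euler_riemann x W Bf G b g (x0 s K T : R) (bm gm : nat -> R -> R)
    (Y : nat -> nat -> R) (n : nat -> nat) (h : nat -> R) :
  0 < T -> 0 <= K -> continuous x -> continuous g ->
  has_deriv Bf (fun t => b (x t)) -> has_deriv G (fun t => g (x t)) ->
  (forall t, 0 <= t -> x t = x0 - (Bf t - Bf 0) + s * W t) -> W 0 = 0 ->
  (forall m, 0 < h m) -> (forall m, (n m)%:R * h m = T) -> h @ \oo --> 0 ->
  (forall m, Y m 0%N = x0) ->
  (forall m k, Y m k.+1 = Y m k - bm m (Y m k) * h m +
     s * (W (k.+1%:R * h m) - W (k%:R * h m))) ->
  (forall m y y', `|bm m y - bm m y'| <= K * `|y - y'|) ->
  (forall m y, `|y| <= m%:R -> bm m y = b y) ->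
  (forall A e : R, 0 < e -> \forall m \near \oo, forall y, `|y| <= A -> `|gm m y - g y| <= e) ->
  (fun m => h m * \sum_(k < n m) gm m (Y m k)) @ \oo --> G T - G 0.
Proof.
move=> T0 K0 cx cg dB dG xE W0 h0 nh hlim Y0 YS bmL bmE gmg.
have [A hA] : exists A : R, forall t, 0 <= t <= T -> `|x t| <= A.
  have [c _ hc] := @EVT_max R (fun t => `|x t|) 0 T (ltW T0)
    (continuous_subspaceT (cont_norm cx)).
  by exists `|x c| => t tT; apply: hc; rewrite in_itv.
apply/cvgrPdist_le => e e0.
pose e1 := e / T / 2; have e10 : 0 < e1 by rewrite !divr_gt0.
have [d1 d10 ud1] := unif_cont_segment (- (A + 1)) (A + 1) cg e10.
pose E := expR (K * T); have E1 : 1 <= E by rewrite -[leLHS]expR0 ler_expR mulr_ge0// ltW.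
have E0 : 0 < E := expR_gt0 _.
(* The Gronwall error [om (E - 1)] plus one oscillation [om] of the path make [min 1 d1]: at most 1
   to stay in the window of radius [A + 1], at most [d1] for the uniform continuity of [g] there. *)
pose om := Num.min 1 d1 / E.
have om0 : 0 < om by rewrite divr_gt0// lt_min ltr01.
have [d2 d20 ud2] := unif_cont_segment 0 T cx om0.
have hsmall : \forall m \near \oo, h m <= d2.
  move: hlim => /cvgrPdist_le /(_ d2 d20); apply: filterS => m.
  by rewrite sub0r normrN gtr0_norm.
have gsmall := gmg (A + 1) e1 e10.
have msmall : \forall m \near \oo, A <= m%:R :> R.
  by exists (Num.truncn A).+1 => // m /= km; apply/ltW; rewrite (lt_le_trans (truncnS_gt A))// ler_nat.
near=> m.
have m1 : h m <= d2 by near: m.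
have m2 : forall y, `|y| <= A + 1 -> `|gm m y - g y| <= e1 by near: m.
have m3 : A <= m%:R by near: m.
have err : forall k, (k <= n m)%N -> `|x (k%:R * h m) - Y m k| <= om * (E - 1).
  move=> k kn.
  have H := @euler_error x W Bf b (bm m) (Y m) x0 s K om (h m) (n m) K0 (h0 m) dB xE W0 (Y0 m)
     (YS m) (bmL m) _ _ k kn.
  apply: le_trans (H _ _) _.
  - by rewrite nh => t t1 t2; apply: bmE; apply: le_trans m3; apply: hA; rewrite t1.
  - rewrite nh => t t' a1 a2 a3 a4 tt; apply: ud2; rewrite ?a1 ?a3//.
    exact: le_trans m1.
  rewrite ler_wpM2l ?(ltW om0)// lerD2r.
  apply: (@le_trans _ _ ((expR (K * h m)) ^+ k)).
    rewrite lerXn2r ?nnegrE ?expR_ge0// ?addr_ge0// ?mulr_ge0// ?(ltW (h0 m))//.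
    exact: expR_ge1Dx.
  rewrite -expRM_natl ler_expR /E -(nh m) mulrCA ler_wpM2l// ler_wpM2r ?(ltW (h0 m))//.
  by rewrite ler_nat.
have tele j : (j <= n m)%N -> `|G (j%:R * h m) - G 0 - h m * \sum_(k < j) gm m (Y m k)| <=
    j%:R * h m * (2 * e1).
  elim: j => [|j IH] jn; first by rewrite big_ord0 mulr0 !mul0r subrr subr0 normr0.
  have {}IH := IH (ltnW jn).
  have t1 : j.+1%:R * h m = j%:R * h m + h m by rewrite -natr1; ring.
  have tj0 : 0 <= j%:R * h m by rewrite mulr_ge0// ltW.
  have tj1 : j.+1%:R * h m <= T by rewrite -(nh m) ler_pM2r// ler_nat.
  have [|c /andP[c1 c2] cE] := has_deriv_MVT dG (_ : j%:R * h m <= j.+1%:R * h m).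
    by rewrite t1 lerDl ltW.
  have hh : j.+1%:R * h m - j%:R * h m = h m by rewrite t1; ring.
  rewrite hh in cE.
  rewrite big_ord_recr /=.
  have -> : G (j.+1%:R * h m) - G 0 - h m * (\sum_(k < j) gm m (Y m k) + gm m (Y m j)) =
     (G (j%:R * h m) - G 0 - h m * \sum_(k < j) gm m (Y m k)) +
     h m * (g (x c) - gm m (Y m j)).
    have -> : G (j.+1%:R * h m) = G (j%:R * h m) + g (x c) * h m by lra.
    by ring.
  apply: le_trans (ler_normD _ _) _; rewrite t1 mulrDl lerD//.
  rewrite normrM gtr0_norm// ler_wpM2l ?(ltW (h0 m))//.
  have c0 : 0 <= c by apply: le_trans c1.
  have cT : c <= T by apply: le_trans tj1.
  have jT : j%:R * h m <= T by apply: le_trans tj1; rewrite t1 lerDl ltW.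
  have xj : `|x c - x (j%:R * h m)| <= om.
    apply: ud2; rewrite ?c0 ?tj0//; apply: le_trans m1.
    by rewrite ger0_norm ?subr_ge0//; move: c2; rewrite t1; lra.
  have omE : om * E = Num.min 1 d1 by rewrite /om mulfVK// gt_eqF.
  have xY : `|x c - Y m j| <= Num.min 1 d1.
    have -> : x c - Y m j = (x c - x (j%:R * h m)) + (x (j%:R * h m) - Y m j) by ring.
    apply: le_trans (ler_normD _ _) _; have := err j (ltnW jn); rewrite -omE; lra.
  have xA : `|x c| <= A by apply: hA; rewrite c0.
  have [xY1 xYd] : `|x c - Y m j| <= 1 /\ `|x c - Y m j| <= d1.
    by apply/andP; rewrite -le_min.
  have YA : `|Y m j| <= A + 1.
    have -> : Y m j = x c - (x c - Y m j) by ring.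
    by apply: le_trans (ler_normB _ _) _; lra.
  have q1 := m2 _ YA.
  have q2 : `|g (x c) - g (Y m j)| <= e1.
    apply: ud1 => //; last by rewrite -ler_norml.
    by rewrite -ler_norml; lra.
  have -> : g (x c) - gm m (Y m j) = (g (x c) - g (Y m j)) - (gm m (Y m j) - g (Y m j)) by ring.
  by apply: le_trans (ler_normB _ _) _; lra.
have := tele (n m) (leqnn _); rewrite nh => /le_trans; apply.
by rewrite /e1 le_eqVlt; apply/orP; left; apply/eqP; field; rewrite gt_eqF.
Unshelve. all: by end_near. Qed.

End PathwiseEuler.

(** * Growth of the confining potential and clamping *)

Section ConfiningPotential.
Context {R : realType}.
Implicit Types (f g : R -> R).

Lemma has_deriv_refl f df : has_deriv f df ->
  has_deriv (fun x => f (- x)) (fun x => - df (- x)).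
Proof.
move=> h; apply: has_deriv_eq (has_deriv_comp h (has_derivN has_deriv_id)) _ => x.
by rewrite mulrN1.
Qed.

(** [V y - beta / 2 * y^2] is nondecreasing beyond [RR]. On [[0, RR]] the Lipschitz bound keeps its
    slope above [- D], so its total loss is at most [D * RR]. *)
Lemma confining_growth (V V1 : R -> R) (LV beta RR : R) : has_deriv V V1 ->
  0 <= LV -> 0 < beta -> 0 <= RR ->
  (forall x y, `|V1 x - V1 y| <= LV * `|x - y|) ->
  (forall x, RR <= x -> beta * x <= V1 x) ->
  forall x t, 0 <= x -> x <= t ->
  beta / 2 * (t ^+ 2 - x ^+ 2) - (`|V1 0| + (LV + beta) * RR) * RR <= V t - V x.
Proof.
move=> dV LV0 b0 RR0 lip diss x t x0 xt.
pose f y := V y - beta / 2 * (y * y).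
have df : has_deriv f (fun y => V1 y - beta * y).
  apply: has_deriv_eq (has_derivB dV (has_derivZ (beta / 2)
    (has_derivM has_deriv_id has_deriv_id))) _ => y; by field.
set D := `|V1 0| + (LV + beta) * RR.
have D0 : 0 <= D by rewrite addr_ge0// mulr_ge0// addr_ge0// ltW.
have far y y' : RR <= y -> y <= y' -> 0 <= f y' - f y.
  move=> h1 h2; have [c /andP[c1 c2] ->] := has_deriv_MVT df h2.
  by rewrite mulr_ge0 ?subr_ge0//; apply: diss; exact: le_trans c1.
have near y y' : 0 <= y -> y <= y' -> y' <= RR -> - (D * RR) <= f y' - f y.
  move=> h1 h2 h3; have [c /andP[c1 c2] ->] := has_deriv_MVT df h2.
  have c0 : 0 <= c := le_trans h1 c1; have cR : c <= RR := le_trans c2 h3.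
  have hc : - D <= V1 c - beta * c.
    have := lip c 0; rewrite subr0 (ger0_norm c0) ler_norml => /andP[l1 _].
    have := ler_norm (- V1 0); rewrite normrN => l2.
    have l3 := ler_wpM2l LV0 cR; have l4 := ler_wpM2l (ltW b0) cR.
    by rewrite /D; lra.
  have yy : 0 <= y' - y by rewrite subr_ge0.
  have yR : y' - y <= RR by lra.
  have := ler_wpM2r yy hc; have := ler_wpM2l D0 yR; lra.
have DR : 0 <= D * RR by rewrite mulr_ge0.
have : - (D * RR) <= f t - f x.
  case: (leP t RR) => tR; first exact: near.
  case: (leP RR x) => xR; first by have := far x t xR xt; lra.
  have := far RR t (lexx _) (ltW tR); have := near x RR x0 (ltW xR) (lexx _); lra.
by rewrite /f -!expr2; lra.
Qed.

Lemma clamp_lip (c y y' : R) : 0 <= c ->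
  `|Num.max (- c) (Num.min c y) - Num.max (- c) (Num.min c y')| <= `|y - y'|.
Proof.
move=> c0; wlog yy : y y' / y <= y'.
  by move=> H; case: (leP y y') => [/H//|/ltW /H]; rewrite distrC (distrC y').
have h1 : Num.min c y <= Num.min c y' by rewrite le_min ge_min lexx /= ge_min yy orbT.
have h2 : Num.max (- c) (Num.min c y) <= Num.max (- c) (Num.min c y').
  by rewrite ge_max le_max lexx /= le_max h1 orbT.
rewrite distrC ger0_norm ?subr_ge0// distrC ger0_norm ?subr_ge0//.
case: (leP c y) => cy; case: (leP c y') => cy'.
- by rewrite subrr subr_ge0.
- lra.
- case: (leP (- c) c); case: (leP (- c) y); lra.
- case: (leP (- c) y); case: (leP (- c) y'); lra.
Qed.

Lemma clampE (c y : R) : 0 <= c ->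
  [\/ Num.max (- c) (Num.min c y) = y, (Num.max (- c) (Num.min c y) = c /\ c <= y) |
      (Num.max (- c) (Num.min c y) = - c /\ y <= - c)].
Proof.
move=> c0; case: (leP c y) => cy.
  by apply: Or32; split => //; apply/max_idPr; lra.
by case: (leP (- c) y) => cy'; [exact: Or31|apply: Or33; split => //; exact: ltW].
Qed.

Lemma clamp_id (c y : R) : `|y| <= c -> Num.max (- c) (Num.min c y) = y.
Proof.
rewrite ler_norml => /andP[h1 h2]; rewrite (min_idPr h2).
exact/max_idPr.
Qed.

Lemma lip_cont f (K : R) : (forall x y, `|f x - f y| <= K * `|x - y|) -> continuous f.
Proof.
move=> h x; apply: eps_cont => e e0.
have K0 : 0 < `|K| + 1 by rewrite ltr_wpDl.
exists (e / (`|K| + 1)); first by rewrite divr_gt0.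
move=> y; rewrite ltr_pdivlMr// => yx.
apply: le_lt_trans (h y x) _; apply: le_lt_trans yx.
rewrite mulrC ler_wpM2l//; have := ler_norm K; lra.
Qed.

Lemma clamp_bounded (c y : R) : 0 <= c -> `|Num.max (- c) (Num.min c y)| <= c.
Proof.
move=> c0; case: (leP c y) => cy.
  by rewrite (_ : Num.max _ _ = c) ?ger0_norm//; apply/max_idPr; lra.
by case: (leP (- c) y) => cy'; rewrite ler_norml; lra.
Qed.

Lemma cont_bounded f (c : R) : 0 <= c -> continuous f ->
  exists2 K, 0 <= K & forall y, `|y| <= c -> `|f y| <= K.
Proof.
move=> c0 cf; have [|k _ hk] := @EVT_max R (fun t => `|f t|) (- c) c _
  (continuous_subspaceT (cont_norm cf)); first by lra.
by exists `|f k| => // y; rewrite ler_norml => yc; apply: hk; rewrite in_itv.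
Qed.

End ConfiningPotential.

(** * The invariant density and the Poisson equation *)

Section PoissonEquation.
Context {R : realType}.
Variables (sigma LV beta RR LL : R) (V V1 V2 p p1 p2 : R -> R).
Hypotheses (sigma0 : 0 < sigma) (LV0 : 0 < LV) (beta0 : 0 < beta) (RR1 : 1 <= RR) (LL0 : 0 < LL).
Hypotheses (dV : has_deriv V V1) (dV1 : has_deriv V1 V2) (cV2 : continuous V2).
Hypotheses (dp : has_deriv p p1) (dp1 : has_deriv p1 p2) (cp2 : continuous p2).
Hypotheses (V00 : V 0 = 0) (pp : periodic LL p).
Hypothesis lipV : forall x y, `|V1 x - V1 y| <= LV * `|x - y|.
Hypothesis dissR : forall x, RR <= x -> beta * x <= V1 x.
Hypothesis dissL : forall x, x <= - RR -> V1 x <= beta * x.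

(** The loss allowed inside the radius [RR], where the dissipativity assumption says nothing. *)
Definition growth_defect : R := (`|V1 0| + (LV + beta) * RR) * RR.

Let RR0 : 0 <= RR. Proof. exact: le_trans RR1. Qed.

Lemma growth_defect_ge0 : 0 <= growth_defect.
Proof.
by rewrite mulr_ge0// addr_ge0// mulr_ge0// addr_ge0// ltW.
Qed.

Lemma V_growth x t : (t <= x <= 0) || (0 <= x <= t) ->
  beta / 2 * (t ^+ 2 - x ^+ 2) - growth_defect <= V t - V x.
Proof.
case/orP => /andP[h1 h2]; last first.
  exact: (confining_growth dV (ltW LV0) beta0 RR0 lipV dissR).
have := @confining_growth R (fun x => V (- x)) (fun x => - V1 (- x)) LV beta RR
  (has_deriv_refl dV) (ltW LV0) beta0 RR0 _ _ (- x) (- t) _ _.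
rewrite !opprK oppr0 normrN !sqrrN; apply.
- move=> a c; rewrite -opprD normrN; apply: le_trans (lipV _ _) _.
  by rewrite -opprD normrN.
- by move=> a Ra; have := @dissL (- a); rewrite lerN2 => /(_ Ra); lra.
- by rewrite oppr_ge0.
- by rewrite lerN2.
Qed.

Let s2 := sigma ^+ 2.
Let s20 : 0 < s2. Proof. by rewrite exprn_gt0. Qed.
Let r := beta / (2 * s2).
Let r0 : 0 < r. Proof. by rewrite divr_gt0// mulr_gt0. Qed.

Definition gibbs (x : R) : R := expR (- V x / sigma ^+ 2).
Let Kd := expR (growth_defect / s2).

(** The decay is relative to the value at [x], because the Poisson solution divides by the density
    at [x]. *)
Lemma gibbs_decay x t : (t <= x <= 0) || (0 <= x <= t) ->
  gibbs t <= Kd * gibbs x * gauss r x t.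
Proof.
move=> h; have hV := V_growth h.
apply: (@le_trans _ _ (Kd * gibbs x * (expR (r * x ^+ 2) * expR (- (r * t ^+ 2))))).
  rewrite /Kd /gibbs -/s2 -!expRD ler_expR.
  have -> : growth_defect / s2 + - V x / s2 + (r * x ^+ 2 + - (r * t ^+ 2)) =
     (growth_defect - V x - beta / 2 * (t ^+ 2 - x ^+ 2)) / s2.
    by rewrite /r; field; rewrite gt_eqF.
  by rewrite ler_pM2r ?invr_gt0//; lra.
apply: ler_wpM2l; first by rewrite mulr_ge0 ?expR_ge0.
have := ler_wpM2l (expR_ge0 (r * x ^+ 2)) (gauss_split (ltW r0) h).
have e : expR (r * x ^+ 2) * expR (- (r * x ^+ 2)) = 1 by rewrite -expRD subrr expR0.
by rewrite [leRHS]mulrA e mul1r.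
Qed.

Lemma gibbs_deriv : has_deriv gibbs (fun x => - (V1 x / s2) * gibbs x).
Proof.
have h := has_derivZ (- s2^-1) dV.
have -> : gibbs = fun x => expR (- s2^-1 * V x).
  by apply/funext => x; rewrite /gibbs; congr expR; rewrite -/s2; field; rewrite gt_eqF.
apply: has_deriv_eq (has_deriv_exp h) _ => x.
by congr (_ * _); field; rewrite gt_eqF.
Qed.

Lemma gdecay_gibbs : gdecay gibbs.
Proof.
apply: (@gdecayP _ _ Kd r) => //; first exact: has_deriv_cont gibbs_deriv.
move=> x; rewrite ger0_norm ?expR_ge0//.
have h : (x <= 0 <= (0 : R)) || ((0 : R) <= 0 <= x).
  by rewrite !lexx andbT /=; case: leP => //= /ltW.
apply: le_trans (gibbs_decay h) _.
by rewrite /gibbs V00 oppr0 mul0r expR0 mulr1 /gauss subr0.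
Qed.

Lemma V1_pgrowth : pgrowth V1.
Proof.
apply: (@pgrowth_lin _ _ `|V1 0| LV) => //; [exact: has_deriv_cont dV1|exact: ltW|].
move=> x; have := lipV x 0; rewrite subr0 => h.
have -> : V1 x = V1 0 + (V1 x - V1 0) by ring.
by apply: le_trans (ler_normD _ _) _; rewrite lerD2l.
Qed.

(** Otherwise, by continuity of [V2], the slope of [V1] near [x] differs from [V2 x] by less than
    [e], half of the excess over [LV], and the Lipschitz bound fails on a short interval. *)
Lemma V2_bound x : `|V2 x| <= LV.
Proof.
have h : has_deriv (fun t => V1 t - V2 x * t) (fun t => V2 t - V2 x).
  by apply: has_deriv_eq (has_derivB dV1 (has_derivZ (V2 x) has_deriv_id)) _ => t; rewrite mulr1.
rewrite leNgt; apply/negP => lt.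
pose e := (`|V2 x| - LV) / 2; have e0 : 0 < e by rewrite divr_gt0// subr_gt0.
have [dl d0 hd] := @cont_eps R V2 x e (@cV2 x) e0.
have h1 : `|(V1 (x + dl / 2) - V2 x * (x + dl / 2)) - (V1 x - V2 x * x)| <= e * `|x + dl / 2 - x|.
  apply: has_deriv_lip h _ => t ht; apply/ltW/hd; apply: le_lt_trans ht _.
  by rewrite (_ : x + dl / 2 - x = dl / 2) ?gtr0_norm ?divr_gt0//; [lra|ring].
have h2 := lipV (x + dl / 2) x.
have d20 : 0 < dl / 2 by rewrite divr_gt0.
have dd : x + dl / 2 - x = dl / 2 by ring.
rewrite dd (gtr0_norm d20) in h1 h2.
have h3 : `|V2 x| * (dl / 2) <= (LV + e) * (dl / 2).
  have -> : `|V2 x| * (dl / 2) = `|V2 x * (dl / 2)| by rewrite normrM (gtr0_norm d20).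
  have -> : V2 x * (dl / 2) = (V1 (x + dl / 2) - V1 x) -
     ((V1 (x + dl / 2) - V2 x * (x + dl / 2)) - (V1 x - V2 x * x)) by ring.
  by apply: le_trans (ler_normB _ _) _; rewrite mulrDl lerD.
by move: h3; rewrite ler_pM2r// /e; lra.
Qed.

Lemma gibbs_derivs : exists d1 d2, [/\ has_deriv gibbs d1, has_deriv d1 d2, gdecay d1 & gdecay d2].
Proof.
have gg := gdecay_gibbs.
have pV1 : pgrowth (fun x => - (V1 x / s2)).
  by apply: eq_pgrowth (pgrowthZ (- s2^-1) V1_pgrowth) _ => x; rewrite mulNr mulrC.
have pV2 : pgrowth (fun x => - (V2 x / s2)).
  have := pgrowthZ (- s2^-1) (pgrowth_bounded cV2 V2_bound).
  by move=> h; apply: eq_pgrowth h _ => x; rewrite mulNr mulrC.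
exists (fun x => - (V1 x / s2) * gibbs x),
  (fun x => - (V2 x / s2) * gibbs x + - (V1 x / s2) * (- (V1 x / s2) * gibbs x)).
have g1 : gdecay (fun x => - (V1 x / s2) * gibbs x).
  by apply: eq_gdecay (gdecayMp gg pV1) _ => x; rewrite mulrC.
split => //.
- exact: gibbs_deriv.
- have h : has_deriv (fun x => - (V1 x / s2)) (fun x => - (V2 x / s2)).
    rewrite (_ : (fun x => - (V1 x / s2)) = fun x => - s2^-1 * V1 x); last first.
      by apply/funext => x; rewrite mulNr mulrC.
    by apply: has_deriv_eq (has_derivZ (- s2^-1) dV1) _ => x; rewrite mulNr mulrC.
  exact: has_derivM h gibbs_deriv.
- apply: gdecayD; first by apply: eq_gdecay (gdecayMp gg pV2) _ => x; rewrite mulrC.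
  by apply: eq_gdecay (gdecayMp g1 pV1) _ => x; rewrite mulrC.
Qed.

Definition mod_factor (y : R) : R := expR (- p y / sigma ^+ 2).

Lemma mod_factor_cont : continuous mod_factor.
Proof.
have h := has_deriv_exp (has_derivZ (- s2^-1) dp).
rewrite (_ : mod_factor = fun x => expR (- s2^-1 * p x)); first exact: has_deriv_cont h.
by apply/funext => x; rewrite /mod_factor; congr expR; rewrite -/s2; field; rewrite gt_eqF.
Qed.

Lemma mod_factor_bounds : exists qm qM, [/\ 0 < qm, 0 < qM & forall y, qm <= mod_factor y <= qM].
Proof.
have [M hM] := periodic_bounded LL0 (has_deriv_cont dp) pp.
exists (expR (- M / s2)), (expR (M / s2)); split; rewrite ?expR_gt0// => y.
rewrite /mod_factor -/s2 !ler_expR !ler_pM2r ?invr_gt0//.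
by have := hM y; rewrite ler_norml; lra.
Qed.

Lemma mod_factor_periodic : periodic LL mod_factor.
Proof. by move=> y; rewrite /mod_factor pp. Qed.

Variables (eps qm qM : R).
Hypotheses (eps0 : 0 < eps) (qm0 : 0 < qm) (qM0 : 0 < qM).
Hypothesis qb : forall y, qm <= mod_factor y <= qM.

Definition osc_gibbs (x : R) : R := gibbs x * mod_factor (x / eps).
Definition drift (x : R) : R := V1 x + eps^-1 * p1 (x / eps).

Lemma osc_gibbs_gt0 x : 0 < osc_gibbs x.
Proof. by rewrite mulr_gt0// expR_gt0. Qed.

Lemma gdecay_osc_gibbs : gdecay osc_gibbs.
Proof.
apply: (@gdecay_osc R gibbs gdecay_gibbs mod_factor qM eps mod_factor_cont).
by move=> x; rewrite ger0_norm ?expR_ge0//; case/andP: (qb x).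
Qed.

(** With a zero integral the primitive would decay at [+oo] while being nonnegative and
    nondecreasing. It would vanish at 0 and at 1, although its derivative is positive in between. *)
Lemma integ_gibbs_gt0 : 0 < integ gibbs.
Proof.
have g0 : 0 <= integ gibbs by apply: integ_ge0 => x; exact: expR_ge0.
rewrite lt_neqAle g0 andbT eq_sym; apply/eqP => i0.
have mono := primitive_deriv gdecay_gibbs.
have gg := gdecay_primitive gdecay_gibbs i0.
have [C [d [C0 d0 hC]]] := gdecay_nonneg gg.
have z : primitive gibbs 0 = 0.
  apply: (@le_gauss_eq0 _ _ C d) => // x x0.
  have p0 : 0 <= primitive gibbs 0 by apply: Rintegral_ge0 => t _; exact: expR_ge0.
  have [c _ e] := has_deriv_MVT mono x0.
  have : primitive gibbs 0 <= primitive gibbs x.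
    by rewrite -subr_ge0 e mulr_ge0 ?expR_ge0// subr_ge0.
  move=> h; rewrite (ger0_norm p0); apply: le_trans h _.
  exact: le_trans (ler_norm _) (hC x).
have [c _ e] := has_deriv_MVT mono (ler01 : (0 : R) <= 1).
have e1 : primitive gibbs 1 = gibbs c by move: e; rewrite z !subr0 mulr1.
have z1 : primitive gibbs 1 = 0.
  apply: (@le_gauss_eq0 _ _ (C * expR 0) d) => // x x0.
  have p0 : 0 <= primitive gibbs 1 by apply: Rintegral_ge0 => t _; exact: expR_ge0.
  rewrite (ger0_norm p0) expR0 mulr1.
  case: (leP 1 x) => x1; last first.
    apply: le_trans (ler_norm _) _; apply: le_trans (hC 1) _.
    rewrite ler_wpM2l// ler_expR lerN2 ler_wpM2l ?(ltW d0)// lerXn2r// ?nnegrE//; exact: ltW.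
  have [c' _ e'] := has_deriv_MVT mono x1.
  have h : primitive gibbs 1 <= primitive gibbs x.
    by rewrite -subr_ge0 e' mulr_ge0 ?expR_ge0// subr_ge0.
  by apply: le_trans h _; exact: le_trans (ler_norm _) (hC x).
by have := expR_gt0 (- V c / sigma ^+ 2); rewrite -/(gibbs c) -e1 z1 ltxx.
Qed.

Lemma integ_osc_gibbs_ge : qm * integ gibbs <= integ osc_gibbs.
Proof.
rewrite -integZ; last exact: gdecay_gibbs.
apply: integ_le; [exact: gdecayZ gdecay_gibbs|exact: gdecay_osc_gibbs|] => x.
by rewrite mulrC /osc_gibbs ler_wpM2l ?expR_ge0//; case/andP: (qb (x / eps)).
Qed.

Let I0 : 0 < integ osc_gibbs.
Proof. by apply: lt_le_trans integ_osc_gibbs_ge; rewrite mulr_gt0// integ_gibbs_gt0. Qed.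

Lemma osc_gibbs_inv_deriv :
  has_deriv (fun x => (osc_gibbs x)^-1) (fun x => drift x / s2 * (osc_gibbs x)^-1).
Proof.
have h := has_derivZ (s2^-1) (has_derivD dV (has_deriv_scale eps dp)).
have e x : (osc_gibbs x)^-1 = expR (s2^-1 * (V x + p (x / eps))).
  rewrite /osc_gibbs /gibbs /mod_factor -expRD -expRN; congr expR.
  by rewrite -/s2; field; rewrite !gt_eqF.
rewrite (_ : (fun x => (osc_gibbs x)^-1) = fun x => expR (s2^-1 * (V x + p (x / eps)))).
  apply: has_deriv_eq (has_deriv_exp h) _ => x; rewrite e.
  by congr (_ * _); rewrite /drift; field; rewrite !gt_eqF.
by apply/funext => x; rewrite e.
Qed.

Variables (f f1 : R -> R).
Hypotheses (df : has_deriv f f1) (gf : gdecay f) (gf1 : gdecay f1).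

Definition inv_mean : R := integ (fun x => f x * osc_gibbs x) / integ osc_gibbs.

Let al := inv_mean.
Let g x := al * osc_gibbs x - f x * osc_gibbs x.

Let gg : gdecay g.
Proof.
apply: gdecayB; first exact: gdecayZ gdecay_osc_gibbs.
exact: gdecayM gdecay_osc_gibbs.
Qed.

Let g_mean0 : integ g = 0.
Proof.
rewrite /g integB; [|exact: gdecayZ gdecay_osc_gibbs|exact: gdecayM gdecay_osc_gibbs].
rewrite integZ; last exact: gdecay_osc_gibbs.
by rewrite /al /inv_mean mulfVK ?subrr// gt_eqF.
Qed.

(** The function [v = u']: multiplying [sigma^2 v' - drift v = al - f] by the invariant weight turns
    the left side into the derivative of [sigma^2 v osc_gibbs], which is integrated from [-oo]. *)
Definition poisson_sol (x : R) : R := s2^-1 * (primitive g x * (osc_gibbs x)^-1).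

Lemma poisson_deriv :
  has_deriv poisson_sol (fun x => (al - f x + drift x * poisson_sol x) / s2).
Proof.
apply: has_deriv_eq (has_derivZ (s2^-1) (has_derivM (primitive_deriv gg) osc_gibbs_inv_deriv)) _ => x.
rewrite /poisson_sol /g; field.
by rewrite !gt_eqF// osc_gibbs_gt0.
Qed.

Let J k := integ (gauss k (0 : R)).

Definition mean_bound : R :=
  (integ (fun x => f x ^+ 2) + qM ^+ 2 * integ (fun x => gibbs x ^+ 2)) / (2 * (qm * integ gibbs)).

Lemma inv_mean_bound : `|al| <= mean_bound.
Proof.
have go := gdecay_osc_gibbs; have gfo := gdecayM gf go.
have sq : integ (fun x => osc_gibbs x ^+ 2) <= qM ^+ 2 * integ (fun x => gibbs x ^+ 2).
  apply: integ_sqr_le; [exact: go|exact: gdecay_gibbs|exact: ltW|] => x.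
  rewrite /osc_gibbs normrM mulrC ler_wpM2r// ger0_norm ?expR_ge0//.
  by case/andP: (qb (x / eps)).
have nI : `|integ (fun x => f x * osc_gibbs x)| <=
    (integ (fun x => f x ^+ 2) + integ (fun x => osc_gibbs x ^+ 2)) / 2.
  apply: (@le_trans _ _ (1 * integ (fun x => 2^-1 * (f x ^+ 2 + osc_gibbs x ^+ 2)))).
    apply: (@gdecay_le_integ R setT) => //.
    - by apply: gdecayZ; apply: gdecayD; exact: gdecay_sqr.
    - by move=> x; apply: mulr_ge0 => //; apply: addr_ge0; exact: sqr_ge0.
    move=> t _; rewrite mul1r normrM -(real_normK (num_real (f t))).
    rewrite -(real_normK (num_real (osc_gibbs t))).
    have := sqr_ge0 (`|f t| - `|osc_gibbs t|); rewrite sqrrB; lra.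
  rewrite mul1r integZ; last by apply: gdecayD; exact: gdecay_sqr.
  by rewrite (integD (gdecay_sqr gf) (gdecay_sqr go)) mulrC lexx.
rewrite /al /inv_mean normrM normfV (gtr0_norm I0) /mean_bound.
have i0 := integ_gibbs_gt0.
apply: (@le_trans _ _ ((integ (fun x => f x ^+ 2) + qM ^+ 2 * integ (fun x => gibbs x ^+ 2)) / 2
   / integ osc_gibbs)).
  by rewrite ler_pM2r ?invr_gt0//; apply: le_trans nI _; rewrite ler_pM2r ?invr_gt0// lerD2l.
rewrite -mulrA -invfM ler_wpM2l//.
  by apply: addr_ge0; [|apply: mulr_ge0; [exact: sqr_ge0|]]; apply: integ_ge0 => x; exact: sqr_ge0.
rewrite lef_pV2 ?posrE ?mulr_gt0// ler_pM2l//; exact: integ_osc_gibbs_ge.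
Qed.

(** The test function enters only through the integral of its square, and the small scale only
    through [qm] and [qM]; hence the uniformity in the Hermite index and in [eps]. *)
Definition poisson_bound : R := s2^-1 * (Kd * (qM / qm) *
  (mean_bound * J r + (integ (fun x => f x ^+ 2) + J (2 * r)) / 2)).

(** As [g] has mean zero, its primitive can be read as an integral over the half-line from [x] away
    from the origin. There the weight at [t] is at most a constant times the weight at [x] times a
    Gaussian in [t - x], so the division leaves [(|al| + |f|)] against that Gaussian, which [k]
    majorises. *)
Lemma poisson_sol_bound x : `|poisson_sol x| <= poisson_bound.
Proof.
pose k t := mean_bound * gauss r x t + 2^-1 * (f t ^+ 2 + gauss (2 * r) x t).
have r20 : 0 < 2 * r by rewrite mulr_gt0.
have gk : gdecay k.
  apply: gdecayD; apply: gdecayZ; first exact: gdecay_gauss.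
  by apply: gdecayD; [exact: gdecay_sqr|exact: gdecay_gauss].
have mb0 : 0 <= mean_bound := le_trans (normr_ge0 _) inv_mean_bound.
have k0 t : 0 <= k t.
  apply: addr_ge0; first by rewrite mulr_ge0 ?gauss_ge0.
  by apply: mulr_ge0 => //; apply: addr_ge0; rewrite ?gauss_ge0 ?sqr_ge0.
have Ik : integ k = mean_bound * J r + (integ (fun x => f x ^+ 2) + J (2 * r)) / 2.
  have h1 := gdecay_gauss x r0; have h2 := gdecay_gauss x r20; have h3 := gdecay_sqr gf.
  rewrite /k integD; [|exact: gdecayZ|by apply: gdecayZ; exact: gdecayD].
  rewrite !integZ//; last exact: gdecayD.
  rewrite (integD h3 h2) (integ_gauss_shift x r0) (integ_gauss_shift x r20) /J.
  by congr (_ + _); exact: mulrC.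
have qq : 0 <= qM / qm by rewrite divr_ge0// ltW.
pose K := Kd * (qM / qm) * osc_gibbs x.
have K0 : 0 <= K.
  by apply: mulr_ge0; [apply: mulr_ge0 => //; exact: expR_ge0|exact/ltW/osc_gibbs_gt0].
have pt t : (t <= x <= 0) || (0 <= x <= t) -> `|g t| <= K * k t.
  move=> h.
  have o1 : osc_gibbs t <= K * gauss r x t.
    rewrite /osc_gibbs; have /andP[_ q1] := qb (t / eps); have /andP[q2 _] := qb (x / eps).
    apply: (@le_trans _ _ (Kd * gibbs x * gauss r x t * qM)).
      by apply: ler_pM; rewrite ?expR_ge0//; exact: gibbs_decay.
    rewrite /K /osc_gibbs.
    have -> : Kd * (qM / qm) * (gibbs x * mod_factor (x / eps)) * gauss r x t =
       (Kd * gibbs x * gauss r x t * qM) * (mod_factor (x / eps) / qm) by ring.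
    apply: ler_peMr; last by rewrite ler_pdivlMr// mul1r.
    by rewrite !mulr_ge0 ?expR_ge0 ?gauss_ge0// ltW.
  have -> : g t = (al - f t) * osc_gibbs t by rewrite /g; ring.
  rewrite normrM (gtr0_norm (osc_gibbs_gt0 t)).
  have gsq : gauss r x t * gauss r x t = gauss (2 * r) x t.
    by rewrite /gauss -expRD; congr expR; ring.
  have ft : (`|al| + `|f t|) * gauss r x t <= k t.
    rewrite mulrDl /k; apply: lerD; first by rewrite ler_wpM2r ?gauss_ge0// inv_mean_bound.
    rewrite -(real_normK (num_real (f t))) -gsq.
    have := sqr_ge0 (`|f t| - gauss r x t); rewrite sqrrB; lra.
  apply: (@le_trans _ _ ((`|al| + `|f t|) * (K * gauss r x t))).
    by apply: ler_pM => //; [exact/ltW/osc_gibbs_gt0|exact: ler_normB].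
  by rewrite mulrCA ler_wpM2l.
rewrite /poisson_sol normrM gtr0_norm ?invr_gt0// /poisson_bound ler_pM2l ?invr_gt0//.
rewrite normrM (@ger0_norm _ (_^-1)) ?invr_ge0 ?(ltW (osc_gibbs_gt0 x))//.
rewrite ler_pdivrMr ?osc_gibbs_gt0// -Ik mulrAC.
case: (leP x 0) => [x0|/ltW x0].
  by apply: primitive_left => // t tx; apply: pt; rewrite tx x0.
have := @primitive_right R g k K x gg gk k0 K0; rewrite g_mean0 sub0r normrN; apply => t tx.
by apply: pt; rewrite tx x0 orbT.
Qed.

End PoissonEquation.

(** * Passage to the limit and Gaussian cutoffs *)

Section CutoffAndFatou.
Context {R : realType}.
Implicit Types (f g v b : R -> R).

(** The limit inherits measurability along with the bound; this is how time averages of [X] are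
    shown to be measurable. *)
Lemma fatou_bound d (Om : measurableType d) (P : probability Om R)
    (A : nat -> Om -> R) (Z : Om -> R) (c : R) :
  (forall m, measurable_fun setT (A m)) -> (forall om, A ^~ om @ \oo --> Z om) ->
  (forall m, (\int[P]_om ((A m om) ^+ 2)%:E <= c%:E)%E) ->
  measurable_fun setT Z /\ (\int[P]_om ((Z om) ^+ 2)%:E <= c%:E)%E.
Proof.
move=> mA AZ bA; split; first by apply: (measurable_fun_cvg mA) => om _; exact: AZ.
have mA2 m : measurable_fun setT (fun om => ((A m om) ^+ 2)%:E).
  by apply/measurable_EFinP; exact: measurable_funX.
have A20 m om : setT om -> (0 <= ((A m om) ^+ 2)%:E)%E by rewrite lee_fin sqr_ge0.
have := fatou P measurableT mA2 A20.
have h om : (fun m => ((A m om) ^+ 2)%:E) @ \oo --> ((Z om) ^+ 2)%:E.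
  apply: cvg_EFin; first exact: nearW.
  rewrite expr2 (_ : fine \o _ = (A ^~ om) * (A ^~ om)); first exact: cvgM (AZ om) (AZ om).
  by apply/funext => m /=; rewrite expr2.
rewrite (eq_integral (fun om => ((Z om) ^+ 2)%:E)); last first.
  by move=> om _; rewrite (cvg_limn_einf_sup (h om)).1.
move=> /le_trans; apply; rewrite limn_einf_lim; apply: lime_le.
  exact: is_cvg_einfs.
by apply: nearW => m; apply: le_trans (bA m); apply: ereal_inf_lbound; exists m => /=.
Qed.

Definition cutoff (k x : R) : R := gauss k 0 x.

Lemma cutoff_deriv (k : R) : has_deriv (cutoff k) (fun x => - (2 * k) * x * cutoff k x).
Proof.
rewrite /cutoff /gauss; under [X in has_deriv X _]eq_fun do rewrite subr0 expr2.
apply: has_deriv_eq (has_deriv_exp (has_derivN (has_derivZ k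
  (has_derivM has_deriv_id has_deriv_id)))) _ => x.
by rewrite subr0 -expr2; congr (_ * _); ring.
Qed.

Lemma cutoff_near1 (k x : R) : 0 <= k -> `|cutoff k x - 1| <= k * x ^+ 2.
Proof.
move=> k0; rewrite /cutoff /gauss subr0; have kx : 0 <= k * x ^+ 2 by rewrite mulr_ge0 ?sqr_ge0.
have h1 := expR_ge1Dx (- (k * x ^+ 2)); have h2 := expRN_le1 kx.
by rewrite ler_norml; lra.
Qed.

Lemma cutoff_le1 (k x : R) : 0 <= k -> `|cutoff k x| <= 1.
Proof.
move=> k0; rewrite ger0_norm ?gauss_ge0//; apply: expRN_le1.
by rewrite mulr_ge0// sqr_ge0.
Qed.

(* Multiplication by a wide Gaussian makes all the derivatives needed for the
   Ito expansion bounded while moving the values only by O(k) on compacts. *)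
Lemma cutoff_truncation (v v1 v2 : R -> R) (k : R) : 0 < k ->
  has_deriv v v1 -> has_deriv v1 v2 -> pgrowth v -> pgrowth v1 -> pgrowth v2 ->
  let vk := fun x => v x * cutoff k x in
  let wk := fun x => v1 x * cutoff k x + v x * (- (2 * k) * x * cutoff k x) in
  exists zk Kw Kz, [/\ has_deriv vk wk, has_deriv wk zk,
    forall x, `|wk x| <= Kw & forall x, `|zk x| <= Kz].
Proof.
move=> k0 dv dv1 pv pv1 pv2 vk wk.
have gc : gdecay (cutoff k) := gdecay_gauss 0 k0.
pose zk x := (v2 x * cutoff k x + v1 x * (- (2 * k) * x * cutoff k x)) +
  (v1 x * (- (2 * k) * x * cutoff k x) +
   v x * (- (2 * k) * cutoff k x + - (2 * k) * x * (- (2 * k) * x * cutoff k x))).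
have gM q : pgrowth q -> gdecay (fun x => q x * cutoff k x).
  by move=> pq; apply: eq_gdecay (gdecayMp gc pq) _ => x; rewrite mulrC.
have pk : pgrowth (fun x : R => - (2 * k) * x) by apply: pgrowthZ; exact: pgrowth_id.
have gw : gdecay wk.
  apply: gdecayD; first exact: gM.
  by apply: eq_gdecay (gM _ (pgrowthM pv pk)) _ => x; ring.
have gz : gdecay zk.
  have g1 : gdecay (fun x => v1 x * (- (2 * k) * x * cutoff k x)).
    by apply: eq_gdecay (gM _ (pgrowthM pv1 pk)) _ => x; ring.
  apply: gdecayD; first by apply: gdecayD => //; exact: gM.
  apply: gdecayD => //.
  have p3 := pgrowthM pv (pgrowthD (pgrowth_cst (- (2 * k))) (pgrowthM pk pk)).
  by apply: eq_gdecay (gM _ p3) _ => x; ring.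
have [Kw hw] := gdecay_bounded gw; have [Kz hz] := gdecay_bounded gz.
exists zk, Kw, Kz; split => //; first exact: has_derivM dv (cutoff_deriv k).
apply: has_deriv_eq (has_derivD (has_derivM dv1 (cutoff_deriv k))
  (has_derivM dv (has_derivM (has_derivZ (- (2 * k)) has_deriv_id) (cutoff_deriv k)))) _ => x.
by rewrite /zk mulr1.
Qed.

Lemma exists_steps (T D : R) : 0 < T -> exists2 n : nat, (0 < n)%N & T / n%:R * D <= 1.
Proof.
move=> T0; exists (Num.truncn (T * `|D|)).+1 => //.
have n0 : 0 < (Num.truncn (T * `|D|)).+1%:R :> R by rewrite ltr0n.
apply: (@le_trans _ _ (T * `|D| / (Num.truncn (T * `|D|)).+1%:R)).
  rewrite mulrAC ler_pM2r ?invr_gt0// ler_pM2l//; exact: ler_norm.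
by rewrite ler_pdivrMr// mul1r; exact/ltW/truncnS_gt.
Qed.

End CutoffAndFatou.

(** * Mean square bound for time averages of the diffusion *)

Section TimeAverage.
Context {R : realType} {d : measure_display} {Om : measurableType d} (P : probability Om R).
Local Notation rT := (measurableTypeR R).
Local Notation leb := (@lebesgue_measure R).
Variables (W X : Om -> R -> R) (s x0 K Cv Ce T : R) (M0 : nat) (b g v v1 v2 : R -> R).
Hypothesis bm : is_brownian_motion P W.
Hypotheses (T0 : 0 < T) (s0 : 0 <= s) (K0 : 0 <= K).
Hypothesis lipb : forall x y, `|b x - b y| <= K * `|x - y|.
Hypotheses (dv : has_deriv v v1) (dv1 : has_deriv v1 v2).
Hypotheses (pv1 : pgrowth v1) (pv2 : pgrowth v2) (bv : forall x, `|v x| <= Cv).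
Hypothesis gE : forall x, g x = s ^+ 2 / 2 * v1 x - b x * v x.
Hypothesis Ce0 : 0 <= Ce.
Hypothesis diss : forall y, - ((y - x0) * b y) <= Ce.
Hypothesis outward : forall y, M0%:R <= `|y| -> 0 <= y * b y.
Hypothesis Xc : forall om, {within `[0, +oo[, continuous (X om)}.
Hypothesis XE : forall om t, 0 <= t -> X om t = x0 -
  Rintegral leb `[0, t] (fun u => b (X om u)) + s * W om t.

Let level (m : nat) : R := (m + M0).+1%:R.
(** Clamping the argument bounds the drift, as the Ito expansion requires, and preserves its
    Lipschitz constant. *)
Let bc (m : nat) (y : R) : R := b (Num.max (- level m) (Num.min (level m) y)).
Let level0 m : 0 < level m. Proof. by rewrite ltr0n. Qed.

Let bc_lip m x y : `|bc m x - bc m y| <= K * `|x - y|.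
Proof.
by apply: le_trans (lipb _ _) _; rewrite ler_wpM2l// clamp_lip// ltW.
Qed.

Let bc_id m y : `|y| <= m%:R -> bc m y = b y.
Proof.
move=> h; rewrite /bc clamp_id//; apply: le_trans h _.
by rewrite ler_nat ltnW// ltnS leq_addr.
Qed.

Let bc_diss m y : - ((y - x0) * bc m y) <= Ce.
Proof.
have lM : M0%:R <= `|level m| by rewrite gtr0_norm// ler_nat ltnW// ltnS leq_addl.
have lM' : M0%:R <= `|- level m| by rewrite normrN.
have lp := level0 m.
rewrite /bc; have [->//|[-> h]|[-> h]] := clampE y (ltW lp).
- have o2 := diss (level m); have := outward lM => o1.
  rewrite pmulr_rge0// in o1.
  have yl : 0 <= y - level m by rewrite subr_ge0.
  by have := mulr_ge0 yl o1; lra.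
- have o2 := diss (- level m); have := outward lM' => o1.
  rewrite mulNr oppr_ge0 pmulr_rle0// in o1.
  have yl : y + level m <= 0 by lra.
  by have := mulr_le0 yl o1; lra.
Qed.

(** The bound of [euler_ergodic] with the quantities proportional to the step size replaced by 1. *)
Let Ctot : R := 2 * (expR 1 * T * (2 * Cv ^+ 2 * s ^+ 2 + 1)) +
  2 * Cv ^+ 2 * (T * (2 * Ce + s ^+ 2 + 1)).

Let rate (m : nat) : R := m.+1%:R^-1.
Let vc (m : nat) (x : R) := v x * cutoff (rate m) x.
Let wc (m : nat) (x : R) := v1 x * cutoff (rate m) x +
  v x * (- (2 * rate m) * x * cutoff (rate m) x).
Let genc (m : nat) (y : R) := s ^+ 2 / 2 * wc m y - bc m y * vc m y.

Let rate_gt0 m : 0 < rate m. Proof. by rewrite invr_gt0 ltr0n. Qed.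

Let W0 om : W om 0 = 0. Proof. by case: bm => _ []. Qed.

Let incr (h : R) (k : nat) (om : Om) : R := W om (k.+1%:R * h) - W om (k%:R * h).

Let measurable_incr h k : 0 <= h -> measurable_fun setT (incr h k : Om -> rT).
Proof.
by move=> h0; case: bm => mW _; apply: measurable_funB; apply: mW; rewrite mulr_ge0.
Qed.

Let incr_indep tau n (A : nat -> set rT) : 0 < tau -> (forall i, measurable (A i)) ->
  fine (P (\bigcap_(i in `I_n) [set t | A i (incr (tau ^+ 2) i t)])) =
  \prod_(i < n) fine (normal_prob 0 tau (A i)).
Proof.
move=> t0 mA; case: bm => _ [_ [_ hi]].
rewrite (hi n (fun i => i%:R * tau ^+ 2) _ _ A mA).
- apply: eq_bigr => i _; congr (fine (normal_prob 0 _ (A i))).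
  have -> : i.+1%:R * tau ^+ 2 - i%:R * tau ^+ 2 = tau ^+ 2 by rewrite -natr1; ring.
  by rewrite sqrtr_sqr gtr0_norm.
- by rewrite mul0r.
- by move=> i _; rewrite ltr_pM2r ?exprn_gt0// ltr_nat.
Qed.

(** All that the limit needs from the [m]-th scheme (number of steps, step size, path), packed so
    that a whole sequence can be chosen at once. *)
Let approx m (q : nat * R * (Om -> nat -> R)) :=
  let: (n, h, Y) := q in
  [/\ [/\ 0 < h, n%:R * h = T & h <= rate m],
   forall om, Y om 0%N = x0 /\ forall k, Y om k.+1 = Y om k - bc m (Y om k) * h + s * incr h k om,
   measurable_fun setT (fun om => h * \sum_(k < n) genc m (Y om k)) &
   (\int[P]_om ((h * \sum_(k < n) genc m (Y om k)) ^+ 2)%:E <= Ctot%:E)%E].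

Let pv : pgrowth v. Proof. exact: pgrowth_bounded (has_deriv_cont dv) bv. Qed.

Let cont_b : continuous b. Proof. exact: lip_cont lipb. Qed.

Let cont_bc m : continuous (bc m). Proof. exact: lip_cont (bc_lip m). Qed.

(** The clamp and the cutoff are fixed first, and with them [B], [Kw] and [Kz], which depend on [m].
    The step size is chosen afterwards, so these constants do not reach [Ctot]. *)
Let approx_exists m : exists q, approx m q.
Proof.
have [z [Kw [Kz [dvk dwk bw bz]]]] := cutoff_truncation (rate_gt0 m) dv dv1 pv pv1 pv2.
have [u du] := has_antideriv (has_deriv_cont dvk).
have [B B0 hB] := cont_bounded (ltW (level0 m)) cont_b.
have bcB x : `|bc m x| <= B by apply: hB; apply: clamp_bounded; exact: ltW.
have bvk x : `|v x * cutoff (rate m) x| <= Cv.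
  rewrite normrM -[leRHS]mulr1; apply: ler_pM => //.
  by apply: cutoff_le1; exact: ltW.
pose Q := (ito_bias Kw Kz B s) ^+ 2 * T + 2 * (2 * Cv * B + s ^+ 2 / 2 * Kw) ^+ 2.
have Q0 : 0 <= Q.
  apply: addr_ge0; first by apply: mulr_ge0; [exact: sqr_ge0|exact: ltW].
  by apply: mulr_ge0 => //; exact: sqr_ge0.
have B20 : 0 <= B ^+ 2 := sqr_ge0 B.
(* One step size meets four smallness conditions, since the summands are nonnegative: [h <= 1],
   [h <= rate m], [h B^2 <= 1] and [h Q <= 1]. *)
have [n n0 hn] := exists_steps (1 + m.+1%:R + B ^+ 2 + Q) T0.
pose h := T / n%:R; have h0 : 0 < h by rewrite divr_gt0// ltr0n.
pose tau := Num.sqrt h; have tau0 : 0 < tau by rewrite sqrtr_gt0.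
have hE : h = tau ^+ 2 by rewrite sqr_sqrtr// ltW.
rewrite -/h in hn.
have hm1 : 0 <= h * m.+1%:R by rewrite mulr_ge0// ltW.
have hB0 : 0 <= h * B ^+ 2 by rewrite mulr_ge0// ltW.
have hQ0 : 0 <= h * Q by rewrite mulr_ge0// ltW.
have [h1 hm hB1 hQ1] : [/\ h <= 1, h * m.+1%:R <= 1, h * B ^+ 2 <= 1 & h * Q <= 1].
  have e : h * (1 + m.+1%:R + B ^+ 2 + Q) = h + h * m.+1%:R + h * B ^+ 2 + h * Q.
    by rewrite (mulrDr h _ Q) 2!(mulrDr h) mulr1.
  by move: hn; rewrite e => hn; split; lra.
have tau1 : tau <= 1.
  rewrite leNgt; apply/negP => t1; have : 1 * 1 < tau * tau by rewrite ltr_pM.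
  by rewrite -(expr2 tau) -hE mulr1; lra.
have nh : n%:R * h = T by rewrite /h mulrC mulfVK// gt_eqF// ltr0n.
pose C1 := 2 * Ce + s ^+ 2 + 1.
have C10 : 0 <= C1 by rewrite !addr_ge0// ?mulr_ge0// sqr_ge0.
have dis y : (y - x0 - bc m y * h) ^+ 2 + s ^+ 2 * h <= (y - x0) ^+ 2 + h * C1.
  have b2 : bc m y ^+ 2 <= B ^+ 2.
    by rewrite -(real_normK (num_real (bc m y))) lerXn2r ?nnegrE.
  have hb : h * (h * bc m y ^+ 2) <= h * 1.
    apply: ler_wpM2l; first exact: ltW.
    by apply: le_trans hB1; rewrite ler_wpM2l// ltW.
  have := ler_wpM2l (ltW h0) (bc_diss m y).
  rewrite -subr_ge0 => hd; rewrite -subr_ge0.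
  have -> : (y - x0) ^+ 2 + h * C1 - ((y - x0 - bc m y * h) ^+ 2 + s ^+ 2 * h) =
     2 * (h * Ce - h * - ((y - x0) * bc m y)) + (h * 1 - h * (h * bc m y ^+ 2)).
    by rewrite /C1; ring.
  by apply: addr_ge0; [exact: mulr_ge0|rewrite subr_ge0].
have t20 : 0 <= tau ^+ 2 := sqr_ge0 tau.
have mi k := measurable_incr k t20.
have ind N (A : nat -> set rT) (mA : forall i, measurable (A i)) := incr_indep N tau0 mA.
rewrite hE in dis.
have TE : T = n%:R * tau ^+ 2 by rewrite -hE.
exists (n, tau ^+ 2, fun om k => euler tau s x0 (bc m) (incr (tau ^+ 2)) om k).
have mY := measurable_euler tau s x0 (@cont_bc m) du dvk dwk mi.
split.
- by rewrite -hE; split => //; rewrite /rate -[leRHS]mul1r ler_pdivlMr// ltr0n.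
- by move=> om; split.
- apply: measurable_funM => //; apply: measurable_sum => k.
  have cgen : continuous (genc m).
    apply: contD; first by apply: contM; [exact: cont_cst|exact: has_deriv_cont dwk].
    by apply: contN; apply: contM => //; exact: has_deriv_cont dvk.
  exact: (measurableT_comp (continuous_measurable_fun cgen) (mY k)).
- have := @euler_ergodic R d Om P tau s x0 (bc m) u (vc m) (wc m) z Cv Kw Kz B C1 tau0 tau1 s0 B0
    (@cont_bc m) bcB du dvk dwk bvk bw bz (incr (tau ^+ 2)) mi ind n n0 dis C10 T TE.
  move=> /le_trans; apply; rewrite lee_fin /Ctot lerD2r ler_wpM2l// ler_wpM2l//.
    by rewrite mulr_ge0 ?expR_ge0// ltW.
  by rewrite lerD2l -hE mulrC; move: hQ1; rewrite mulrC.
Qed.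

Lemma time_average_bound :
  let Z := fun om => Rintegral leb `[0, T] (fun t => g (X om t)) in
  measurable_fun setT Z /\ (\int[P]_om ((Z om) ^+ 2)%:E <= Ctot%:E)%E.
Proof.
move=> Z.
have [q hq] := choice approx_exists.
pose nn m := (q m).1.1; pose hh m := (q m).1.2; pose Y m := (q m).2.
have qE m : approx m (nn m, hh m, Y m) by have := hq m; rewrite /nn /hh /Y; case: (q m) => [[]].
apply: (@fatou_bound R _ _ P (fun m om => hh m * \sum_(k < nn m) genc m (Y m om k))).
- by move=> m; case: (qE m).
- move=> om.
  pose x t := X om (Num.max t 0).
  have cx : continuous x := cont_extend (@Xc om).
  have xX t : 0 <= t -> x t = X om t by move=> t0; rewrite /x (max_idPl t0).
  have cbx : continuous (fun t => b (x t)) := cont_comp (@cont_b) cx.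
  have cg : continuous g.
    rewrite (_ : g = fun x => s ^+ 2 / 2 * v1 x - b x * v x); last by apply/funext.
    apply: contD; first by apply: contM; [exact: cont_cst|exact: has_deriv_cont dv1].
    by apply: contN; apply: contM => //; exact: has_deriv_cont dv.
  have cgx : continuous (fun t => g (x t)) := cont_comp cg cx.
  have [Bf dB] := has_antideriv cbx; have [G dG] := has_antideriv cgx.
  have rint (f : R -> R) F t : 0 <= t -> continuous (fun u => f (x u)) ->
      has_deriv F (fun u => f (x u)) ->
      Rintegral leb `[0, t] (fun u => f (X om u)) = F t - F 0.
    move=> t0 cf dF; rewrite -(Rintegral_deriv t0 cf dF).
    apply: eq_Rintegral => u; rewrite inE/= in_itv/= => /andP[u0 _].
    by rewrite xX.
  rewrite /Z (rint g G T (ltW T0) cgx dG).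
  apply: (@euler_riemann R x (W om) Bf G b g x0 s K T bc genc (fun m => Y m om) nn hh) => //.
  + by move=> t t0; rewrite xX// XE// (rint b Bf t t0 cbx dB).
  + by move=> m; case: (qE m) => [[]].
  + by move=> m; case: (qE m) => [[]].
  + apply/cvgrPdist_le => e e0.
    exists (Num.truncn e^-1).+1 => // m /= em; have [[h0 _ hr] _ _ _] := qE m.
    rewrite sub0r normrN gtr0_norm//; apply: le_trans hr _.
    rewrite /rate -[leRHS]invrK lef_pV2 ?posrE ?invr_gt0//.
    apply: (le_trans (ltW (truncnS_gt _))); rewrite ler_nat.
    exact: leq_trans em (leqnSn _).
  + by move=> m; case: (qE m) => _ /(_ om)[].
  + by move=> m k; case: (qE m) => _ /(_ om)[_ /(_ k)].
  + move=> A e e0; pose A' := `|A| + 1; have A'0 : 0 <= A' by rewrite addr_ge0.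
    have [Bv Bv0 hv] := cont_bounded A'0 (has_deriv_cont dv).
    have [Bv1 Bv10 hv1] := cont_bounded A'0 (has_deriv_cont dv1).
    have [Bb Bb0 hb] := cont_bounded A'0 (@cont_b).
    (* On [|y| <= A'] the cutoff differs from 1 by at most [rate m * A'^2] and its derivative is at
       most [2 * rate m * A']; [D] collects these errors without the factor [rate m]. *)
    pose D := s ^+ 2 / 2 * (Bv1 * A' ^+ 2 + Bv * (2 * A')) + Bb * (Bv * A' ^+ 2).
    have D0 : 0 <= D.
      apply: addr_ge0; last by rewrite !mulr_ge0// sqr_ge0.
      by apply: mulr_ge0; [rewrite divr_ge0// sqr_ge0|apply: addr_ge0; rewrite !mulr_ge0// sqr_ge0].
    have nm1 : \forall m \near \oo, A' <= m%:R :> R.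
      exists (Num.truncn A').+1 => // m /= km; apply/ltW.
      by rewrite (lt_le_trans (truncnS_gt A'))// ler_nat.
    have nm2 : \forall m \near \oo, rate m * D <= e.
      exists (Num.truncn (D / e)).+1 => // m /= km.
      rewrite /rate mulrC ler_pdivrMr ?ltr0n// mulrC -ler_pdivrMr//.
      apply: (le_trans (ltW (truncnS_gt _))); rewrite ler_nat.
      exact: leq_trans km (leqnSn _).
    near=> m => y yA.
    have ym0 : A' <= m%:R by near: m.
    have mD : rate m * D <= e by near: m.
    have yA' : `|y| <= A' by apply: le_trans yA _; rewrite /A'; have := ler_norm A; lra.
    have ym : `|y| <= m%:R := le_trans yA' ym0.
    have k0 := ltW (rate_gt0 m).
    have c1 := @cutoff_near1 R (rate m) y k0; have c2 := @cutoff_le1 R (rate m) y k0.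
    have y2 : y ^+ 2 <= A' ^+ 2 by rewrite -(real_normK (num_real y)) lerXn2r ?nnegrE.
    have c1' : `|cutoff (rate m) y - 1| <= rate m * A' ^+ 2.
      by apply: le_trans c1 _; rewrite ler_wpM2l.
    have -> : genc m y - g y = s ^+ 2 / 2 * (v1 y * (cutoff (rate m) y - 1) +
        v y * (- (2 * rate m) * y * cutoff (rate m) y)) - b y * (v y * (cutoff (rate m) y - 1)).
      by rewrite /genc gE bc_id// /wc /vc; ring.
    apply: le_trans mD; apply: le_trans (ler_normB _ _) _; rewrite /D [leRHS]mulrDr; apply: lerD.
      rewrite normrM (@ger0_norm _ (s ^+ 2 / 2)) ?divr_ge0 ?sqr_ge0// [leRHS]mulrCA.
      apply: ler_wpM2l; first by rewrite divr_ge0 ?sqr_ge0.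
      rewrite [leRHS]mulrDr; apply: le_trans (ler_normD _ _) _; apply: lerD.
        by rewrite normrM [leRHS]mulrCA; apply: ler_pM => //; exact: hv1.
      rewrite normrM [leRHS]mulrCA; apply: ler_pM => //; first exact: hv.
      rewrite normrM -[leRHS]mulr1; apply: ler_pM => //.
      rewrite normrM normrN (ger0_norm (_ : 0 <= 2 * rate m)) ?mulr_ge0//.
      by rewrite [leRHS]mulrCA mulrA ler_wpM2l// mulr_ge0.
    rewrite normrM [leRHS]mulrCA; apply: ler_pM => //; first exact: hb.
    by rewrite normrM [leRHS]mulrCA; apply: ler_pM => //; exact: hv.
- by move=> m; case: (qE m).
Unshelve. all: by end_near. Qed.

End TimeAverage.

(** * Tools for the risk and the limit *)

Section Risk.
Context {R : realType}.
Implicit Types (f : R -> R).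

Lemma integral_integ f : gdecay f -> (\int[lebesgue_measure]_x (f x)%:E)%E = (integ f)%:E.
Proof.
move=> gf; rewrite /integ /Rintegral fineK//; apply: integrable_fin_num => //.
exact: gdecay_integrable.
Qed.

Lemma integral_sqr_hcomb f N (a : nat -> R) : gdecay f ->
  (\int[lebesgue_measure]_x ((\sum_(n < N) a n * hermite_fun n x - f x) ^+ 2)%:E)%E =
  (\sum_(n < N) (a n - hcoef f n) ^+ 2 +
   (integ (fun x => f x ^+ 2) - \sum_(n < N) hcoef f n ^+ 2))%:E.
Proof.
move=> gf; rewrite -integ_sqr_hcomb//.
apply: (@integral_integ (fun x => (\sum_(n < N) a n * hermite_fun n x - f x) ^+ 2)).
by apply: gdecay_sqr; apply: gdecayB => //; exact: gdecay_hcomb.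
Qed.

Lemma integral_sum_le (d : measure_display) (Om : measurableType d) (P : probability Om R)
    (Y : nat -> Om -> R) (a b : R) N :
  (forall n, measurable_fun setT (Y n)) -> (forall n om, 0 <= Y n om) ->
  (forall n, (\int[P]_om (Y n om)%:E <= a%:E)%E) -> 0 <= b ->
  (\int[P]_om (\sum_(n < N) Y n om + b)%:E <= (N%:R * a + b)%:E)%E.
Proof.
move=> mY Y0 Ya b0; elim: N => [|N IH].
  rewrite mul0r add0r; under eq_integral do rewrite big_ord0 add0r.
  rewrite [leLHS](_ : _ = b%:E)//.
  by transitivity (b%:E * P setT)%E; [exact: integral_cst|rewrite probability_setT mule1].
have mS : measurable_fun setT (fun om => \sum_(n < N) Y n om + b).
  by apply: measurable_funD => //; exact: measurable_sum.
rewrite (eq_integral (fun om => (Y N om)%:E + (\sum_(n < N) Y n om + b)%:E)%E); last first.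
  by move=> om _; rewrite -EFinD big_ord_recr/=; congr EFin; ring.
rewrite ge0_integralD//; last 4 first.
- by move=> om _; rewrite lee_fin.
- exact/measurable_EFinP.
- by move=> om _; rewrite lee_fin addr_ge0// sumr_ge0.
- exact/measurable_EFinP.
have -> : N.+1%:R * a + b = a + (N%:R * a + b) by rewrite -natr1; ring.
by rewrite EFinD; exact: leeD.
Qed.

Lemma nonneg_cvg0 (F : R -> \bar R) : (forall e, 0 <= F e)%E ->
  (forall eta, 0 < eta -> exists2 e0, 0 < e0 & forall e, 0 < e -> e <= e0 -> (F e <= eta%:E)%E) ->
  F e @[e --> 0^'+] --> 0%E.
Proof.
move=> F0 h; apply/fine_cvgP; split.
  have [e0 e00 he] := h 1 ltr01; near=> e.
  rewrite ge0_fin_numE//; apply: le_lt_trans (ltry 1); apply: he.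
    by near: e; exact: nbhs_right_gt.
  by near: e; exact: nbhs_right_le.
apply/cvgrPdist_le => eta eta0; have [e0 e00 he] := h eta eta0; near=> e.
have e1 : (F e <= eta%:E)%E.
  apply: he; first by near: e; exact: nbhs_right_gt.
  by near: e; exact: nbhs_right_le.
rewrite sub0r normrN /= ger0_norm ?fine_ge0//.
have fF : F e \is a fin_num by rewrite ge0_fin_numE//; apply: le_lt_trans e1 (ltry _).
by rewrite -lee_fin fineK.
Unshelve. all: by end_near. Qed.

(** Serves [1 <= ln 8] in the case [sigma = 1]; it follows from [exp (- 1/2) >= 1 / 2]. *)
Lemma expR1_le8 : expR (1 : R) <= 8.
Proof.
have h : expR (1 / 2 : R) <= 2.
  have h1 := expR_ge1Dx (- (1 / 2) : R); rewrite expRN in h1.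
  have := ler_wpM2r (expR_ge0 (1 / 2)) h1; rewrite mulVf ?gt_eqF ?expR_gt0//; lra.
have -> : (1 : R) = 1 / 2 + 1 / 2 by lra.
rewrite expRD; apply: (@le_trans _ _ (2 * 2)); last by lra.
by apply: ler_pM => //; exact: expR_ge0.
Qed.

End Risk.

(** * Statistical error, bias and total risk of the estimator *)

Section Estimator.
Context {R : realType} {d : measure_display} {Om : measurableType d} (P : probability Om R).
Local Notation leb := (@lebesgue_measure R).
Variables (sigma LV beta RR LL x0 : R) (V V1 V2 p p1 p2 : R -> R).
Variables (W : Om -> R -> R) (X : R -> Om -> R -> R).
Hypotheses (sigma0 : 0 < sigma) (LV0 : 0 < LV) (beta0 : 0 < beta) (RR1 : 1 <= RR) (LL0 : 0 < LL).
Hypotheses (dV : has_deriv V V1) (dV1 : has_deriv V1 V2) (cV2 : continuous V2).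
Hypotheses (dp : has_deriv p p1) (dp1 : has_deriv p1 p2) (cp2 : continuous p2).
Hypotheses (V00 : V 0 = 0) (pp : periodic LL p).
Hypothesis lipV : forall x y, `|V1 x - V1 y| <= LV * `|x - y|.
Hypothesis dissR : forall x, RR <= x -> beta * x <= V1 x.
Hypothesis dissL : forall x, x <= - RR -> V1 x <= beta * x.
Hypothesis bm : is_brownian_motion P W.

Local Notation s := (Num.sqrt (2 * sigma ^+ 2)).
Local Notation rho0 := (gibbs sigma V).

Hypothesis Xc : forall eps om, 0 < eps -> {within `[0, +oo[, continuous (X eps om)}.
Hypothesis XE : forall eps om t, 0 < eps -> 0 <= t -> X eps om t = x0 -
  Rintegral leb `[0, t] (fun u => drift V1 p1 eps (X eps om u)) + s * W om t.

Let periodic_deriv f f1 : has_deriv f f1 -> periodic LL f -> periodic LL f1.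
Proof.
move=> df pf x; have h := has_deriv_shift LL df.
have h' : has_deriv (fun x => f (x + LL)) f1.
  by rewrite (_ : (fun x => f (x + LL)) = f)//; apply/funext => y; rewrite pf.
exact: has_deriv_uniq h h' x.
Qed.

Let P1_bound : exists2 M, 0 <= M & forall x, `|p1 x| <= M.
Proof.
have [M hM] := periodic_bounded LL0 (has_deriv_cont dp1) (periodic_deriv dp pp).
by exists M => //; apply: le_trans (hM 0).
Qed.

Let P2_bound : exists2 M, 0 <= M & forall x, `|p2 x| <= M.
Proof.
have [M hM] := periodic_bounded LL0 cp2 (periodic_deriv dp1 (periodic_deriv dp pp)).
by exists M => //; apply: le_trans (hM 0).
Qed.

Let V1_outward y : beta * y ^+ 2 - growth_defect LV beta RR V1 <= y * V1 y.
Proof.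
have D0 := growth_defect_ge0 V1 LV0 beta0 RR1.
case: (leP RR `|y|) => yR.
  have h : beta * y ^+ 2 <= y * V1 y.
    rewrite expr2 mulrCA; case: (ltP y 0) => y0; last first.
      by rewrite (ger0_norm y0) in yR; exact: (ler_wpM2l y0 (dissR yR)).
    rewrite (ltr0_norm y0) in yR; rewrite -subr_ge0 -mulrBr; apply: mulr_le0; first exact: ltW.
    by rewrite subr_le0; apply: dissL; lra.
  lra.
have RR0 : 0 <= RR by apply: le_trans RR1.
have yR2 : y ^+ 2 <= RR ^+ 2.
  by rewrite -(real_normK (num_real y)) lerXn2r ?nnegrE// ltW.
have h1 : `|V1 y| <= `|V1 0| + LV * RR.
  have -> : V1 y = V1 0 + (V1 y - V1 0) by ring.
  apply: le_trans (ler_normD _ _) _; rewrite lerD2l; apply: le_trans (lipV _ _) _.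
  by rewrite subr0 ler_wpM2l// ltW.
have h2 : `|y * V1 y| <= RR * (`|V1 0| + LV * RR).
  by rewrite normrM; apply: ler_pM => //; exact: ltW.
have := ler_wpM2l (ltW beta0) yR2.
move: h2; rewrite ler_norml => /andP[h2 _]; rewrite /growth_defect; lra.
Qed.

Lemma drift_lip : exists2 K, 0 <= K & forall eps x y, 0 < eps -> eps <= 1 ->
  `|drift V1 p1 eps x - drift V1 p1 eps y| <= K / eps ^+ 2 * `|x - y|.
Proof.
have [M M0 hM] := P2_bound; exists (LV + M); first by rewrite addr_ge0// ltW.
move=> eps x y e0 e1.
have e2 : 1 <= (eps ^+ 2)^-1 by rewrite invf_ge1 ?exprn_gt0// exprn_ile1// ltW.
have -> : drift V1 p1 eps x - drift V1 p1 eps y =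
  (V1 x - V1 y) + eps^-1 * (p1 (x / eps) - p1 (y / eps)) by rewrite /drift; ring.
apply: le_trans (ler_normD _ _) _; rewrite mulrDl mulrDl; apply: lerD.
  apply: le_trans (lipV _ _) _; rewrite ler_wpM2r// ler_peMr// ltW//.
rewrite normrM gtr0_norm ?invr_gt0//.
have l : `|p1 (x / eps) - p1 (y / eps)| <= M * `|x / eps - y / eps|.
  by apply: has_deriv_lip dp1 _ => *.
apply: (@le_trans _ _ (eps^-1 * (M * `|x / eps - y / eps|))).
  by rewrite ler_wpM2l// invr_ge0 ltW.
rewrite -mulrBl normrM (@gtr0_norm _ eps^-1) ?invr_gt0//.
by rewrite le_eqVlt; apply/orP; left; apply/eqP; field; rewrite gt_eqF.
Qed.

(** The fast drift contributes at most a multiple of [|y| / eps] plus a constant over [eps].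
    Completing the square against [beta y^2] in [h4] gives the order [eps^-2], with
    [A ^ 2 / (4 beta)] as its part of [Cd]. *)
Lemma drift_dissipative : exists2 Cd, 0 <= Cd & forall eps y, 0 < eps -> eps <= 1 ->
  - ((y - x0) * drift V1 p1 eps y) <= Cd / eps ^+ 2.
Proof.
have [M M0 hM] := P1_bound.
have D0 := growth_defect_ge0 V1 LV0 beta0 RR1; set D := growth_defect _ _ _ _ in D0.
pose A := `|x0| * LV + M; have A0 : 0 <= A by rewrite addr_ge0// mulr_ge0// ltW.
pose Cd := D + `|x0| * `|V1 0| + M * `|x0| + A ^+ 2 / (4 * beta).
have A20 : 0 <= A ^+ 2 / (4 * beta) by rewrite divr_ge0 ?sqr_ge0// mulr_ge0// ltW.
exists Cd; first by rewrite !addr_ge0// mulr_ge0.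
move=> eps y e0 e1; pose q := eps^-1.
have q1 : 1 <= q by rewrite invf_ge1.
have q0 : 0 <= q by apply: le_trans q1.
have qq : q <= q ^+ 2 by rewrite expr2 ler_peMl.
have -> : Cd / eps ^+ 2 = Cd * q ^+ 2 by rewrite /q exprVn.
have h1 := V1_outward y; rewrite -/D in h1.
have h2 : x0 * V1 y <= `|x0| * (`|V1 0| + LV * `|y|).
  apply: le_trans (ler_norm _) _; rewrite normrM ler_wpM2l//.
  have -> : V1 y = V1 0 + (V1 y - V1 0) by ring.
  by apply: le_trans (ler_normD _ _) _; rewrite lerD2l; have := lipV y 0; rewrite subr0.
have h3 : - ((y - x0) * (q * p1 (y / eps))) <= q * M * (`|y| + `|x0|).
  apply: le_trans (ler_norm _) _; rewrite normrN normrM mulrC; apply: ler_pM => //.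
    by rewrite normrM (ger0_norm q0) ler_wpM2l.
  exact: ler_normB.
have h4 : - beta * y ^+ 2 + q * A * `|y| <= (q * A) ^+ 2 / (4 * beta).
  rewrite -(real_normK (num_real y)) -subr_ge0.
  have -> : (q * A) ^+ 2 / (4 * beta) - (- beta * `|y| ^+ 2 + q * A * `|y|) =
     (q * A - 2 * beta * `|y|) ^+ 2 / (4 * beta) by field; rewrite gt_eqF.
  by rewrite divr_ge0 ?sqr_ge0// mulr_ge0// ltW.
have h5 : 1 * (D + `|x0| * `|V1 0|) <= q ^+ 2 * (D + `|x0| * `|V1 0|).
  rewrite ler_wpM2r ?(le_trans q1 qq)//.
  by rewrite addr_ge0// mulr_ge0.
have h6 : q * (M * `|x0|) <= q ^+ 2 * (M * `|x0|) by rewrite ler_wpM2r// mulr_ge0.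
have h7 : 1 * (`|x0| * LV * `|y|) <= q * (`|x0| * LV * `|y|).
  by rewrite ler_wpM2r// !mulr_ge0// ltW.
have h8 : (q * A) ^+ 2 / (4 * beta) = q ^+ 2 * (A ^+ 2 / (4 * beta)) by field; rewrite gt_eqF.
rewrite /drift -/q /Cd /A in h4 h8 *; lra.
Qed.

(** Beyond this radius the confinement dominates the fast drift. The radius depends on [eps], but it
    enters only the clamping level and not the final bound. *)
Lemma drift_outward eps : 0 < eps -> exists M0 : nat, forall y, M0%:R <= `|y| ->
  0 <= y * drift V1 p1 eps y.
Proof.
move=> e0; have [M Mp hM] := P1_bound.
pose b := Num.max RR (M / eps / beta).
exists (Num.truncn b).+1 => y hy.
have yb : b <= `|y| by apply: le_trans hy; exact/ltW/truncnS_gt.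
have [yR yM] : RR <= `|y| /\ M / eps / beta <= `|y| by apply/andP; rewrite -ge_max.
have h1 : beta * `|y| ^+ 2 <= y * V1 y.
  rewrite real_normK ?num_real// expr2 mulrCA; case: (ltP y 0) => y0; last first.
    by rewrite (ger0_norm y0) in yR; exact: (ler_wpM2l y0 (dissR yR)).
  rewrite (ltr0_norm y0) in yR; rewrite -subr_ge0 -mulrBr; apply: mulr_le0; first exact: ltW.
  by rewrite subr_le0; apply: dissL; lra.
have h2 : - (M / eps * `|y|) <= y * (eps^-1 * p1 (y / eps)).
  have : `|y * (eps^-1 * p1 (y / eps))| <= M / eps * `|y|.
    rewrite !normrM mulrC ler_wpM2r// (@gtr0_norm _ eps^-1) ?invr_gt0// mulrC.
    by rewrite ler_wpM2r// invr_ge0 ltW.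
  by rewrite ler_norml => /andP[].
have h3 : M / eps * `|y| <= beta * `|y| ^+ 2.
  have h : M / eps <= `|y| * beta by rewrite -ler_pdivrMr.
  by have := ler_wpM2r (normr_ge0 y) h; lra.
rewrite /drift mulrDr; lra.
Qed.

(** The time integral has mean square O(T / eps^2), the [eps] dependence coming from [Cd / eps^2]
    alone; dividing by [T^2] gives the stated order. *)
Lemma alpha_hat_error : exists2 CA, 0 <= CA & forall eps T n, 0 < eps -> eps <= 1 -> 0 < T ->
  measurable_fun setT (fun om => alpha_hat (X eps om) T n) /\
  (\int[P]_om ((alpha_hat (X eps om) T n - inv_mean sigma V p eps (hermite_fun n)) ^+ 2)%:E
    <= (CA / (eps ^+ 2 * T))%:E)%E.
Proof.
have [qm [qM [qm0 qM0 qb]]] := mod_factor_bounds sigma0 LL0 dp pp.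
have [K K0 hK] := drift_lip; have [Cd Cd0 hCd] := drift_dissipative.
have [M2 M20 hM2] := P2_bound.
pose Cv := poisson_bound sigma LV beta RR V V1 qm qM (@hermite_fun R 0).
(* The bound sees the test function only through its norm, which is 1 for every Hermite function;
   index 0 stands for all. *)
have CvE n : poisson_bound sigma LV beta RR V V1 qm qM (@hermite_fun R n) = Cv.
  have nE k : integ (fun x => @hermite_fun R k x ^+ 2) = 1.
    have h := @hermite_fun_orth R k k; rewrite eqxx in h; rewrite -[RHS]h.
    by apply: eq_integ => x; rewrite expr2.
  by rewrite /Cv /poisson_bound /mean_bound !nE.
have s20 : 0 < 2 * sigma ^+ 2 by rewrite mulr_gt0// exprn_gt0.
have sE : s ^+ 2 = 2 * sigma ^+ 2 by rewrite sqr_sqrtr// ltW.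
pose CA := 2 * (expR 1 * (2 * Cv ^+ 2 * s ^+ 2 + 1)) + 2 * Cv ^+ 2 * (2 * Cd + s ^+ 2 + 1).
have c0 : 0 <= 2 * Cv ^+ 2 * s ^+ 2 + 1.
  by apply: addr_ge0 => //; apply: mulr_ge0; [apply: mulr_ge0|] => //; exact: sqr_ge0.
have c1 : 0 <= 2 * Cv ^+ 2 by apply: mulr_ge0 => //; exact: sqr_ge0.
have c2 : 0 <= s ^+ 2 + 1 by apply: addr_ge0 => //; exact: sqr_ge0.
exists CA.
  apply: addr_ge0; first by rewrite mulr_ge0// mulr_ge0// expR_ge0.
  by apply: mulr_ge0 => //; rewrite -addrA addr_ge0// mulr_ge0.
move=> eps T n e0 e1 T0.
have [M0 hM0] := drift_outward e0.
have gf := @gdecay_hermite_fun R n; have [f1 gf1 df] := @hermite_fun_deriv R n.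
set f := @hermite_fun R n in gf df *; set al := inv_mean _ _ _ _ _.
pose v := poisson_sol sigma V p eps f.
have dv := poisson_deriv sigma0 LV0 beta0 RR1 dV dp V00 lipV dissR dissL e0 qb gf.
rewrite -/al -/v in dv; set v1 := (fun x => _ / _) in dv.
have bv := poisson_sol_bound sigma0 LV0 beta0 RR1 dV dp V00 lipV dissR dissL eps qm0 qM0 qb gf.
rewrite CvE -/v in bv.
have cv := has_deriv_cont dv.
have pv := pgrowth_bounded cv bv.
pose b1 x := V2 x + eps^-1 * (eps^-1 * p2 (x / eps)).
have db : has_deriv (drift V1 p1 eps) b1.
  exact: has_derivD dV1 (has_derivZ eps^-1 (has_deriv_scale eps dp1)).
have lipb x y := hK eps x y e0 e1.
have Ke0 : 0 <= K / eps ^+ 2 by rewrite divr_ge0// sqr_ge0.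
have pb : pgrowth (drift V1 p1 eps).
  apply: (@pgrowth_lin _ _ `|drift V1 p1 eps 0| (K / eps ^+ 2)) => //.
    exact: has_deriv_cont db.
  move=> x; have := lipb x 0; rewrite subr0 => h.
  have -> : drift V1 p1 eps x = drift V1 p1 eps 0 + (drift V1 p1 eps x - drift V1 p1 eps 0) by ring.
  by apply: le_trans (ler_normD _ _) _; rewrite lerD2l.
have pb1 : pgrowth b1.
  apply: (@pgrowth_bounded _ _ (LV + eps^-1 * (eps^-1 * M2))).
    apply: contD => //; apply: contM; first exact: cont_cst.
    by apply: contM; [exact: cont_cst|exact: cont_scale].
  move=> x; apply: le_trans (ler_normD _ _) _; apply: lerD; first exact: V2_bound dV1 cV2 lipV x.
  by rewrite !normrM !(@gtr0_norm _ eps^-1) ?invr_gt0// !ler_wpM2l ?invr_ge0// ltW.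
have pf := gdecay_pgrowth gf; have pf1 := gdecay_pgrowth gf1.
have pv1 : pgrowth v1.
  have h := pgrowthZ (sigma ^+ 2)^-1 (pgrowthD (pgrowthD (pgrowth_cst al) (pgrowthZ (-1) pf))
    (pgrowthM pb pv)).
  by apply: eq_pgrowth h _ => x; rewrite /v1; ring.
pose v2 x := (sigma ^+ 2)^-1 * (- f1 x + (b1 x * v x + drift V1 p1 eps x * v1 x)).
have dv1 : has_deriv v1 v2.
  have h := has_derivZ (sigma ^+ 2)^-1 (has_derivD (has_derivB (has_deriv_cst al) df) (has_derivM db dv)).
  rewrite (_ : v1 = fun x => (sigma ^+ 2)^-1 * (al - f x + drift V1 p1 eps x * v x)); last first.
    by apply/funext => x; rewrite /v1 mulrC.
  by apply: has_deriv_eq h _ => x; rewrite /v2 sub0r.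
have pv2 : pgrowth v2.
  apply: pgrowthZ; apply: pgrowthD.
    by apply: eq_pgrowth (pgrowthZ (-1) pf1) _ => x; rewrite mulN1r.
  by apply: pgrowthD; exact: pgrowthM.
have gE x : al - f x = s ^+ 2 / 2 * v1 x - drift V1 p1 eps x * v x.
  by rewrite sE /v1; field; rewrite gt_eqF.
have Ce0 : 0 <= Cd / eps ^+ 2 by rewrite divr_ge0// sqr_ge0.
have [mZ bZ] := @time_average_bound R d Om P W (X eps) s x0 (K / eps ^+ 2) Cv (Cd / eps ^+ 2) T M0
  (drift V1 p1 eps) (fun x => al - f x) v v1 v2 bm T0 (sqrtr_ge0 _) Ke0 lipb dv dv1 pv1 pv2 bv gE
  Ce0 (fun y => hCd eps y e0 e1) hM0 (fun om => @Xc eps om e0) (fun om t => @XE eps om t e0).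
have ZE om : Rintegral leb `[0, T] (fun t => al - f (X eps om t)) =
    T * (al - alpha_hat (X eps om) T n).
  pose x t := X eps om (Num.max t 0).
  have cx : continuous x := cont_extend (@Xc eps om e0).
  have cfx : continuous (fun t => f (x t)) := cont_comp (has_deriv_cont df) cx.
  have xX t : t \in `[0, T]%classic -> x t = X eps om t.
    by rewrite inE/= in_itv/= => /andP[t0 _]; rewrite /x (max_idPl t0).
  rewrite /alpha_hat -/f mulrBr mulVKf ?gt_eqF//.
  transitivity (Rintegral leb `[0, T] (fun t => al - f (x t))).
    by apply: eq_Rintegral => t /xX ->.
  rewrite RintegralB//; [|exact: cont_integrable (@cont_cst R al)|exact: cont_integrable cfx].
  congr (_ - _); last by apply: eq_Rintegral => t /xX ->.
  have da : has_deriv (fun t => al * t) (fun=> al).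
    by apply: has_deriv_eq (has_derivZ al (@has_deriv_id R)) _ => t; rewrite mulr1.
  by rewrite (Rintegral_deriv (ltW T0) (@cont_cst R al) da) mulr0 subr0 mulrC.
have aE om : alpha_hat (X eps om) T n - al = - T^-1 * (T * (al - alpha_hat (X eps om) T n)).
  by field; rewrite gt_eqF.
have mD : measurable_fun setT (fun om => alpha_hat (X eps om) T n - al).
  under eq_fun do rewrite aE -ZE.
  exact: measurable_funM.
split.
  rewrite (_ : (fun om => alpha_hat _ _ _) = fun om => (alpha_hat (X eps om) T n - al) + al).
    exact: measurable_funD.
  by apply/funext => om; rewrite subrK.
rewrite (eq_integral (fun om => (T^-1 ^+ 2)%:E *
    ((Rintegral leb `[0, T] (fun t => al - f (X eps om t))) ^+ 2)%:E)%E); last first.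
  by move=> om _; rewrite -EFinM ZE aE; congr EFin; ring.
rewrite ge0_integralZl//; last 3 first.
- by apply/measurable_EFinP; exact: measurable_funX.
- by move=> om _; rewrite lee_fin sqr_ge0.
- by rewrite lee_fin sqr_ge0.
apply: (@le_trans _ _ _ _ _ (lee_wpmul2l _ bZ)); first by rewrite lee_fin sqr_ge0.
rewrite -EFinM lee_fin.
have q1 : 1 <= (eps ^+ 2)^-1 by rewrite invf_ge1 ?exprn_gt0// exprn_ile1// ltW.
set q := (eps ^+ 2)^-1 in q1 bZ *.
have -> : CA / (eps ^+ 2 * T) = T^-1 * (CA * q) by rewrite invfM -/q; ring.
have -> : T^-1 ^+ 2 * (2 * (expR 1 * T * (2 * Cv ^+ 2 * s ^+ 2 + 1)) +
    2 * Cv ^+ 2 * (T * (2 * (Cd * q) + s ^+ 2 + 1))) =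
   T^-1 * (2 * (expR 1 * (2 * Cv ^+ 2 * s ^+ 2 + 1)) +
    2 * Cv ^+ 2 * (2 * (Cd * q) + s ^+ 2 + 1)) by field; rewrite gt_eqF.
apply: ler_wpM2l; first by rewrite invr_ge0 ltW.
have -> : CA * q = 2 * (expR 1 * (2 * Cv ^+ 2 * s ^+ 2 + 1)) * q +
    2 * Cv ^+ 2 * (2 * (Cd * q) + (s ^+ 2 + 1) * q) by rewrite /CA; ring.
apply: lerD.
  by rewrite ler_peMr// mulr_ge0// mulr_ge0// expR_ge0.
by rewrite ler_wpM2l// -addrA lerD2l ler_peMr.
Qed.

(** The weight is [qbar] times [rho0] plus a zero-mean oscillation. The oscillation perturbs the
    numerator, which is handled by [osc_hcoef_small], and the normalising constant, which is handled
    by [osc_integ_small] together with Bessel's inequality for [rho0]. *)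
Lemma bias_small (B : R) : 0 <= B -> B * LL ^+ 2 / 16 <= 1 / 2 ->
  forall eta : R, 0 < eta -> exists2 e0 : R, 0 < e0 &
  forall (e : R) (N : nat), 0 < e -> e <= e0 -> 2 * N%:R * e ^+ 2 <= B ->
  \sum_(n < N) (inv_mean sigma V p e (hermite_fun n) - hcoef rho0 n / integ rho0) ^+ 2 <= eta.
Proof.
move=> B0 BL eta eta0.
have [qm [qM [qm0 qM0 qb]]] := mod_factor_bounds sigma0 LL0 dp pp.
have gr := gdecay_gibbs sigma0 LV0 beta0 RR1 dV V00 lipV dissR dissL.
have [d1 [d2 [dr dr1 g1 g2]]] := gibbs_derivs sigma0 LV0 beta0 RR1 dV dV1 cV2 V00 lipV dissR dissL.
have I0 := integ_gibbs_gt0 sigma0 LV0 beta0 RR1 dV V00 lipV dissR dissL.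
have cq := mod_factor_cont sigma0 dp.
have [qbar zq] := zero_mean_decomp LL0 cq (mod_factor_periodic sigma pp).
pose q x := mod_factor sigma p x - qbar.
have cq' : continuous q by apply: contD => //; exact: cont_cst.
have pq : periodic LL q by move=> x; rewrite /q mod_factor_periodic.
have [C C0 hC] := osc_integ_small dr gr g1 LL0 cq' pq zq.
set Iw := integ rho0 in I0 *; pose J2 := integ (fun x => rho0 x ^+ 2).
have J20 : 0 <= J2 by apply: integ_ge0 => x; exact: sqr_ge0.
pose m := qm * Iw; have m0 : 0 < m by rewrite mulr_gt0.
pose eta1 := eta / 4 * m ^+ 2.
have eta10 : 0 < eta1 by rewrite mulr_gt0 ?exprn_gt0// divr_gt0.
have [e1 e10 he1] := osc_hcoef_small dr dr1 gr g1 g2 LL0 B0 BL cq' pq zq eta10.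
pose D := 2 * J2 * C ^+ 2 / (m * Iw) ^+ 2.
have mI0 : 0 < m * Iw by rewrite mulr_gt0.
have D0 : 0 <= D.
  apply: divr_ge0; last exact: sqr_ge0.
  by apply: mulr_ge0; [apply: mulr_ge0|exact: sqr_ge0].
pose e2 := Num.min 1 (eta / 2 / (D + 1)).
have D1 : 0 < D + 1 by lra.
exists (Num.min e1 e2); first by rewrite !lt_min e10 ltr01 !divr_gt0.
move=> e N ep; rewrite !le_min => /andP[h1 /andP[h2 h3]] NB.
have gw := gdecay_osc_gibbs sigma0 LV0 beta0 RR1 dV dp V00 lipV dissR dissL e qb.
have Ie : m <= integ (osc_gibbs sigma V p e).
  exact: (integ_osc_gibbs_ge sigma0 LV0 beta0 RR1 dV dp V00 lipV dissR dissL e qb).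
set Ig := integ (osc_gibbs sigma V p e) in Ie *.
have Ig0 : 0 < Ig by apply: lt_le_trans Ie.
have [Mq hMq] := periodic_bounded LL0 cq' pq.
have gq : gdecay (fun x => rho0 x * q (x / e)).
  by apply: (@gdecay_mul_bounded _ _ _ Mq) => //; exact: cont_scale.
have wE x : osc_gibbs sigma V p e x = qbar * rho0 x + rho0 x * q (x / e).
  by rewrite /osc_gibbs /q; ring.
have IgE : Ig = qbar * Iw + integ (fun x => rho0 x * q (x / e)).
  by rewrite /Ig (eq_integ wE) integD ?integZ//; exact: gdecayZ.
set Iq := integ (fun x => rho0 x * q (x / e)) in IgE.
(* Eliminating [qbar = (Ig - Iq) / Iw] separates the oscillating numerator from the normalisation
   error carried by [Iq]. *)
have cE n : inv_mean sigma V p e (hermite_fun n) - hcoef rho0 n / Iw =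
   hcoef (fun x => rho0 x * q (x / e)) n / Ig - hcoef rho0 n * (Iq / (Ig * Iw)).
  rewrite /inv_mean -/Ig.
  have -> : integ (fun x => hermite_fun n x * osc_gibbs sigma V p e x) =
      qbar * hcoef rho0 n + hcoef (fun x => rho0 x * q (x / e)) n.
    rewrite -hcoefZ// -hcoefD//; last exact: gdecayZ.
    by apply: eq_integ => x; rewrite wE.
  have -> : qbar = (Ig - Iq) / Iw by rewrite IgE addrK mulfK// gt_eqF.
  by field; rewrite !gt_eqF.
have b1 : \sum_(n < N) hcoef (fun x => rho0 x * q (x / e)) n ^+ 2 <= eta1 := he1 e N ep h1 NB.
have b2 := bessel N gr; rewrite -/J2 in b2.
have b3 := hC e ep; rewrite -/Iq in b3.
apply: (@le_trans _ _ (2 / Ig ^+ 2 * \sum_(n < N) hcoef (fun x => rho0 x * q (x / e)) n ^+ 2 +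
   2 * (Iq / (Ig * Iw)) ^+ 2 * \sum_(n < N) hcoef rho0 n ^+ 2)).
  rewrite !mulr_sumr -big_split; apply: ler_sum => i _ /=; rewrite cE -subr_ge0.
  set a := hcoef _ i; set c := hcoef rho0 i.
  have -> : 2 / Ig ^+ 2 * a ^+ 2 + 2 * (Iq / (Ig * Iw)) ^+ 2 * c ^+ 2 -
      (a / Ig - c * (Iq / (Ig * Iw))) ^+ 2 = (a / Ig + c * (Iq / (Ig * Iw))) ^+ 2.
    by field; rewrite !gt_eqF.
  exact: sqr_ge0.
have Igm : (Ig ^+ 2)^-1 <= (m ^+ 2)^-1.
  move: (Ig) (m) Ig0 m0 Ie => a b a0 b0 ab.
  by rewrite lef_pV2 ?posrE ?exprn_gt0// lerXn2r ?nnegrE// ltW.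
have t1 : 2 / Ig ^+ 2 * \sum_(n < N) hcoef (fun x => rho0 x * q (x / e)) n ^+ 2 <= eta / 2.
  have -> : eta / 2 = 2 / m ^+ 2 * eta1 by rewrite /eta1; field; rewrite gt_eqF.
  apply: ler_pM => //; last by rewrite ler_wpM2l.
  - by rewrite divr_ge0// sqr_ge0.
  - by apply: sumr_ge0 => i _; exact: sqr_ge0.
have t2 : 2 * (Iq / (Ig * Iw)) ^+ 2 * \sum_(n < N) hcoef rho0 n ^+ 2 <= D * e ^+ 2.
  have -> : D * e ^+ 2 = 2 * ((C * e) / (m * Iw)) ^+ 2 * J2.
    by rewrite /D; field; rewrite !gt_eqF.
  apply: ler_pM => //.
  - by apply: mulr_ge0 => //; exact: sqr_ge0.
  - by apply: sumr_ge0 => i _; exact: sqr_ge0.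
  rewrite ler_wpM2l// -(real_normK (num_real (Iq / _))) lerXn2r ?nnegrE//.
    by rewrite divr_ge0 ?mulr_ge0// ltW.
  rewrite normrM normfV; apply: ler_pM => //.
  rewrite gtr0_norm ?mulr_gt0// lef_pV2 ?posrE ?mulr_gt0// ler_pM2r.
  exact: Ie.
  exact: I0.
have t3 : D * e ^+ 2 <= eta / 2.
  apply: (@le_trans _ _ ((D + 1) * e)).
    apply: ler_pM => //; [exact: sqr_ge0|by lra|].
    by rewrite expr2 -[leRHS]mul1r ler_wpM2r// ltW.
  by rewrite mulrC -ler_pdivlMr.
lra.
Qed.

(** Each of the three errors receives a third of [eta]: the statistical one is at most [D1 e], the
    truncation one at most [D2 e], and the bias is made small by [bias_small]. *)
Lemma risk_small (kappa gamma zeta : R) : 0 < kappa -> 4 <= gamma -> 5 <= zeta ->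
  forall eta : R, 0 < eta -> exists2 e0 : R, 0 < e0 & forall e : R, 0 < e -> e <= e0 ->
  (\int[P]_om (\int[leb]_x ((rho_hat (X e om) (kappa * e `^ (- zeta))
     (Num.truncn (pi ^+ 2 / (gamma * LL ^+ 2 * e ^+ 2))) x - rho V sigma x) ^+ 2)%:E)
   <= eta%:E)%E.
Proof.
move=> kappa0 gamma4 zeta5 eta eta0.
have gamma0 : 0 < gamma by lra.
have [CA CA0 hA] := alpha_hat_error.
have gr := gdecay_gibbs sigma0 LV0 beta0 RR1 dV V00 lipV dissR dissL.
have [d1 [d2 [dr _ g1 _]]] := gibbs_derivs sigma0 LV0 beta0 RR1 dV dV1 cV2 V00 lipV dissR dissL.
pose Z := integ rho0.
pose f := rho V sigma.
have fE x : f x = Z^-1 * rho0 x by rewrite /f /rho mulrC.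
have gf : gdecay f by apply: eq_gdecay (gdecayZ Z^-1 gr) _ => x; rewrite fE.
have df : has_deriv f (fun x => Z^-1 * d1 x).
  rewrite (_ : f = fun x => Z^-1 * rho0 x); first exact: has_derivZ.
  by apply/funext => x; rewrite fE.
have hf n : hcoef f n = hcoef rho0 n / Z.
  by rewrite mulrC -hcoefZ//; apply: eq_integ => x; rewrite fE.
pose Q := integ (fun x => (x * f x + Z^-1 * d1 x) ^+ 2).
have Q0 : 0 <= Q by apply: integ_ge0 => x; exact: sqr_ge0.
pose tail N := integ (fun x => f x ^+ 2) - \sum_(n < N) hcoef f n ^+ 2.
have tail0 N : 0 <= tail N by rewrite subr_ge0; exact: bessel.
have tailQ N : 2 * N%:R * tail N <= Q := hermite_tail N df gf (gdecayZ _ g1).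
have pi0 : 0 < pi :> R := pi_gt0 R.
have pi2 : pi ^+ 2 <= 16 :> R.
  have h := pihalf_lt2 R.
  have h4 : pi <= 4 :> R by lra.
  by apply: (@le_trans _ _ (4 ^+ 2)); [rewrite lerXn2r ?nnegrE// ltW|lra].
(* By definition of [N], [B] bounds [2 N e^2]. Its product with [LL^2 / 16] is [pi^2 / (8 gamma)],
   at most [1 / 2] since [pi^2 <= 16] and [gamma >= 4]. *)
have [B BE] : exists B : R, B = 2 * pi ^+ 2 / (gamma * LL ^+ 2) by eexists.
have gL0 : 0 < gamma * LL ^+ 2 by rewrite mulr_gt0// exprn_gt0.
have B0 : 0 < B by rewrite BE; apply: divr_gt0 => //; apply: mulr_gt0 => //; rewrite exprn_gt0.
have BL : B * LL ^+ 2 / 16 <= 1 / 2.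
  have -> : B * LL ^+ 2 / 16 = (pi ^+ 2 / 8) / gamma.
    by rewrite BE; field; rewrite !gt_eqF.
  by rewrite ler_pdivrMr//; lra.
(* A sixth, because separating the bias from the noise doubles both squares. *)
have eta6 : 0 < eta / 6 by rewrite divr_gt0.
have [e1 e10 he1] := bias_small (ltW B0) BL eta6.
have [D1 D1E] : exists D1, D1 = B * CA / kappa by eexists.
have [D2 D2E] : exists D2, D2 = 2 * Q / B by eexists.
have D10 : 0 <= D1 by rewrite D1E; exact: divr_ge0 (mulr_ge0 (ltW B0) CA0) (ltW kappa0).
have D20 : 0 <= D2 by rewrite D2E; exact: divr_ge0 (mulr_ge0 (ler0n R 2) Q0) (ltW B0).
have D11 : 0 < D1 + 1 by lra.
have D21 : 0 < D2 + 1 by lra.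
pose e2 := Num.min (B / 4) (Num.min (eta / 3 / (D1 + 1)) (eta / 3 / (D2 + 1))).
have e20 : 0 < e2 by rewrite !lt_min !divr_gt0.
exists (Num.min 1 (Num.min e1 e2)); first by rewrite lt_min ltr01 lt_min e10.
move=> e ep; rewrite !le_min => /andP[el1 /andP[ele1 /andP[eB /andP[ed1 ed2]]]].
set N := Num.truncn _; set T := kappa * _.
have ee : e ^+ 2 <= e by rewrite expr2 ler_piMl// ltW.
have ep2 : 0 < e ^+ 2 by rewrite exprn_gt0.
pose x := B / 2 / e ^+ 2.
have NE : N = Num.truncn x.
  by rewrite /N; congr Num.truncn; rewrite /x BE; field; rewrite !gt_eqF.
(* The condition [e <= B / 4] ensures this, so that rounding down costs at most half of [x] and [N]
   stays of order [e^-2] from below, as the truncation error requires. *)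
have x2 : 2 <= x by rewrite ler_pdivlMr//; lra.
have N1 : N%:R <= x by rewrite NE truncn_le; lra.
have N2 : x / 2 <= N%:R by have := truncnS_gt x; rewrite -NE -natr1; lra.
have NB : 2 * N%:R * e ^+ 2 <= B by have := N1; rewrite ler_pdivlMr//; lra.
have T0 : 0 < T by rewrite mulr_gt0// powR_gt0.
have Tinv : T^-1 <= e ^+ 5 / kappa.
  rewrite /T powRN invfM invrK mulrC ler_wpM2r ?invr_ge0 ?(ltW kappa0)//.
  by rewrite -(powR_mulrn 5 (ltW ep)) ger_powR// ep.
have mah n := (hA e T n ep el1 T0).1; have bah n := (hA e T n ep el1 T0).2.
have bb : \sum_(n < N) (inv_mean sigma V p e (hermite_fun n) - hcoef f n) ^+ 2 <= eta / 6.
  by under eq_bigr do rewrite hf; exact: he1.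
set be := \sum_(n < N) _ in bb.
have be0 : 0 <= be by apply: sumr_ge0 => n _; exact: sqr_ge0.
pose Y n om := 2 * (alpha_hat (X e om) T n - inv_mean sigma V p e (hermite_fun n)) ^+ 2.
have Y0 n om : 0 <= Y n om by rewrite mulr_ge0// sqr_ge0.
have mY n : measurable_fun setT (Y n).
  apply: measurable_funM => //; apply: measurable_funX; apply: measurable_funB => //; exact: mah.
pose a := CA / (e ^+ 2 * T).
have Ya n : (\int[P]_om (Y n om)%:E <= (2 * a)%:E)%E.
  rewrite (eq_integral (fun om => 2%:E *
    ((alpha_hat (X e om) T n - inv_mean sigma V p e (hermite_fun n)) ^+ 2)%:E)%E); last first.
    by move=> om _; rewrite -EFinM.
  rewrite ge0_integralZl//; last first.
  - by move=> om _; rewrite lee_fin sqr_ge0.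
  - apply/measurable_EFinP; apply: measurable_funX; apply: measurable_funB => //; exact: mah.
  by rewrite EFinM; apply: lee_wpmul2l => //; exact: bah.
have t0 : 0 <= 2 * be + tail N by rewrite addr_ge0// mulr_ge0.
have mS : measurable_fun setT (fun om => \sum_(n < N) Y n om + (2 * be + tail N)).
  by apply: measurable_funD => //; exact: measurable_sum.
apply: (@le_trans _ _ (\int[P]_om (\sum_(n < N) Y n om + (2 * be + tail N))%:E)%E).
  rewrite (eq_integral (fun om =>
    (\sum_(n < N) (alpha_hat (X e om) T n - hcoef f n) ^+ 2 + tail N)%:E)); last first.
    by move=> om _; exact: (integral_sqr_hcomb N (alpha_hat (X e om) T) gf).
  apply: ge0_le_integral => //.
  - by move=> om _; rewrite lee_fin addr_ge0// sumr_ge0// => n _; exact: sqr_ge0.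
  - apply/measurable_EFinP; apply: measurable_funD => //; apply: measurable_sum => n.
    by apply: measurable_funX; apply: measurable_funB => //; exact: mah.
  - exact/measurable_EFinP.
  - move=> om _; rewrite lee_fin (addrA _ (2 * be)) lerD2r /be mulr_sumr -big_split; apply: ler_sum => n _.
    rewrite /= /Y -subr_ge0; set u := alpha_hat _ _ _; set v := inv_mean _ _ _ _ _.
    have -> : 2 * (u - v) ^+ 2 + 2 * (v - hcoef f n) ^+ 2 - (u - hcoef f n) ^+ 2 =
      ((u - v) - (v - hcoef f n)) ^+ 2 by ring.
    exact: sqr_ge0.
apply: le_trans (integral_sum_le N mY Y0 Ya t0) _; rewrite lee_fin.
have s1 : N%:R * (2 * a) <= eta / 3.
  have -> : N%:R * (2 * a) = 2 * N%:R * e ^+ 2 * (CA / e ^+ 4 * T^-1).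
    by rewrite /a; field; rewrite !gt_eqF.
  apply: (@le_trans _ _ (B * (CA / e ^+ 4 * (e ^+ 5 / kappa)))).
    have c4 : 0 <= CA / e ^+ 4 by apply: divr_ge0 => //; apply: exprn_ge0; exact: ltW.
    have Ti0 : 0 <= T^-1 by rewrite invr_ge0; exact: ltW.
    apply: ler_pM => //; [|exact: mulr_ge0|exact: ler_wpM2l].
    by apply: mulr_ge0; [exact: mulr_ge0|exact: ltW].
  have -> : B * (CA / e ^+ 4 * (e ^+ 5 / kappa)) = D1 * e.
    by rewrite D1E; field; rewrite !gt_eqF.
  move: ed1; rewrite ler_pdivlMr//; have := ltW ep; lra.
have s2 : tail N <= eta / 3.
  have h : x * tail N <= Q.
    apply: le_trans (tailQ N); rewrite ler_wpM2r//; lra.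
  have h2 : tail N <= D2 * e ^+ 2.
    have -> : D2 * e ^+ 2 = Q / x by rewrite D2E /x; field; rewrite !gt_eqF.
    by rewrite ler_pdivlMr; [rewrite mulrC|lra].
  apply: le_trans h2 _; apply: (@le_trans _ _ (D2 * e)); first exact: ler_wpM2l.
  move: ed2; rewrite ler_pdivlMr//; have := ltW ep; lra.
lra.
Qed.

End Estimator.

(** * Convergence of the risk for the prescribed parameters *)

Theorem theorem2p3 (R : realType) (LL sigma x0 : R) (V p : R -> R) (LV beta RR : R)
  (kappa gamma zeta : R)
  (d : measure_display) (Omega : measurableType d) (P : probability Omega R)
  (W : Omega -> R -> R) (X : R -> Omega -> R -> R) :
  0 < LL -> 0 < sigma ->
  C2 V -> C2 p -> V 0 = 0 -> p 0 = 0 -> (forall x, p (x + LL) = p x) ->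
  0 < LV -> (forall x y, `|derive1 V x - derive1 V y| <= LV * `|x - y|) ->
  0 < beta -> 1 <= RR ->
  (forall x, RR <= `|x| -> - Num.sg x * derive1 V x <= - beta * `|x|) ->
  is_brownian_motion P W ->
  (forall eps, 0 < eps -> solves_sde V p sigma eps x0 W (X eps)) ->
  let c := (sigma ^+ 2 + 1) / sigma ^+ 2 in
  let l := (LV + `|derive1 V 0|) / sigma ^+ 2 in
  let r := beta / sigma ^+ 2 in
  0 < kappa ->
  (if sigma == 1 then 3 + ln 8 < gamma
   else c ^+ 2 + Num.max (16 * expR (3 / 2))
                   (c / 4 * (ln `|2 / c - 1| + 2 * ln 4)) < gamma) ->
  (if r >= l then 5 < zeta else 5 * l / r < zeta) ->
  let N := fun eps : R => Num.truncn (pi ^+ 2 / (gamma * LL ^+ 2 * eps ^+ 2)) in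
  let T := fun eps : R => kappa * eps `^ (- zeta) in
  (\int[P]_w (\int[lebesgue_measure]_x
      ((rho_hat (X eps w) (T eps) (N eps) x - rho V sigma x) ^+ 2)%:E))%E
    @[eps --> 0^'+] --> 0%E.
Proof.
move=> LL0 sigma0 [V_d [V_d1 V_c]] [p_d [p_d1 p_c]] V00 _ pp LV0 lipV beta0 RR1 hdiss bm sde.
move=> c l r kappa0 hgamma hzeta N T.
have s20 : 0 < sigma ^+ 2 by rewrite exprn_gt0.
have dissR x : RR <= x -> beta * x <= derive1 V x.
  move=> hx; have x0' : 0 < x by lra.
  have := hdiss x; rewrite gtr0_sg// gtr0_norm// => /(_ hx); lra.
have dissL x : x <= - RR -> derive1 V x <= beta * x.
  move=> hx; have x0' : x < 0 by lra.
  have := hdiss x; rewrite ltr0_sg// ltr0_norm//; lra.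
(* For [sigma = 1] this is [ln 8 >= 1]; otherwise the first entry of the maximum is already at least
   16. *)
have gamma4 : 4 <= gamma.
  move: hgamma; case: ifP => _ hg.
    have : ln (expR 1) <= ln 8 :> R by rewrite ler_ln ?posrE ?expR_gt0//; exact: expR1_le8.
    by rewrite expRK; lra.
  have h1 : 1 <= expR (3 / 2) :> R by have := @expR_ge1Dx R (3 / 2); lra.
  have h2 : 16 * expR (3 / 2) <= Num.max (16 * expR (3 / 2)) (c / 4 * (ln `|2 / c - 1| + 2 * ln 4)).
    by rewrite le_max lexx.
  have := sqr_ge0 c; lra.
(* In the second case [l / r > 1], so [5 l / r] exceeds 5. *)
have zeta5 : 5 <= zeta.
  case: (leP l r) hzeta => hrl hz; first exact: ltW.
  have r0 : 0 < r by exact: divr_gt0.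
  apply/ltW/(lt_trans _ hz); rewrite ltr_pdivlMr//; lra.
have Xc eps om : 0 < eps -> {within `[0, +oo[, continuous (X eps om)} by move=> /sde /(_ om) [].
have XE eps om t : 0 < eps -> 0 <= t -> X eps om t = x0 -
    Rintegral lebesgue_measure `[0, t] (fun u => drift (derive1 V) (derive1 p) eps (X eps om u)) +
    Num.sqrt (2 * sigma ^+ 2) * W om t.
  by move=> /sde /(_ om) [_ h] /h.
apply: nonneg_cvg0.
  by move=> e; apply: integral_ge0 => om _; apply: integral_ge0 => x _; rewrite lee_fin sqr_ge0.
exact: (@risk_small R d Omega P sigma LV beta RR LL x0 V (derive1 V) (derive1 (derive1 V))
  p (derive1 p) (derive1 (derive1 p)) W X sigma0 LV0 beta0 RR1 LL0
  (has_deriv_derive1 V_d) (has_deriv_derive1 V_d1) V_c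
  (has_deriv_derive1 p_d) (has_deriv_derive1 p_d1) p_c V00 pp lipV dissR dissL bm Xc XE
  kappa gamma zeta kappa0 gamma4 zeta5).
Qed.
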